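(* Let $k$ be a positive integer and $p \in \mathbb{N}^{\mathbb{N}}$. Let $\mathscr{P}_1, \mathscr{P}_2, \dots$ be a sequence of degree $p$ branching partitions of $[0,1]^{r[k]}$. Then there exists a degree $p$ branching partition $\widetilde{\mathscr{P}}$ of $[0,1]^{r[k]}$ such that $\mathscr{P}_n$ partitionably converges to $\widetilde{\mathscr{P}}$ as $n \to \infty$ along some infinite subsequence.
   Context: All sets and functions are assumed measurable; $\mathbb{N}$ is the set of positive integers. Index sets. For a set $A$, $r(A)$ is the collection of nonempty subsets of $A$ and $r_<(A)$ the collection of nonempty proper subsets of $A$; $[k]=\{1,\dots,k\}$, $r[k]=r([k])$, $r_<[k]=r_<([k])$. For $\mathbf{x}\in[0,1]^{\mathcal{A}}$ and $\mathcal{B}\subseteq\mathcal{A}$, $\mathbf{x}_{\mathcal{B}}$ is the restriction to coordinates in $\mathcal{B}$. Functions and sets with coordinates indexed by subsets of a $j$-element set are interpreted by identifying that set with $[j]$ by any bijection (immaterial by symmetry). Symmetric objects. A function on $[0,1]^{r_<[k]}$ or $[0,1]^{r[k]}$, or a subset of $[0,1]^{r[k]}$, is symmetric if it is invariant under all coordinate permutations induced by permutations of $[k]$. A symmetric partition of $[0,1]^{r[k]}$ is an ordered partition into finitely many symmetric subsets (empty parts allowed). A $k$-uniform hypergraphon is a symmetric measurable function $W\colon[0,1]^{r_<[k]}\to[0,1]$. A symmetric subset $P\subseteq[0,1]^{r[k]}$ has associated hypergraphon $W^P(\mathbf{x}_{r_<[k]}) := \int_0^1 1_P(\mathbf{x}_{r[k]})\,dx_{[k]}$.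 Quotients and stepping. Let $k\ge2$, $W$ a $k$-uniform hypergraphon, $\mathcal{Q}=\{Q_1,\dots,Q_q\}$ a symmetric partition of $[0,1]^{r[k-1]}$. For $f=(f_1,\dots,f_k)\in[q]^k$ let $1_f(\mathbf{x})=\prod_{i=1}^k 1_{Q_{f_i}}(\mathbf{x}_{r([k]\setminus\{i\})})$, $v_f=\int_{[0,1]^{r_<[k]}}1_f\,d\mathbf{x}$, and $w_f=\frac1{v_f}\int_{[0,1]^{r_<[k]}} W\,1_f\,d\mathbf{x}$ if $v_f\neq0$, $w_f=0$ if $v_f=0$. The quotient $W/\mathcal{Q}$ is the collection of pairs $(v_f,w_f)_{f\in[q]^k}$, and $W_{\mathcal{Q}}:=\sum_{f\in[q]^k}w_f 1_f$. If $W'$ is a $k$-uniform hypergraphon and $\mathcal{Q}'$ a symmetric partition of $[0,1]^{r[k-1]}$ also with $q$ parts, with $W'/\mathcal{Q}'=(v'_f,w'_f)_f$, then $d_1(W/\mathcal{Q},W'/\mathcal{Q}'):=\sum_{f\in[q]^k}(|v_f-v'_f|+|v_fw_f-v'_fw'_f|)$. For a symmetric set $P$, $P/\mathcal{Q}:=W^P/\mathcal{Q}$. Cut norm and regularity. For symmetric $W\colon[0,1]^{r_<[k]}\to\mathbb{R}$, $$\|W\|_{\square^{k-1}}:=\sup_{u_1,\dots,u_k}\left|\int_{[0,1]^{r_<[k]}}W(\mathbf{x})\prod_{i=1}^k u_i(\mathbf{x}_{r([k]\setminus\{i\})})\,d\mathbf{x}\right|,$$ the supremum being over symmetric $u_1,\dots,u_k\colon[0,1]^{r[k-1]}\to[0,1]$.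 For a symmetric set $P\subseteq[0,1]^{r[k]}$, $(P,\mathcal{Q})$ is weakly $\epsilon$-regular if $\|W^P-(W^P)_{\mathcal{Q}}\|_{\square^{k-1}}\le\epsilon$. Branching partitions. For $p=(p_1,p_2,\dots)\in\mathbb{N}^{\mathbb{N}}$, a degree $p$ branching partition $\mathscr{P}$ of $[0,1]^{r[k]}$ consists of symmetric partitions $\mathcal{P}_0,\mathcal{P}_1,\mathcal{P}_2,\dots$ (levels) of $[0,1]^{r[k]}$, with $\mathcal{P}_0=\{[0,1]^{r[k]}\}$ and, for $l\ge1$, $\mathcal{P}_l$ a refinement of $\mathcal{P}_{l-1}$ in which each part of $\mathcal{P}_{l-1}$ is refined into exactly $p_l$ (ordered, possibly empty) parts. An index at level $l$ is $i=(i_1,\dots,i_l)\in[p_1]\times\cdots\times[p_l]$; it points to the set $P_i\in\mathcal{P}_l$ that is the $i_l$-th part in the refinement of $P_{i_1,\dots,i_{l-1}}$. If $\mathscr{P}$ is a branching partition of $[0,1]^{r[k]}$ and $\mathscr{Q}$ one of $[0,1]^{r[k-1]}$ with levels $\mathcal{Q}_s$, $(\mathscr{P},\mathscr{Q})$ is weakly $(\epsilon_1,\epsilon_2,\dots)$-regular if for every $s\ge1$ and every member $P$ of $\mathscr{P}$ of level at most $s$, $(P,\mathcal{Q}_s)$ is weakly $\epsilon_s$-regular. Partitionable convergence (defined inductively on $k$). Let $\mathscr{P}_1,\mathscr{P}_2,\dots$ and $\widetilde{\mathscr{P}}$ be degree $p$ branching partitions of $[0,1]^{r[k]}$, with index $i$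 members $P_{n,i}$ and $\widetilde P_i$. When $k=1$, $\mathscr{P}_n$ partitionably converges to $\widetilde{\mathscr{P}}$ if $\lim_{n\to\infty}\lambda(P_{n,i})=\lambda(\widetilde P_i)$ for every index $i$ of every level, where $\lambda$ is Lebesgue measure on $[0,1]$. When $k\ge2$, $\mathscr{P}_n$ partitionably converges to $\widetilde{\mathscr{P}}$ if there exist some $q\in\mathbb{N}^{\mathbb{N}}$ and degree $q$ branching partitions $\mathscr{Q}_1,\mathscr{Q}_2,\dots$ and $\widetilde{\mathscr{Q}}$ of $[0,1]^{r[k-1]}$, with level $s$ partitions $\mathcal{Q}_{n,s}$ and $\widetilde{\mathcal{Q}}_s$, such that: (a) $(\mathscr{P}_n,\mathscr{Q}_n)$ is weakly $(1,1/2,1/3,\dots)$-regular for every $n$; (b) $\mathscr{Q}_n$ partitionably converges to $\widetilde{\mathscr{Q}}$ as $n\to\infty$; (c) for every $s\ge1$ and every index $i$ (of any level $l\ge1$), $\lim_{n\to\infty}d_1(P_{n,i}/\mathcal{Q}_{n,s},\widetilde P_i/\widetilde{\mathcal{Q}}_s)=0$; (d) for every member $\widetilde P$ of $\widetilde{\mathscr{P}}$, $(W^{\widetilde P})_{\widetilde{\mathcal{Q}}_s}\to W^{\widetilde P}$ pointwise almost everywhere as $s\to\infty$. *)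

(* Defs.v *)
From HB Require Import structures.
From mathcomp Require Import all_boot all_order all_algebra perm.
From mathcomp Require Import all_classical all_reals all_analysis.
Import Order.TTheory GRing.Theory Num.Theory.
Import numFieldNormedType.Exports.

Set Implicit Arguments.
Unset Strict Implicit.
Unset Printing Implicit Defensive.

Local Open Scope classical_set_scope.
Local Open Scope ring_scope.

Definition unitI (R : realType) : Type := {x : R | 0 <= x <= 1}.

Section unit_interval.
Context (R : realType).

Let unitI0 : unitI R := exist _ 0 (introT andP (conj (lexx 0) ler01)).

HB.instance Definition _ := Choice.on (unitI R).
HB.instance Definition _ := isPointed.Build (unitI R) unitI0.

Definition unitI_measurable : set (set (unitI R)) :=
  preimage_set_system setT (@sval R (fun x => 0 <= x <= 1)) measurable.

Let unitI_sigma : sigma_algebra setT unitI_measurable.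
Proof.
apply: sigma_algebra_preimage; exact: sigma_algebra_measurable.
Qed.

Let unitI_meas0 : unitI_measurable set0.
Proof. by case: unitI_sigma. Qed.

Let unitI_measC A : unitI_measurable A -> unitI_measurable (~` A).
Proof. by case: unitI_sigma => _ + _; rewrite -setTD; exact. Qed.

Let unitI_meas_bigcup (F : (set (unitI R))^nat) :
  (forall n, unitI_measurable (F n)) -> unitI_measurable (\bigcup_n F n).
Proof. by case: unitI_sigma => _ _; exact. Qed.

HB.instance Definition _ := @isMeasurable.Build default_measure_display
  (unitI R) unitI_measurable unitI_meas0 unitI_measC unitI_meas_bigcup.

Definition unitI_lebesgue (A : set (unitI R)) : \bar R :=
  lebesgue_measure ((@sval R (fun x => 0 <= x <= 1)) @` A).

Let measurable_image (A : set (unitI R)) : measurable A ->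
  measurable ((@sval R (fun x => 0 <= x <= 1)) @` A).
Proof.
move=> [B mB <-]; rewrite setTI.
have -> : [set sval x | x in (@sval R (fun x => 0 <= x <= 1)) @^-1` B]
    = B `&` `[0, 1].
  apply/seteqP; split => [_ [[x x01] /= Bx <-]|x [Bx /=]].
    by split => //=; rewrite in_itv.
  by rewrite in_itv /= => x01; exists (exist _ x x01).
exact: measurableI.
Qed.

Let unitI_lebesgue0 : unitI_lebesgue set0 = 0%E.
Proof. by rewrite /unitI_lebesgue image_set0 measure0. Qed.

Let unitI_lebesgue_ge0 A : (0 <= unitI_lebesgue A)%E.
Proof. exact: measure_ge0. Qed.

Let unitI_lebesgue_sigma_additive : semi_sigma_additive unitI_lebesgue.
Proof.
move=> F mF tF mUF; rewrite /unitI_lebesgue image_bigcup.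
apply: measure_semi_sigma_additive.
- by move=> n; exact: measurable_image.
- apply/trivIsetP => i j _ _ ij; apply/seteqP; split => //.
  move=> _ [[x Fix <-] [y Fjy /val_inj yx]].
  move/trivIsetP : tF => /(_ _ _ I I ij) FF.
  by have : (F i `&` F j) x by [split => //; rewrite -yx]; rewrite FF.
- by rewrite -image_bigcup; exact: measurable_image.
Qed.

HB.instance Definition _ := isMeasure.Build _ _ _ unitI_lebesgue
  unitI_lebesgue0 unitI_lebesgue_ge0 unitI_lebesgue_sigma_additive.

Let unitI_lebesgueT : unitI_lebesgue setT = 1%E.
Proof.
rewrite /unitI_lebesgue.
have -> : [set sval x | x in @setT (unitI R)] = [set` `[0%R, 1%R]].
  apply/seteqP; split => [_ [[x x01] /= _ <-]|x /=].
    by rewrite in_itv.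
  by rewrite in_itv /= => x01; exists (exist _ x x01).
by rewrite lebesgue_measure_itv /= lte_fin ltr01 oppr0 adde0.
Qed.

HB.instance Definition _ := Measure_isProbability.Build _ _ _ unitI_lebesgue
  unitI_lebesgueT.

End unit_interval.

Section product_probability.
Context d1 d2 (T1 : measurableType d1) (T2 : measurableType d2) (R : realType).
Variables (P1 : probability T1 R) (P2 : probability T2 R).

Let prod := (P1 \x P2)%E.

HB.instance Definition _ := Measure.on prod.

Let prod_setT : prod setT = 1%E.
Proof.
rewrite /prod -setXTT product_measure1E//.
have -> : (P1 setT * P2 setT = 1 * 1)%E.
  by congr (_ * _)%E; exact: probability_setT.
by rewrite mule1.
Qed.

HB.instance Definition _ := Measure_isProbability.Build _ _ _ prod prod_setT.

Definition product_probability : probability (T1 * T2)%type R := prod.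

End product_probability.

Definition cube (R : realType) (I : finType) : Type := I -> unitI R.

Section cube.
Context (R : realType).

Section sigma_algebra.
Variable I : finType.

HB.instance Definition _ := Pointed.on (cube R I).

Definition cube_measurable : set (set (cube R I)) :=
  <<s \bigcup_i preimage_set_system setT (fun x : cube R I => x i) measurable >>.

Let cube_meas0 : cube_measurable set0.
Proof. exact: sigma_algebra0. Qed.

Let cube_measC A : cube_measurable A -> cube_measurable (~` A).
Proof. exact: sigma_algebraC. Qed.

Let cube_meas_bigcup (F : (set (cube R I))^nat) :
  (forall n, cube_measurable (F n)) -> cube_measurable (\bigcup_n F n).
Proof. exact: sigma_algebra_bigcup. Qed.

HB.instance Definition _ := @isMeasurable.Build default_measure_display
  (cube R I) cube_measurable cube_meas0 cube_measC cube_meas_bigcup.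

Lemma measurable_fun_cubeP d (T : measurableType d) (f : T -> cube R I) :
  (forall i, measurable_fun setT (fun t => f t i)) -> measurable_fun setT f.
Proof.
move=> mf _ A mA; rewrite setTI.
have : (cube_measurable `<=` image_set_system setT f measurable).
  apply: smallest_sub.
    by apply: sigma_algebra_image; exact: sigma_algebra_measurable.
  by move=> _ [i _ [B mB <-]]; rewrite /image_set_system /= !setTI;
    have := mf i measurableT _ mB; rewrite setTI.
by move=> /(_ A mA); rewrite /image_set_system /= setTI.
Qed.

End sigma_algebra.

Let tuple_cons n (xt : unitI R * n.-tuple (unitI R)) : n.+1.-tuple (unitI R) :=
  [tuple of xt.1 :: xt.2].

Let measurable_tuple_cons n : measurable_fun setT (@tuple_cons n).
Proof. exact: measurable_cons. Qed.

HB.instance Definition _ n :=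
  isMeasurableFun.Build _ _ _ _ (@tuple_cons n) (@measurable_tuple_cons n).

Fixpoint tuple_lebesgue (n : nat) : probability (n.-tuple (unitI R)) R :=
  match n with
  | 0 => \d_[tuple]
  | n'.+1 =>
    distribution (product_probability (@unitI_lebesgue R) (tuple_lebesgue n'))
      (@tuple_cons n')
  end.

Let cube_of_tuple (I : finType) (t : #|I|.-tuple (unitI R)) : cube R I :=
  fun i => tnth t (enum_rank i).

Let measurable_cube_of_tuple I : measurable_fun setT (@cube_of_tuple I).
Proof.
by apply: measurable_fun_cubeP => i; exact: measurable_tnth.
Qed.

HB.instance Definition _ I := isMeasurableFun.Build _ _ _ _ (@cube_of_tuple I)
  (@measurable_cube_of_tuple I).

Definition cube_lebesgue (I : finType) : probability (cube R I) R :=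
  distribution (tuple_lebesgue #|I|) (@cube_of_tuple I).

Lemma tuple_lebesgue_box n (B : 'I_n -> set (unitI R)) :
  (forall i, measurable (B i)) ->
  tuple_lebesgue n [set t | forall i, B i (tnth t i)] =
    (\prod_i unitI_lebesgue (B i))%E.
Proof.
elim: n B => [|n IHn] B mB.
  by rewrite big_ord0 /= diracE mem_set// => -[].
rewrite big_ord_recl -IHn//=.
rewrite /distribution /pushforward.
have -> : @tuple_cons n @^-1` [set t | forall i, B i (tnth t i)] =
    B ord0 `*` [set t | forall i, B (lift ord0 i) (tnth t i)].
  apply/seteqP; split => [[x t]/= Bxt|[x t] /= [Bx Bt] i].
    split; first exact: (Bxt ord0).
    by move=> i; have := Bxt (lift ord0 i); rewrite tnthS.
  by case: (unliftP ord0 i) => [j|] ->; rewrite ?tnthS.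
rewrite /product_probability /= product_measure1E//.
have -> : [set t : n.-tuple (unitI R) | forall i, B (lift ord0 i) (tnth t i)] =
    \bigcap_(i in setT) ((fun t => tnth t i) @^-1` B (lift ord0 i)).
  by apply/seteqP; split => [t Bt i _|t Bt i]; [exact: Bt|exact: Bt i I].
apply: fin_bigcap_measurable => // i _.
by rewrite -[X in measurable X]setTI; exact: measurable_tnth.
Qed.

Lemma cube_lebesgue_box (I : finType) (A : I -> set (unitI R)) :
  (forall i, measurable (A i)) ->
  cube_lebesgue I [set x | forall i, A i (x i)] =
    (\prod_i unitI_lebesgue (A i))%E.
Proof.
move=> mA; rewrite (reindex (@enum_val I I)); last first.
  by exists enum_rank => i _; rewrite ?enum_valK ?enum_rankK.
rewrite -(tuple_lebesgue_box (B := fun j => A (enum_val j)))//.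
rewrite /cube_lebesgue /distribution /pushforward; congr (tuple_lebesgue _ _).
apply/seteqP; split => t /= At i.
  by have := At (enum_val i); rewrite /cube_of_tuple enum_valK.
by have := At (enum_rank i); rewrite enum_rankK.
Qed.

End cube.

Section index_sets.
Variable k : nat.

(* The index sets r[k] and r_<[k]. *)
Definition rset : finType := {A : {set 'I_k} | A != finset.set0}.

Definition rset_lt : finType :=
  {A : {set 'I_k} | (A != finset.set0) && (A \proper [set: 'I_k]%SET)}.

Lemma perm_rset_subproof (s : 'S_k) (A : rset) :
  (s @: val A)%SET != finset.set0.
Proof. by rewrite imset_eq0 (valP A). Qed.

Definition perm_rset (s : 'S_k) (A : rset) : rset :=
  Sub (s @: val A)%SET (perm_rset_subproof s A).

Lemma face_subproof (i : 'I_k) (A : {A : {set 'I_k.-1} | A != finset.set0}) :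
  ((lift i @: val A)%SET != finset.set0) &&
  ((lift i @: val A)%SET \proper [set: 'I_k]%SET).
Proof.
rewrite imset_eq0 (valP A) properE finset.subsetT/=.
apply/subsetPn; exists i => //.
by apply/imsetP => -[j _ /eqP]; rewrite (negbTE (neq_lift i j)).
Qed.

End index_sets.

(* r[k-1] identified with r([k] \ {i}) through the increasing bijection. *)
Definition face k (i : 'I_k) (A : rset k.-1) : rset_lt k :=
  Sub (lift i @: val A)%SET (face_subproof i A).

Section hypergraphons.
Context {R : realType}.

Definition symmetric_fun k T (f : cube R (rset k) -> T) : Prop :=
  forall (s : 'S_k) x, f (x \o perm_rset s) = f x.

Definition symmetric_set k (P : set (cube R (rset k))) : Prop :=
  forall (s : 'S_k) x, P (x \o perm_rset s) <-> P x.

(* Parts are indexed by an arbitrary finite type J instead of [q] ; the sums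
   below do not depend on an enumeration of J. *)
Definition symmetric_partition k (J : finType)
    (Q : J -> set (cube R (rset k))) : Prop :=
  [/\ forall j, measurable (Q j),
      forall j, symmetric_set (Q j),
      trivIset setT Q &
      \bigcup_j Q j = setT].

Definition add_top k (x : cube R (rset_lt k)) (t : unitI R) : cube R (rset k) :=
  fun A => if insub (val A) is Some B then x B else t.

(* The hypergraphon W^P. *)
Definition set_graphon k (P : set (cube R (rset k)))
    (x : cube R (rset_lt k)) : R :=
  \int[@unitI_lebesgue R]_t \1_P (add_top x t).

Section quotient.
Variables (k : nat) (J : finType).
Implicit Types (W : cube R (rset_lt k) -> R)
  (Q : J -> set (cube R (rset k.-1))) (f : {ffun 'I_k -> J}).

(* cell_indic, cell_vol, cell_weight are 1_f, v_f, w_f. *)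
Definition cell_indic Q f (x : cube R (rset_lt k)) : R :=
  \prod_i \1_(Q (f i)) (x \o face i).

Definition cell_vol Q f : R :=
  \int[cube_lebesgue R (rset_lt k)]_x cell_indic Q f x.

Definition cell_weight W Q f : R :=
  if cell_vol Q f == 0 then 0
  else (cell_vol Q f)^-1 *
       \int[cube_lebesgue R (rset_lt k)]_x (W x * cell_indic Q f x).

Definition quotient W Q : {ffun 'I_k -> J} -> R * R :=
  fun f => (cell_vol Q f, cell_weight W Q f).

Definition stepping W Q (x : cube R (rset_lt k)) : R :=
  \sum_f cell_weight W Q f * cell_indic Q f x.

Definition quotient_d1 (V V' : {ffun 'I_k -> J} -> R * R) : R :=
  \sum_f (`|(V f).1 - (V' f).1| + `|(V f).1 * (V f).2 - (V' f).1 * (V' f).2|).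

End quotient.

Definition cut_norm k (W : cube R (rset_lt k) -> R) : \bar R :=
  ereal_sup [set (`| \int[cube_lebesgue R (rset_lt k)]_x
                       (W x * \prod_i u i (x \o face i)) |)%:E
    | u in [set u : 'I_k -> cube R (rset k.-1) -> R |
        forall i, [/\ measurable_fun setT (u i), symmetric_fun (u i) &
                      forall y, 0 <= u i y <= 1]]].

Definition weakly_regular k (J : finType) (P : set (cube R (rset k)))
    (Q : J -> set (cube R (rset k.-1))) (eps : R) : Prop :=
  (cut_norm (fun x => (set_graphon P x - stepping (set_graphon P) Q x)%R)
     <= eps%:E)%E.

End hypergraphons.

(* Degree sequences are numbered from 0 : p l is the number of parts into which
   each part of level l is refined at level l.+1. *)
Definition positive_degrees (p : nat -> nat) : Prop :=
  forall l, (0 < p l)%N.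

Fixpoint level_index (p : nat -> nat) (l : nat) : finType :=
  if l is l'.+1 then (level_index p l' * 'I_(p l'))%type else unit.

Record branching_partition (R : realType) (k : nat) (p : nat -> nat) := {
  level :> forall l, level_index p l -> set (cube R (rset k));
  level_partition : forall l, symmetric_partition (@level l);
  level0 : @level 0 tt = setT;
  level_refine : forall l (i : level_index p l),
    \bigcup_(j : 'I_(p l)) @level l.+1 (i, j) = @level l i }.

Arguments level {R k p} _ l _.

Definition weakly_regular_pair (R : realType) k (p q : nat -> nat)
    (P : branching_partition R k p) (Q : branching_partition R k.-1 q)
    (eps : nat -> R) : Prop :=
  forall s, (0 < s)%N -> forall l (i : level_index p l), (l <= s)%N ->
    weakly_regular (P l i) (Q s) (eps s).

(* partitionably_converges k is convergence of branching partitions of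
   [0,1]^{r[k.+1]} : the recursion starts at uniformity 1. *)
Fixpoint partitionably_converges (R : realType) (k : nat) (p : nat -> nat) :
    (nat -> branching_partition R k.+1 p) -> branching_partition R k.+1 p ->
    Prop :=
  match k with
  | 0 => fun P Pt =>
      forall l (i : level_index p l),
        cube_lebesgue R (rset 1) (P n l i) @[n --> \oo]
          --> cube_lebesgue R (rset 1) (Pt l i)
  | k'.+1 => fun P Pt =>
      exists (q : nat -> nat) (Q : nat -> branching_partition R k'.+1 q)
             (Qt : branching_partition R k'.+1 q),
      [/\ positive_degrees q,
          forall n, weakly_regular_pair (P n) (Q n) (fun s => s%:R^-1),
          partitionably_converges Q Qt,
          forall s l (i : level_index p l), (0 < s)%N -> (0 < l)%N ->
            quotient_d1 (quotient (set_graphon (P n l i)) (Q n s))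
                        (quotient (set_graphon (Pt l i)) (Qt s))
              @[n --> \oo] --> (0 : R) &
          forall l (i : level_index p l),
            {ae cube_lebesgue R (rset_lt k'.+2), forall x,
              stepping (set_graphon (Pt l i)) (Qt s) x @[s --> \oo]
                --> set_graphon (Pt l i) x}]
  end.

(* Main.v *)
Require Import Defs.
From HB Require Import structures.
From mathcomp Require Import all_boot all_order all_algebra perm.
From mathcomp Require Import all_classical all_reals all_analysis.
From mathcomp Require Import measurable_realfun.
From mathcomp Require Import ring lra.
Import Order.TTheory GRing.Theory Num.Theory.
Import numFieldNormedType.Exports.

Set Implicit Arguments.
Unset Strict Implicit.
Unset Printing Implicit Defensive.

Local Open Scope classical_set_scope.
Local Open Scope ring_scope.

(** The proof is by induction on the uniformity, the passage from uniformity
    [K - 1] to [K] being the usual regularity method.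

    Every partition is handled through a label, that is, a measurable function to
    a finite type whose fibres are the parts.  The labels of the facets of a point
    form its [profile]; stepping a hypergraphon along a partition is then its
    conditional expectation on the profile, and the elementary theory of
    conditional expectations on finite partitions applies.

    Given [P 0, P 1, ...], energy increments show that each [P n] has a branching
    partition [Q n] of the lower faces that regularizes it, of a degree that does
    not depend on [n] ([weak_regularity], [regular_branching]).  The induction
    hypothesis makes [Q n] converge to some [Qt] along a subsequence.  Two things
    then have to be known in the limit: the volume of each cell of [Q n], and the
    integral of each hypergraphon [set_graphon (P n l i)] on that cell.

    The volumes converge by [counting_lemma]: if [Q n] converges partitionably,
    then so does the density of any configuration of members of [Q n] on the
    faces of a larger simplex.  Its proof replaces the members of [Q n] by step
    functions one face at a time.  With the coordinates off that face frozen, the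
    remaining factors are test functions for the cut norm ([freeze_outside]),
    although not symmetric ones; [cut_norm_bounded] shows that symmetric test
    functions already control all of them, by colouring the vertices.  What is
    left is a combination of densities one uniformity lower.  The integrals lie
    in the unit interval and there are countably many, so
    [common_subsequence] makes them all converge, to numbers [z] say.

    The limits [z] inherit the linear relations between the integrals for finite
    [n].  Divided by the cell volumes of [Qt] they define, for each index of the
    tree, a martingale along the levels of [Qt], which converges almost everywhere
    by Doob's maximal inequality ([martingale_cauchy]).  The limit functions
    [limit_graphon] are nonnegative and add up along the tree, so consecutive
    subintervals of the top coordinate with these lengths form a branching
    partition whose hypergraphons they are ([realize_tree]).  Its integrals on the
    cells of [Qt] are the numbers [z], which gives the convergence of quotients,
    and its steppings are the martingale itself, which gives the almost
    everywhere convergence.  In uniformity 1 there are no lower faces, and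
    [realize_tree] is applied to constants. *)

(** * Bounded measurable functions and finite labellings *)

(** All integrals below are of bounded measurable functions against probability
    measures, a class closed under everything that is done to integrands; this
    makes the real-valued integral linear and monotone unconditionally. *)
Definition bmf d (T : measurableType d) (R : realType) (f : T -> R) : Prop :=
  measurable_fun setT f /\ exists M, forall x, `|f x| <= M.

(** A finite measurable partition, given by the function that names the part
    containing a point. *)
Definition finlab d (T : measurableType d) (J : finType) (c : T -> J) : Prop :=
  forall j, measurable (c @^-1` [set j]).

Section bounded_measurable.
Context d (T : measurableType d) (R : realType).
Implicit Types f g : T -> R.

Lemma eq_bmf f g : f =1 g -> bmf f -> bmf g.
Proof. by move=> /funext ->. Qed.

Lemma bmf_cst (r : R) : bmf (fun _ : T => r).
Proof. by split; [exact: measurable_cst|exists `|r|]. Qed.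

Lemma bmfD f g : bmf f -> bmf g -> bmf (fun x => f x + g x).
Proof.
move=> [mf [M fM]] [mg [N gN]]; split; first exact: measurable_funD.
by exists (M + N) => x; rewrite (le_trans (ler_normD _ _))// lerD.
Qed.

Lemma bmfM f g : bmf f -> bmf g -> bmf (fun x => f x * g x).
Proof.
move=> [mf [M fM]] [mg [N gN]]; split; first exact: measurable_funM.
by exists (M * N) => x; rewrite normrM ler_pM.
Qed.

Lemma bmfN f : bmf f -> bmf (fun x => - f x).
Proof.
move=> [mf [M fM]]; split; first exact: measurable_funN.
by exists M => x; rewrite normrN.
Qed.

Lemma bmfB f g : bmf f -> bmf g -> bmf (fun x => f x - g x).
Proof. by move=> bf bg; apply: bmfD => //; exact: bmfN. Qed.

Lemma bmf_norm f : bmf f -> bmf (fun x => `|f x|).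
Proof.
move=> [mf [M fM]]; split; first exact: measurableT_comp.
by exists M => x; rewrite normr_id.
Qed.

Lemma bmf_sum I (s : seq I) (P : pred I) (f : I -> T -> R) :
  (forall i, P i -> bmf (f i)) -> bmf (fun x => \sum_(i <- s | P i) f i x).
Proof.
move=> bf; elim: s => [|i s IHs].
  by apply: (eq_bmf (f := fun=> 0)) (bmf_cst 0) => x; rewrite big_nil.
have [Pi|/negbTE Pi] := boolP (P i); last first.
  by apply: eq_bmf IHs => x; rewrite big_cons Pi.
by apply: eq_bmf (bmfD (bf i Pi) IHs) => x; rewrite big_cons Pi.
Qed.

Lemma bmf_prod I (s : seq I) (P : pred I) (f : I -> T -> R) :
  (forall i, P i -> bmf (f i)) -> bmf (fun x => \prod_(i <- s | P i) f i x).
Proof.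
move=> bf; elim: s => [|i s IHs].
  by apply: (eq_bmf (f := fun=> 1)) (bmf_cst 1) => x; rewrite big_nil.
have [Pi|/negbTE Pi] := boolP (P i); last first.
  by apply: eq_bmf IHs => x; rewrite big_cons Pi.
by apply: eq_bmf (bmfM (bf i Pi) IHs) => x; rewrite big_cons Pi.
Qed.

Lemma bmf_sqr f : bmf f -> bmf (fun x => f x ^+ 2).
Proof. by move=> bf; apply: eq_bmf (bmfM bf bf) => x; rewrite expr2. Qed.

Lemma bmf01 f : measurable_fun setT f -> (forall x, 0 <= f x <= 1) -> bmf f.
Proof.
move=> mf f01; split => //; exists 1 => x.
by have /andP[? ?] := f01 x; rewrite ger0_norm.
Qed.

Lemma indic01 (A : set T) x : 0 <= (\1_A x : R) <= 1.
Proof. by rewrite indicE; case: (_ \in _); rewrite /= ?lexx ?ler01. Qed.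

Lemma bmf_indic (A : set T) : measurable A -> bmf (\1_A : T -> R).
Proof.
move=> mA; apply: bmf01; first exact: measurable_indic.
by move=> x; exact: indic01.
Qed.

Lemma bmf_comp d' (T' : measurableType d') (h : T' -> T) f :
  measurable_fun setT h -> bmf f -> bmf (fun x => f (h x)).
Proof.
move=> mh [mf [M fM]]; split; first exact: measurableT_comp.
by exists M => x.
Qed.

End bounded_measurable.

Section finite_labels.
Context d (T : measurableType d).

Lemma finlab_preimage (J : finType) (c : T -> J) (A : set J) :
  finlab c -> measurable (c @^-1` A).
Proof.
move=> mc; rewrite (_ : c @^-1` A = \bigcup_(j in A) c @^-1` [set j]).
  by apply: fin_bigcup_measurable => //; exact: finite_finset.
by apply/seteqP; split=> [x Acx|x [j Aj /= cx]]; [exists (c x)|rewrite /= cx].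
Qed.

Lemma finlab_map (J J' : finType) (h : J -> J') (c : T -> J) :
  finlab c -> finlab (fun x => h (c x)).
Proof. by move=> mc j; exact: (finlab_preimage (h @^-1` [set j]) mc). Qed.

Lemma finlab_factor (J J' : finType) (c : T -> J) (c' : T -> J')
    (pi : J' -> J) :
  finlab c' -> (forall x, c x = pi (c' x)) -> finlab c.
Proof.
move=> mc' cc'; rewrite (_ : c = fun x => pi (c' x)); last exact/funext.
exact: finlab_map.
Qed.

Lemma finlab_ffun (E J : finType) (c : E -> T -> J) :
  (forall i, finlab (c i)) -> finlab (fun x => [ffun i => c i x]).
Proof.
move=> mc f; rewrite (_ : _ @^-1` _ = \bigcap_(i in setT) c i @^-1` [set f i]).
  by apply: fin_bigcap_measurable => // i _; exact: mc.
apply/seteqP; split=> [x /= <- i _|x /= cf]; first by rewrite /= ffunE.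
by apply/ffunP => i; rewrite ffunE; exact: (cf i I).
Qed.

Lemma finlab_pair (J J' : finType) (c : T -> J) (c' : T -> J') :
  finlab c -> finlab c' -> finlab (fun x => (c x, c' x)).
Proof.
move=> mc mc' [j j']; rewrite (_ : _ @^-1` _ =
    (c @^-1` [set j]) `&` (c' @^-1` [set j'])).
  by apply: measurableI; [exact: mc|exact: mc'].
by apply/seteqP; split=> x /= [cx c'x]; rewrite /preimage /= cx c'x.
Qed.

Lemma finlab_comp d' (T' : measurableType d') (J : finType) (h : T' -> T)
    (c : T -> J) :
  measurable_fun setT h -> finlab c -> finlab (fun x => c (h x)).
Proof.
by move=> mh mc j; rewrite -[X in measurable X]setTI;
  exact: (mh measurableT _ (mc j)).
Qed.

Lemma finlab_bool (b : T -> bool) : measurable [set x | b x] -> finlab b.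
Proof.
move=> mb; case.
  by rewrite (_ : _ @^-1` _ = [set x | b x]).
rewrite (_ : _ @^-1` _ = ~` [set x | b x]); first exact: measurableC.
by apply/seteqP; split=> x /=; [move=> ->|move/negP/negbTE].
Qed.

Lemma finlab_le (R : realType) (f g : T -> R) :
  measurable_fun setT f -> measurable_fun setT g -> finlab (fun x => f x <= g x).
Proof.
move=> mf mg; apply: finlab_bool.
have := measurable_fun_ler mf mg.
move=> /(_ measurableT [set true] I); rewrite setTI.
by congr measurable; apply/seteqP; split=> x /=.
Qed.

Lemma finlab_lt (R : realType) (f g : T -> R) :
  measurable_fun setT f -> measurable_fun setT g -> finlab (fun x => f x < g x).
Proof.
move=> mf mg; apply: finlab_bool.
have := measurable_fun_ltr mf mg.
move=> /(_ measurableT [set true] I); rewrite setTI.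
by congr measurable; apply/seteqP; split=> x /=.
Qed.

Lemma finlab_bmf (R : realType) (J : finType) (h : J -> R) (c : T -> J) :
  finlab c -> bmf (fun x => h (c x)).
Proof.
move=> mc.
rewrite (_ : (fun x => _) = fun x => \sum_j h j * \1_(c @^-1` [set j]) x).
  apply: bmf_sum => j _; apply: bmfM; first exact: bmf_cst.
  exact: bmf_indic.
apply/funext => x; rewrite (bigD1 (c x))//= big1 => [|j /negbTE jc].
  by rewrite indicE mem_set//= mulr1 addr0.
rewrite indicE memNset ?mulr0// => /= cj; by rewrite cj eqxx in jc.
Qed.

End finite_labels.

Section expectation.
Context d (T : measurableType d) (R : realType) (mu : probability T R).
Implicit Types f g : T -> R.

Lemma bmf_integrable f : bmf f -> mu.-integrable setT (EFin \o f).
Proof.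
move=> [mf [M fM]]; apply: measurable_bounded_integrable => //.
  by apply: (le_lt_trans (probability_le1 mu measurableT)); exact: ltry.
exists M; split; first exact: num_real.
by move=> x Mx y _ /=; rewrite (le_trans (fM y))// ltW.
Qed.

Lemma ExD f g : bmf f -> bmf g ->
  \int[mu]_x (f x + g x) = \int[mu]_x f x + \int[mu]_x g x.
Proof. by move=> bf bg; rewrite RintegralD//; exact: bmf_integrable. Qed.

Lemma ExB f g : bmf f -> bmf g ->
  \int[mu]_x (f x - g x) = \int[mu]_x f x - \int[mu]_x g x.
Proof. by move=> bf bg; rewrite RintegralB//; exact: bmf_integrable. Qed.

Lemma ExZ (r : R) f : bmf f -> \int[mu]_x (r * f x) = r * \int[mu]_x f x.
Proof. by move=> bf; rewrite RintegralZl//; exact: bmf_integrable. Qed.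

Lemma Ex_cst (r : R) : \int[mu]_x r = r.
Proof.
by rewrite Rintegral_cst//; rewrite [X in fine X]probability_setT mulr1.
Qed.

Lemma eq_Ex f g : f =1 g -> \int[mu]_x f x = \int[mu]_x g x.
Proof. by move=> fg; apply: eq_Rintegral => x _; exact: fg. Qed.

Lemma Ex_sum I (s : seq I) (P : pred I) (f : I -> T -> R) :
  (forall i, P i -> bmf (f i)) ->
  \int[mu]_x (\sum_(i <- s | P i) f i x) = \sum_(i <- s | P i) \int[mu]_x f i x.
Proof.
move=> bf; elim: s => [|i s IHs].
  by under eq_Ex do rewrite big_nil; rewrite big_nil Ex_cst.
under eq_Ex do rewrite big_cons; rewrite big_cons.
case: ifPn => // Pi; rewrite ExD ?IHs//; first exact: bf.
exact: bmf_sum.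
Qed.

Lemma Ex_le f g : bmf f -> bmf g -> (forall x, f x <= g x) ->
  \int[mu]_x f x <= \int[mu]_x g x.
Proof. by move=> bf bg fg; apply: le_Rintegral => //; exact: bmf_integrable. Qed.

Lemma Ex_ge0 f : (forall x, 0 <= f x) -> 0 <= \int[mu]_x f x.
Proof. by move=> f0; apply: Rintegral_ge0. Qed.

Lemma Ex_norm f : bmf f -> `|\int[mu]_x f x| <= \int[mu]_x `|f x|.
Proof. by move=> bf; apply: le_normr_Rintegral => //; exact: bmf_integrable. Qed.

Lemma Ex_norm_le f (M : R) : bmf f -> (forall x, `|f x| <= M) ->
  `|\int[mu]_x f x| <= M.
Proof.
move=> bf fM; apply: (le_trans (Ex_norm bf)); rewrite -[leRHS]Ex_cst.
by apply: Ex_le => //; [exact: bmf_norm|exact: bmf_cst].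
Qed.

Lemma Ex_indic (A : set T) : measurable A -> \int[mu]_x \1_A x = fine (mu A).
Proof. by move=> mA; rewrite /Rintegral integral_indic// setIT. Qed.

Lemma Ex_01 f : bmf f -> (forall x, 0 <= f x <= 1) ->
  0 <= \int[mu]_x f x <= 1.
Proof.
move=> bf f01; rewrite Ex_ge0 => [|x]; last by case/andP: (f01 x).
rewrite -[leRHS](Ex_cst 1) Ex_le//; first exact: bmf_cst.
by move=> x; case/andP: (f01 x).
Qed.

(** The variance is nonnegative. *)
Lemma Ex_sqr f : bmf f -> (\int[mu]_x f x) ^+ 2 <= \int[mu]_x (f x ^+ 2).
Proof.
move=> bf; set m := \int[mu]_x f x.
have : 0 <= \int[mu]_x ((f x - m) ^+ 2) by apply: Ex_ge0 => x; exact: sqr_ge0.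
have -> : \int[mu]_x ((f x - m) ^+ 2) =
    \int[mu]_x ((f x * f x - (2 * m) * f x) + m ^+ 2).
  by apply: eq_Ex => x; ring.
have b2 : bmf (fun x => f x * f x) by exact: bmfM.
have b1 : bmf (fun x => 2 * m * f x) by apply: bmfM => //; exact: bmf_cst.
rewrite ExD; [|exact: bmfB|exact: bmf_cst].
rewrite ExB// ExZ// Ex_cst.
rewrite -/m.
have -> : \int[mu]_x (f x ^+ 2) = \int[mu]_x (f x * f x).
  by apply: eq_Ex => x; rewrite expr2.
lra.
Qed.

(** Dominated convergence with a constant bound. *)
Lemma Ex_cvg (f : nat -> T -> R) (g : T -> R) (M : R) :
  (forall n, measurable_fun setT (f n)) -> measurable_fun setT g ->
  (forall n x, `|f n x| <= M) ->
  {ae mu, forall x, f n x @[n --> \oo] --> g x} ->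
  \int[mu]_x f n x @[n --> \oo] --> \int[mu]_x g x.
Proof.
move=> mf mg fM fg.
have [] := @dominated_convergence _ _ _ mu setT measurableT
  (fun n x => (f n x)%:E) (fun x => (g x)%:E) (fun=> M%:E).
- by move=> n; exact/measurable_EFinP.
- exact/measurable_EFinP.
- by apply: filterS fg => x fgx _; apply: cvg_EFin => //; exact: nearW.
- by apply: (bmf_integrable (f := fun=> M)); exact: bmf_cst.
- by apply: aeW => x n _; rewrite lee_fin.
move=> ig _ cvgI; rewrite /Rintegral; apply: fine_cvg.
by rewrite fineK//; exact: integrable_fin_num ig.
Qed.

End expectation.

Section transfer.
Context d1 d2 (T1 : measurableType d1) (T2 : measurableType d2) (R : realType).
Variables (mu1 : probability T1 R) (mu2 : probability T2 R).

Lemma Ex_pushforward (h : T1 -> T2) (f : T2 -> R) :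
  measurable_fun setT h ->
  (forall A, measurable A -> mu1 (h @^-1` A) = mu2 A) ->
  bmf f -> \int[mu1]_x f (h x) = \int[mu2]_y f y.
Proof.
move=> mh muh bf; congr fine.
transitivity (\int[pushforward mu1 h]_y (f y)%:E)%E.
  rewrite integral_pushforward//.
    by apply/measurable_EFinP; case: bf.
  exact: (bmf_integrable mu1 (bmf_comp mh bf)).
by apply: eq_measure_integral => A mA _; exact: muh.
Qed.

Lemma Ex_fubini (f : T1 * T2 -> R) : bmf f ->
  bmf (fun x => \int[mu2]_y f (x, y)) /\
  \int[product_probability mu1 mu2]_z f z =
    \int[mu1]_x \int[mu2]_y f (x, y).
Proof.
move=> bf.
have if_ := bmf_integrable (product_probability mu1 mu2) bf.
have bsec x : bmf (fun y => f (x, y)).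
  apply: bmf_comp bf; exact: measurable_pair1.
have FE x : (\int[mu2]_y (f (x, y))%:E)%E = (\int[mu2]_y f (x, y))%:E.
  rewrite fineK//; exact: integrable_fin_num (bmf_integrable mu2 (bsec x)).
split.
  split.
    apply/measurable_EFinP.
    rewrite (_ : _ \o _ = fun x => (\int[mu2]_y (f (x, y))%:E)%E).
      by apply: (@measurable_fubini_F _ _ _ _ _ mu1 mu2 (EFin \o f)).
    by apply/funext => x /=; rewrite FE.
  have [_ [M fM]] := bf; exists M => x.
  exact: Ex_norm_le.
rewrite /Rintegral; congr fine.
transitivity (\int[mu1]_x \int[mu2]_y (f (x, y))%:E)%E.
  by rewrite (integral12_prod_meas1 (f := EFin \o f)).
by apply: eq_integral => x _; rewrite FE.
Qed.

End transfer.

(** * Lebesgue measure on cubes *)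

Section cube_measure.
Context (R : realType).

Lemma measurable_coord (I : finType) (i : I) :
  measurable_fun setT (fun x : cube R I => x i).
Proof.
move=> _ B mB; apply: sub_sigma_algebra; exists i => //.
by exists B.
Qed.

Lemma measurable_reindex (I K : finType) (phi : I -> K) :
  measurable_fun setT (fun x : cube R K => (x \o phi : cube R I)).
Proof. by apply: measurable_fun_cubeP => i; exact: measurable_coord. Qed.

Lemma measurable_box (I : finType) (A : I -> set (unitI R)) :
  (forall i, measurable (A i)) ->
  measurable [set x : cube R I | forall i, A i (x i)].
Proof.
move=> mA; rewrite (_ : [set _ | _] =
    \bigcap_(i in setT) ((fun x : cube R I => x i) @^-1` A i)).
  apply: fin_bigcap_measurable => // i _.
  by rewrite -[X in measurable X]setTI; exact: measurable_coord.
by apply/seteqP; split=> [x Ax i _|x Ax i]; [exact: Ax|exact: Ax i Logic.I].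
Qed.

(** Boxes are stable under intersection and generate the product
    sigma-algebra. *)
Lemma cube_lebesgue_unique d (T : measurableType d) (mu : probability T R)
    (I : finType) (h : T -> cube R I) : measurable_fun setT h ->
  (forall A : I -> set (unitI R), (forall i, measurable (A i)) ->
    mu (h @^-1` [set x | forall i, A i (x i)]) =
    (\prod_i unitI_lebesgue (A i))%E) ->
  forall X, measurable X -> mu (h @^-1` X) = cube_lebesgue R I X.
Proof.
move=> mh mubox X mX.
pose h_ : {mfun T >-> cube R I} :=
  HB.pack h (isMeasurableFun.Build _ _ _ _ _ mh).
pose G : set (set (cube R I)) := [set B | exists2 A : I -> set (unitI R),
  forall i, measurable (A i) & B = [set x | forall i, A i (x i)]].
apply: (measure_unique G (fun=> setT) _ _ _ _ (distribution mu h_)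
  (cube_lebesgue R I)) => //.
- apply/seteqP; split.
    apply: smallest_sub; first exact: smallest_sigma_algebra.
    move=> _ [i _ [B mB <-]]; apply: sub_sigma_algebra.
    exists (fun j => if j == i then B else setT) => [j|]; first by case: ifP.
    rewrite setTI; apply/seteqP; split=> x /= Bx.
      by move=> j; case: eqP => // ->.
    by have := Bx i; rewrite eqxx.
  apply: smallest_sub; first exact: sigma_algebra_measurable.
  by move=> _ [A mA ->]; exact: measurable_box.
- move=> _ _ [A mA ->] [B mB ->]; exists (fun i => A i `&` B i).
    by move=> i; exact: measurableI.
  apply/seteqP; split=> x /=; first by move=> [Ax Bx] i; split.
  by move=> ABx; split=> i; case: (ABx i).
- by move=> _; exists (fun=> setT) => //; apply/seteqP; split.
- by rewrite bigcup_const.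
- by move=> _ [A mA ->]; apply: (etrans (mubox A mA)); symmetry;
    exact: cube_lebesgue_box.
- by move=> _; apply: (le_lt_trans (probability_le1 _ measurableT));
    exact: ltry.
Qed.

Lemma prod_codom (I K : finType) (phi : I -> K) (F : K -> \bar R) :
  injective phi ->
  (\prod_k F k = (\prod_i F (phi i)) * \prod_(k | k \notin codom phi) F k)%E.
Proof.
move=> phi_inj; rewrite (bigID (mem (codom phi)))/=; congr (_ * _)%E.
rewrite (eq_bigl (mem (phi @: [set: I]%SET))) => [|k]; last first.
  apply/codomP/imsetP => [[i ->]|[i _ ->]]; exists i => //.
rewrite big_imset/=; first by apply: eq_bigl => i; rewrite finset.inE.
by move=> i j _ _; exact: phi_inj.
Qed.

Lemma unitI_lebesgueT : unitI_lebesgue (@setT (unitI R)) = 1%E.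
Proof. exact: (@probability_setT _ _ _ (@unitI_lebesgue R)). Qed.

(** If [y] and [z] are independent and uniform, then so is [overwrite phi y z].
    Integrating over a pair [(z, y)] with redundant coordinates in [z] is a form of
    Fubini's theorem for a block of coordinates that does not require splitting
    the index type. *)
Definition overwrite (I K : finType) (phi : I -> K) (y : cube R I) (z : cube R K) :
  cube R K := fun k => if [pick i | phi i == k] is Some i then y i else z k.

Lemma overwrite_codom (I K : finType) (phi : I -> K) y z i : injective phi ->
  overwrite phi y z (phi i) = y i.
Proof.
move=> phi_inj; rewrite /overwrite; case: pickP => [j /eqP/phi_inj ->//|].
by move/(_ i); rewrite eqxx.
Qed.

Lemma overwrite_notin (I K : finType) (phi : I -> K) y z k : k \notin codom phi ->
  overwrite phi y z k = z k.
Proof.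
move=> kphi; rewrite /overwrite; case: pickP => // j /eqP jk.
by rewrite -jk codom_f in kphi.
Qed.

Lemma measurable_overwrite (I K : finType) (phi : I -> K) :
  measurable_fun setT (fun p : cube R K * cube R I => overwrite phi p.2 p.1).
Proof.
apply: measurable_fun_cubeP => k; rewrite /overwrite; case: pickP => [i _|_].
  exact: (measurableT_comp (measurable_coord i) measurable_snd).
exact: (measurableT_comp (measurable_coord k) measurable_fst).
Qed.

Lemma overwrite_lebesgue (I K : finType) (phi : I -> K) (A : set (cube R K)) :
  injective phi -> measurable A ->
  product_probability (cube_lebesgue R K) (cube_lebesgue R I)
    ((fun p => overwrite phi p.2 p.1) @^-1` A) = cube_lebesgue R K A.
Proof.
move=> phi_inj; apply: cube_lebesgue_unique; first exact: measurable_overwrite.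
move=> {}A mA.
pose A2 k := if k \in codom phi then setT else A k.
have -> : (fun p : cube R K * cube R I => overwrite phi p.2 p.1) @^-1`
    [set x | forall i, A i (x i)] =
    [set z | forall k, A2 k (z k)] `*` [set y | forall i, A (phi i) (y i)].
  apply/seteqP; split=> [[z y]/= Agl|[z y] /= [A2z Ay] k].
    split=> [k|i]; last by have := Agl (phi i); rewrite overwrite_codom.
    by rewrite /A2; case: ifPn => // kphi; have := Agl k; rewrite overwrite_notin.
  have [/codomP[i ->]|kphi] := boolP (k \in codom phi).
    by rewrite overwrite_codom.
  by rewrite overwrite_notin//; have := A2z k; rewrite /A2 (negbTE kphi).
have mA2 k : measurable (A2 k) by rewrite /A2; case: ifP.
have mAphi i : measurable ((A \o phi) i) by exact: mA.
rewrite /product_probability/= product_measure1E;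
  [|exact: (measurable_box mA2)|exact: (measurable_box mAphi)].
rewrite [X in (X * _)%E = _](cube_lebesgue_box mA2).
rewrite [X in (_ * X)%E = _](cube_lebesgue_box mAphi).
rewrite muleC (prod_codom (fun k => unitI_lebesgue (A k)) phi_inj)/=.
congr (_ * _)%E; rewrite (bigID (mem (codom phi)))/= big1 ?mul1e => [|k].
  by apply: eq_bigr => k /negbTE kphi; rewrite /A2 kphi.
by move=> kphi; rewrite /A2 kphi unitI_lebesgueT.
Qed.

Lemma Ex_overwrite (I K : finType) (phi : I -> K) (F : cube R K -> R) :
  injective phi -> bmf F ->
  bmf (fun z => \int[cube_lebesgue R I]_y F (overwrite phi y z)) /\
  \int[cube_lebesgue R K]_x F x =
    \int[cube_lebesgue R K]_z \int[cube_lebesgue R I]_y F (overwrite phi y z).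
Proof.
move=> phi_inj bF.
have bgl := bmf_comp (measurable_overwrite phi) bF.
have [? fub] := Ex_fubini (cube_lebesgue R K) (cube_lebesgue R I) bgl.
split => //; rewrite -fub; symmetry; apply: Ex_pushforward => //.
  exact: measurable_overwrite.
by move=> A mA; exact: overwrite_lebesgue.
Qed.

Lemma Ex_reindex (I K : finType) (phi : I -> K) (F : cube R I -> R) :
  injective phi -> bmf F ->
  \int[cube_lebesgue R K]_x F (x \o phi) = \int[cube_lebesgue R I]_y F y.
Proof.
move=> phi_inj bF.
rewrite (Ex_overwrite phi_inj (bmf_comp (@measurable_reindex _ _ phi) bF)).2.
rewrite -[RHS](Ex_cst (cube_lebesgue R K)); apply: eq_Ex => z.
by apply: eq_Ex => y; congr F; apply/funext => i /=; rewrite overwrite_codom.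
Qed.

Lemma measurable_overwrite_l (I K : finType) (phi : I -> K) z :
  measurable_fun setT (fun y : cube R I => overwrite phi y z).
Proof.
exact: (measurableT_comp (measurable_overwrite phi) (measurable_pair1 z)).
Qed.

Lemma Ex_coord (K : finType) (k : K) (F : unitI R -> R) : bmf F ->
  \int[cube_lebesgue R K]_x F (x k) = \int[@unitI_lebesgue R]_t F t.
Proof.
move=> bF; apply: Ex_pushforward => //; first exact: measurable_coord.
move=> A mA; pose B j := if j == k then A else setT.
have -> : (fun x : cube R K => x k) @^-1` A = [set x | forall j, B j (x j)].
  apply/seteqP; split=> x /= Ax; last by have := Ax k; rewrite /B eqxx.
  by move=> j; rewrite /B; case: eqP => // ->.
rewrite cube_lebesgue_box => [|j]; last by rewrite /B; case: ifP.
rewrite (bigD1 k)//= big1 => [|j /negbTE jk]; first by rewrite /B eqxx mule1.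
by rewrite /B jk unitI_lebesgueT.
Qed.

End cube_measure.

(** * The top coordinate *)

Section top_coordinate.
Context (R : realType).

Definition rset_of_lt K (A : rset_lt K) : rset K :=
  Sub (val A) (proj1 (andP (valP A))).

Lemma rset_of_lt_inj K : injective (@rset_of_lt K).
Proof. by move=> A B /(congr1 val) /= /val_inj. Qed.

Lemma setT_neq0 K : [set: 'I_K.+1]%SET != finset.set0.
Proof. by apply/set0Pn; exists ord0. Qed.

Definition rset_top K : rset K.+1 := Sub [set: 'I_K.+1]%SET (setT_neq0 K).

Lemma rset_of_lt_neq_top K (A : rset_lt K.+1) : rset_of_lt A != rset_top K.
Proof.
apply/eqP => /(congr1 val)/= AT; have /andP[_] := valP A.
by rewrite /= AT fintype.properxx.
Qed.

Lemma rset_ltP K (A : rset K.+1) : A != rset_top K -> {B | rset_of_lt B = A}.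
Proof.
move=> AT; have Alt : (val A != finset.set0) && (val A \proper [set: 'I_K.+1]%SET).
  by rewrite (valP A) finset.properT.
by exists (Sub (val A) Alt); apply: val_inj.
Qed.

Lemma add_top_lt K (y : cube R (rset_lt K)) t A :
  add_top y t (rset_of_lt A) = y A.
Proof.
rewrite /add_top; case: insubP => [B _ /val_inj ->//|].
by rewrite (valP A).
Qed.

Lemma add_top_top K (y : cube R (rset_lt K.+1)) t :
  add_top y t (rset_top K) = t.
Proof. by rewrite /add_top insubF//= fintype.properxx andbF. Qed.

Lemma measurable_add_top K :
  measurable_fun setT (fun p : cube R (rset_lt K) * unitI R => add_top p.1 p.2).
Proof.
apply: measurable_fun_cubeP => A; rewrite /add_top; case: insubP => [B _ _|_].
  exact: (measurableT_comp (measurable_coord B) measurable_fst).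
exact: measurable_snd.
Qed.

Lemma add_top_lebesgue K (A : set (cube R (rset K.+1))) : measurable A ->
  product_probability (cube_lebesgue R (rset_lt K.+1)) (@unitI_lebesgue R)
    ((fun p => add_top p.1 p.2) @^-1` A) = cube_lebesgue R (rset K.+1) A.
Proof.
apply: cube_lebesgue_unique; first exact: measurable_add_top.
move=> {}A mA.
have -> : (fun p : cube R (rset_lt K.+1) * unitI R => add_top p.1 p.2) @^-1`
    [set x | forall i, A i (x i)] =
    [set y | forall B, A (rset_of_lt B) (y B)] `*` A (rset_top K).
  apply/seteqP; split=> [[y t]/= Ayt|[y t] /= [Ay At] B].
    split=> [B|]; first by have := Ayt (rset_of_lt B); rewrite add_top_lt.
    by have := Ayt (rset_top K); rewrite add_top_top.
  have [->|/rset_ltP[C <-]] := eqVneq B (rset_top K); first by rewrite add_top_top.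
  by rewrite add_top_lt.
have mAlt B : measurable ((A \o @rset_of_lt _) B) by exact: mA.
rewrite /product_probability/= product_measure1E//;
  last exact: (measurable_box mAlt).
rewrite [X in (X * _)%E = _](cube_lebesgue_box mAlt).
rewrite (prod_codom (fun k => unitI_lebesgue (A k)) (@rset_of_lt_inj _))/=.
congr (_ * _)%E; rewrite (big_pred1 (rset_top K))// => B /=.
apply/idP/eqP => [|->]; last first.
  by apply/negP => /codomP[C /eqP]; rewrite eq_sym; exact/negP/rset_of_lt_neq_top.
by apply: contraNeq => /rset_ltP[C <-]; exact: codom_f.
Qed.

(** [add_top] identifies the cube over the nonempty subsets with the product of
    the cube over the proper ones and the interval of the top coordinate. *)
Lemma Ex_top K (F : cube R (rset K.+1) -> R) : bmf F ->
  bmf (fun y => \int[@unitI_lebesgue R]_t F (add_top y t)) /\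
  \int[cube_lebesgue R (rset K.+1)]_x F x =
    \int[cube_lebesgue R (rset_lt K.+1)]_y
      \int[@unitI_lebesgue R]_t F (add_top y t).
Proof.
move=> bF.
have bat := bmf_comp (@measurable_add_top _) bF.
have [? fub] := Ex_fubini (cube_lebesgue R (rset_lt K.+1)) (@unitI_lebesgue R) bat.
split => //; rewrite -fub; symmetry; apply: Ex_pushforward => //.
  exact: measurable_add_top.
by move=> A mA; exact: add_top_lebesgue.
Qed.

Lemma measurable_add_top2 K (y : cube R (rset_lt K)) :
  measurable_fun setT (add_top y).
Proof. exact: (measurableT_comp (@measurable_add_top K) (measurable_pair1 y)). Qed.

Lemma set_graphon01 K (P : set (cube R (rset K.+1))) : measurable P ->
  measurable_fun setT (set_graphon P) /\ forall y, 0 <= set_graphon P y <= 1.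
Proof.
move=> mP; have bP : bmf (\1_P : _ -> R) by exact: bmf_indic.
split; first by have [[]] := Ex_top bP.
move=> y; apply: Ex_01; first by apply: bmf_comp bP; exact: measurable_add_top2.
by move=> t; exact: indic01.
Qed.

Lemma bmf_set_graphon K (P : set (cube R (rset K.+1))) : measurable P ->
  bmf (set_graphon P).
Proof. by move=> /set_graphon01[? ?]; exact: bmf01. Qed.

Lemma Ex_set_graphon K (P : set (cube R (rset K.+1))) : measurable P ->
  fine (cube_lebesgue R (rset K.+1) P) =
    \int[cube_lebesgue R (rset_lt K.+1)]_y set_graphon P y.
Proof.
by move=> mP; rewrite -Ex_indic// (Ex_top _).2//; exact: bmf_indic.
Qed.

End top_coordinate.

(** * Conditional expectation with respect to a finite partition *)

Section conditional_expectation.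
Context d (T : measurableType d) (R : realType) (mu : probability T R).
Implicit Types (F : finType) (W : T -> R).

Definition lab_vol F (c : T -> F) (f : F) : R := \int[mu]_x (c x == f)%:R.

Definition lab_weight F W (c : T -> F) (f : F) : R :=
  if lab_vol c f == 0 then 0
  else (lab_vol c f)^-1 * \int[mu]_x (W x * (c x == f)%:R).

Definition cond_exp F W (c : T -> F) (x : T) : R := lab_weight W c (c x).

Lemma bmf_cell F (c : T -> F) f : finlab c -> bmf (fun x => (c x == f)%:R : R).
Proof. exact: (finlab_bmf (fun g => (g == f)%:R)). Qed.

Lemma lab_vol_ge0 F (c : T -> F) f : 0 <= lab_vol c f.
Proof. by apply: Ex_ge0 => x; rewrite ler0n. Qed.

(** The convention on null cells is harmless: [W] is bounded, so its integral
    over such a cell vanishes. *)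
Lemma lab_vol_weight F W (c : T -> F) f : bmf W -> finlab c ->
  lab_vol c f * lab_weight W c f = \int[mu]_x (W x * (c x == f)%:R).
Proof.
move=> bW mc; rewrite /lab_weight; case: eqP => [v0|/eqP v0]; last by rewrite mulVKf.
rewrite mulr0; symmetry; have [_ [M WM]] := bW; apply/eqP; rewrite -normr_le0.
have bcell := bmf_cell f mc.
apply: (le_trans (Ex_norm _ (bmfM bW bcell))).
apply: (@le_trans _ _ (\int[mu]_x (M * (c x == f)%:R))); last first.
  by rewrite ExZ// -/(lab_vol c f) v0 mulr0.
apply: Ex_le; first exact/bmf_norm/bmfM.
  by apply: bmfM => //; exact: bmf_cst.
by move=> x; rewrite normrM [X in _ * X]ger0_norm ?ler0n// ler_wpM2r.
Qed.

Lemma Ex_lab F W (c : T -> F) (h : F -> R) : bmf W -> finlab c ->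
  \int[mu]_x (W x * h (c x)) =
    \sum_f h f * \int[mu]_x (W x * (c x == f)%:R).
Proof.
move=> bW mc.
transitivity (\int[mu]_x \sum_f (h f * (W x * (c x == f)%:R))).
  apply: eq_Ex => x; rewrite (bigD1 (c x))//= eqxx mulr1 big1 ?addr0 1?mulrC//.
  by move=> f /negbTE fc; rewrite eq_sym fc !mulr0.
have b f : bmf (fun x => W x * (c x == f)%:R).
  by apply: bmfM => //; exact: bmf_cell.
rewrite Ex_sum => [|f _]; last by apply: bmfM => //; exact: bmf_cst.
by apply: eq_bigr => f _; rewrite ExZ.
Qed.

Lemma bmf_cond_exp F W (c : T -> F) : finlab c -> bmf (cond_exp W c).
Proof. exact: (finlab_bmf (lab_weight W c)). Qed.

Lemma Ex_cond_exp F W (c : T -> F) (h : F -> R) : bmf W -> finlab c ->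
  \int[mu]_x (cond_exp W c x * h (c x)) = \int[mu]_x (W x * h (c x)).
Proof.
move=> bW mc; rewrite (Ex_lab h bW mc) (Ex_lab h (bmf_cond_exp W mc) mc).
apply: eq_bigr => f _; congr (_ * _); rewrite -(lab_vol_weight f bW mc).
have bcell := bmf_cell f mc.
rewrite mulrC /lab_vol -(ExZ mu _ bcell); apply: eq_Ex => x; rewrite /cond_exp.
by case: eqP => [->|]; rewrite ?mulr0.
Qed.

Lemma lab_weight01 F W (c : T -> F) f : bmf W -> finlab c ->
  (forall x, 0 <= W x <= 1) -> 0 <= lab_weight W c f <= 1.
Proof.
move=> bW mc W01; rewrite /lab_weight; case: ifPn => [_|v0].
  by rewrite lexx ler01.
have v_gt0 : 0 < lab_vol c f by rewrite lt_neqAle eq_sym v0 lab_vol_ge0.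
have bcell := bmf_cell f mc.
apply/andP; split.
  apply: mulr_ge0; first by rewrite invr_ge0 ltW.
  by apply: Ex_ge0 => x; case/andP: (W01 x) => ? _; rewrite mulr_ge0// ler0n.
rewrite ler_pdivrMl// mulr1; apply: Ex_le => //; first exact: bmfM.
by move=> x; case/andP: (W01 x) => _ ?; rewrite ler_piMl// ler0n.
Qed.

Lemma cond_exp01 F W (c : T -> F) x : bmf W -> finlab c ->
  (forall x, 0 <= W x <= 1) -> 0 <= cond_exp W c x <= 1.
Proof. by move=> *; exact: lab_weight01. Qed.

(** The coarser conditional expectation is the orthogonal projection of the finer
    one. *)
Lemma cond_exp_pythagoras F F' W (c : T -> F) (c' : T -> F') (pi : F' -> F) :
  bmf W -> finlab c' -> (forall x, c x = pi (c' x)) ->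
  \int[mu]_x (cond_exp W c' x - cond_exp W c x) ^+ 2 =
  \int[mu]_x (cond_exp W c' x) ^+ 2 - \int[mu]_x (cond_exp W c x) ^+ 2.
Proof.
move=> bW mc' cc'.
have mc : finlab c := finlab_factor mc' cc'.
have b := bmf_cond_exp W mc; have b' := bmf_cond_exp W mc'.
have E1 : \int[mu]_x (cond_exp W c' x * cond_exp W c x) =
          \int[mu]_x (cond_exp W c x) ^+ 2.
  transitivity (\int[mu]_x (cond_exp W c' x * lab_weight W c (pi (c' x)))).
    by apply: eq_Ex => x; rewrite /cond_exp cc'.
  rewrite (Ex_cond_exp (lab_weight W c \o pi) bW mc').
  transitivity (\int[mu]_x (W x * lab_weight W c (c x))).
    by apply: eq_Ex => x; rewrite /= cc'.
  by rewrite -(Ex_cond_exp _ bW mc); apply: eq_Ex => x; rewrite expr2.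
transitivity (\int[mu]_x (((cond_exp W c' x) ^+ 2 + (cond_exp W c x) ^+ 2) -
    2 * (cond_exp W c' x * cond_exp W c x))).
  by apply: eq_Ex => x; ring.
have b'b := bmfM b' b.
rewrite (ExB mu (bmfD (bmf_sqr b') (bmf_sqr b)) (bmfM (bmf_cst _ 2) b'b)).
rewrite (ExD mu (bmf_sqr b') (bmf_sqr b)) (ExZ mu 2 b'b) E1.
set u := \int[mu]_x _; set v := \int[mu]_x _.
by rewrite mulr2n mulrDl mul1r opprD addrA addrK.
Qed.

(** A function of the finer label sees [W] only through its finer conditional
    expectation, so its correlation with [W - E[W|c]] is at most the distance
    between the two conditional expectations.  This is the energy increment of the
    regularity lemma. *)
Lemma cond_exp_correlation F F' W (c : T -> F) (c' : T -> F') (pi : F' -> F)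
    (h : F' -> R) :
  bmf W -> finlab c' -> (forall x, c x = pi (c' x)) ->
  (forall f, `|h f| <= 1) ->
  (\int[mu]_x ((W x - cond_exp W c x) * h (c' x))) ^+ 2 <=
  \int[mu]_x (cond_exp W c' x) ^+ 2 - \int[mu]_x (cond_exp W c x) ^+ 2.
Proof.
move=> bW mc' cc' h1.
have mc : finlab c := finlab_factor mc' cc'.
have b := bmf_cond_exp W mc; have b' := bmf_cond_exp W mc'.
have bh : bmf (fun x => h (c' x)) by exact: finlab_bmf.
have -> : \int[mu]_x ((W x - cond_exp W c x) * h (c' x)) =
    \int[mu]_x ((cond_exp W c' x - cond_exp W c x) * h (c' x)).
  have E (u : T -> R) : bmf u ->
      \int[mu]_x ((u x - cond_exp W c x) * h (c' x)) =
      \int[mu]_x (u x * h (c' x)) - \int[mu]_x (cond_exp W c x * h (c' x)).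
    move=> bu; rewrite -ExB; [|exact: bmfM..].
    by apply: eq_Ex => x; rewrite mulrBl.
  by rewrite !E// Ex_cond_exp.
have bd := bmfB b' b.
apply: (le_trans (Ex_sqr mu (bmfM bd bh))).
rewrite -(cond_exp_pythagoras bW mc' cc').
apply: Ex_le; [exact/bmf_sqr/bmfM|exact: bmf_sqr|move=> x].
by rewrite exprMn ler_piMr ?sqr_ge0// -real_normK ?num_real// expr_le1.
Qed.

End conditional_expectation.

(** * Convergence of martingales along finite partitions *)

Section martingale.
Context d (T : measurableType d) (R : realType) (mu : probability T R).

(** All quantifiers are countable, so this set of convergence is measurable by
    construction. *)
Definition cauchy_set (f : nat -> T -> R) : set T :=
  \bigcap_m \bigcup_N \bigcap_j
    [set x | `|f (j + N)%N x - f N x| <= m.+1%:R^-1].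

Lemma measurable_osc (f g : T -> R) (e : R) : bmf f -> bmf g ->
  measurable [set x | `|f x - g x| <= e].
Proof.
move=> bf bg.
have [mn _] := bmf_norm (bmfB bf bg).
have := finlab_le mn (@measurable_cst _ _ T R setT e).
by move=> /(_ true); congr measurable; apply/seteqP; split=> x /=.
Qed.

Lemma measurable_cauchy_set (f : nat -> T -> R) : (forall n, bmf (f n)) ->
  measurable (cauchy_set f).
Proof.
move=> bf; apply: bigcap_measurable => [|m _]; first by exists 0%N.
apply: bigcup_measurable => N _.
apply: bigcap_measurable => [|j _]; first by exists 0%N.
exact: measurable_osc.
Qed.

Lemma cauchy_set_cvg (f : nat -> T -> R) x : cauchy_set f x ->
  cvgn (fun n => f n x).
Proof.
move=> Cx; apply/cauchy_cvgP/cauchy_exP => e e0.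
have [m me] : exists m, m.+1%:R^-1 < e.
  have [N _ /(_ N (leqnn N)) ?] := near_infty_natSinv_lt (PosNum e0).
  by exists N.
have [N _ NC] := Cx m I.
exists (f N x); exists N => // j /= Nj; rewrite /ball/= distrC.
by rewrite -(subnK Nj); apply: le_lt_trans me; exact: NC.
Qed.


(** The filtration is given by labels of finer and finer finite partitions, so that
    being adapted means being a function of the current label and no conditional
    expectation is needed to state the martingale property. *)
Definition is_martingale (F : nat -> finType) (c : forall s, T -> F s)
    (M : nat -> T -> R) : Prop :=
  [/\ forall s, finlab (c s),
      forall s, exists pi : F s.+1 -> F s, forall x, c s x = pi (c s.+1 x),
      forall s, exists w : F s -> R, forall x, M s x = w (c s x),
      forall s x, 0 <= M s x <= 1 &
      forall s (h : F s -> R),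
        \int[mu]_x (M s.+1 x * h (c s x)) = \int[mu]_x (M s x * h (c s x))].

Lemma is_martingale_shift N (F : nat -> finType) (c : forall s, T -> F s) M :
  is_martingale c M ->
  is_martingale (fun s => c (s + N)%N) (fun s => M (s + N)%N).
Proof.
move=> [mc pi w M01 mart]; split=> s.
- exact: mc.
- exact: pi.
- exact: w.
- exact: M01.
- exact: (mart (s + N)%N).
Qed.

Section maximal_inequality.
Variables (F : nat -> finType) (c : forall s, T -> F s) (M : nat -> T -> R).
Hypothesis mart : is_martingale c M.

Let adapted s (f : T -> R) := exists h : F s -> R, forall x, f x = h (c s x).

Let adapted_bmf s f : adapted s f -> bmf f.
Proof.
have [mc _ _ _ _] := mart.
by move=> [h fh]; apply: (eq_bmf (fun x => esym (fh x))); exact: finlab_bmf.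
Qed.

Let adaptedS s f : adapted s f -> adapted s.+1 f.
Proof.
have [_ + _ _ _] := mart => /(_ s)[pi cpi] [h fh].
by exists (h \o pi) => x /=; rewrite fh cpi.
Qed.

Let adapted_op (op : R -> R -> R) s f g :
  adapted s f -> adapted s g -> adapted s (fun x => op (f x) (g x)).
Proof.
move=> [h fh] [k gk]; exists (fun u => op (h u) (k u)) => x.
by rewrite fh gk.
Qed.

Let adaptedM s : adapted s (M s).
Proof. by have [_ _ + _ _] := mart => /(_ s). Qed.

Let adapted0 s : adapted s (M 0%N).
Proof. by elim: s => [|s IHs]; [exact: adaptedM|exact: adaptedS]. Qed.

Let bM s : bmf (M s).
Proof. exact/adapted_bmf/adaptedM. Qed.

Let martE s g : adapted s g ->
  \int[mu]_x (M s.+1 x * g x) = \int[mu]_x (M s x * g x).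
Proof.
move=> [h gh]; have [_ _ _ _ /(_ s h) E] := mart.
by rewrite (eq_Ex _ (g := fun x => M s.+1 x * h (c s x))) ?E => [|x];
  [apply: eq_Ex => x|]; rewrite gh.
Qed.

(** Increments are orthogonal to the past. *)
Lemma martingale_increment n :
  \int[mu]_x (M n x - M 0%N x) ^+ 2 =
  \int[mu]_x (M n x) ^+ 2 - \int[mu]_x (M 0%N x) ^+ 2.
Proof.
have E : \int[mu]_x (M n x * M 0%N x) = \int[mu]_x (M 0%N x) ^+ 2.
  elim: n => [|n IHn]; first by apply: eq_Ex => x; rewrite expr2.
  by rewrite martE.
have b := bmfM (bM n) (bM 0%N).
transitivity (\int[mu]_x (((M n x) ^+ 2 + (M 0%N x) ^+ 2) -
    2 * (M n x * M 0%N x))).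
  by apply: eq_Ex => x; ring.
rewrite (ExB mu (bmfD (bmf_sqr (bM n)) (bmf_sqr (bM 0%N))) (bmfM (bmf_cst _ 2) b)).
rewrite (ExD mu (bmf_sqr (bM n)) (bmf_sqr (bM 0%N))) (ExZ mu 2 b) E.
set u := \int[mu]_x _; set v := \int[mu]_x _.
by rewrite mulr2n mulrDl mul1r opprD addrA addrK.
Qed.

Variable e : R.
Hypothesis e_gt0 : 0 < e.

Fixpoint stopped n : T -> R :=
  if n is n'.+1 then fun x =>
    if e < `|stopped n' x - M 0%N x| then stopped n' x else M n'.+1 x
  else M 0%N.

Let adapted_stopped n : adapted n (stopped n).
Proof.
elim: n => [|n IHn]; first exact: adaptedM.
have [h sh] := adaptedS IHn; have [h0 M0h] := adapted0 n.+1.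
have [hM Mh] := adaptedM n.+1.
exists (fun u => if e < `|h u - h0 u| then h u else hM u) => x /=.
by rewrite sh M0h Mh.
Qed.

Let bst n : bmf (stopped n).
Proof. exact/adapted_bmf/adapted_stopped. Qed.

Let stopped_id n x : `|stopped n x - M 0%N x| <= e -> stopped n x = M n x.
Proof.
case: n => [//|n] /=; case: ifPn => // st le.
by move: st; rewrite ltNge le.
Qed.

Let stopped_exceeds n j x : (j <= n)%N -> e < `|M j x - M 0%N x| ->
  e < `|stopped n x - M 0%N x|.
Proof.
elim: n => [|n IHn]; first by rewrite leqn0 => /eqP ->.
rewrite leq_eqVlt => /predU1P[->|jn] Mj /=; first by case: ifPn.
by rewrite IHn// IHn.
Qed.

(* The part of the martingale after the stopping time has mean zero given the
   stopped value. *)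
Let stopped_cross n :
  \int[mu]_x ((M n x - stopped n x) * (stopped n x - M 0%N x)) = 0.
Proof.
elim: n => [|n IHn].
  by rewrite -(Ex_cst mu 0); apply: eq_Ex => x /=; rewrite subrr mul0r.
pose g x := if e < `|stopped n x - M 0%N x| then stopped n x - M 0%N x else 0.
have ag : adapted n g.
  exact: (adapted_op (fun s m => if e < `|s - m| then s - m else 0)
    (adapted_stopped n) (adapted0 n)).
have bg := adapted_bmf ag.
transitivity (\int[mu]_x (M n.+1 x * g x - stopped n x * g x)).
  apply: eq_Ex => x; rewrite /g /=; case: ifPn => _.
    by rewrite mulrBl.
  by rewrite subrr mul0r !mulr0 subrr.
rewrite (ExB mu (bmfM (bM n.+1) bg) (bmfM (bst n) bg)) martE//.
rewrite -(ExB mu (bmfM (bM n) bg) (bmfM (bst n) bg)) -[RHS]IHn.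
apply: eq_Ex => x; rewrite /g; case: ifPn => [_|]; first by rewrite mulrBl.
by rewrite -leNgt => /stopped_id ->; rewrite !subrr mul0r.
Qed.

(** Doob's argument: when the martingale has moved by more than [e] up to time
    [n], so has the stopped one, whose second moment is at most that of the
    martingale since the rest of the path is orthogonal to it. *)
Lemma maximal_inequality n :
  fine (mu [set x | exists2 j, (j <= n)%N & e < `|M j x - M 0%N x|]) <=
  e ^- 2 * (\int[mu]_x (M n x) ^+ 2 - \int[mu]_x (M 0%N x) ^+ 2).
Proof.
set A := [set x | _].
have mA : measurable A.
  rewrite (_ : A = \bigcup_(j < n.+1) ~` [set x | `|M j x - M 0%N x| <= e]).
    apply: bigcup_measurable => j _; apply: measurableC.
    exact: measurable_osc.
  apply/seteqP; split=> x.
    by move=> [j jn ej]; exists j => //=; apply/negP; rewrite -ltNge.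
  by move=> [j /= jn /negP]; rewrite -ltNge => ej; exists j.
have bS := bmfB (bst n) (bM 0%N).
rewrite ler_pdivlMl ?exprn_gt0// -martingale_increment -Ex_indic//.
have bA : bmf (\1_A : T -> R) by exact: bmf_indic.
rewrite -(ExZ mu _ bA).
apply: (@le_trans _ _ (\int[mu]_x (stopped n x - M 0%N x) ^+ 2)).
  apply: Ex_le; [exact: (bmfM (bmf_cst _ _) bA)|exact: bmf_sqr|move=> x].
  rewrite indicE; have [xA|_] := boolP (x \in A); last first.
    by rewrite mulr0 sqr_ge0.
  rewrite mulr1 -[leRHS]real_normK ?num_real// lerXn2r ?nnegrE//; first exact: ltW.
  apply/ltW; move: xA; rewrite inE => -[j jn]; exact: stopped_exceeds.
have bd := bmfB (bM n) (bst n).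
have bx := bmfM bd bS.
have := Ex_ge0 mu (fun x => sqr_ge0 (M n x - stopped n x)).
rewrite -(lerD2l (\int[mu]_x (stopped n x - M 0%N x) ^+ 2)) addr0.
move=> le; apply: (le_trans le).
rewrite -(ExD mu (bmf_sqr bS) (bmf_sqr bd)).
rewrite -[leLHS]addr0 -{1}(mulr0 2) -(stopped_cross n) -(ExZ mu 2 bx).
rewrite -(ExD mu (bmfD (bmf_sqr bS) (bmf_sqr bd)) (bmfM (bmf_cst _ 2) bx)).
by rewrite le_eqVlt; apply/orP; left; apply/eqP; apply: eq_Ex => x; ring.
Qed.

End maximal_inequality.

(** The second moments increase and are bounded, hence the maximal inequality
    applied from time [N] on bounds the probability of late oscillations by a
    quantity that tends to zero with [N]. *)
Lemma martingale_cauchy (F : nat -> finType) (c : forall s, T -> F s)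
    (M : nat -> T -> R) :
  is_martingale c M -> mu (~` cauchy_set M) = 0%E.
Proof.
move=> mart.
have bM s : bmf (M s).
  have [mc _ /(_ s)[w Mw] _ _] := mart.
  by apply: (eq_bmf (fun x => esym (Mw x))); exact: finlab_bmf.
pose en s := \int[mu]_x (M s x) ^+ 2.
have en_cvg : cvgn en.
  apply: nondecreasing_is_cvgn.
    apply/nondecreasing_seqP => s.
    have := martingale_increment (is_martingale_shift s mart) 1.
    rewrite add1n add0n -/(en s) -/(en s.+1) => E.
    by rewrite -subr_ge0 -E; apply: Ex_ge0 => x; exact: sqr_ge0.
  exists 1 => _ [s _ <-]; have [_ _ _ M01 _] := mart.
  suff /andP[] : 0 <= en s <= 1 by [].
  apply: Ex_01 => [|x]; first exact: bmf_sqr.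
  by have /andP[? ?] := M01 s x; rewrite sqr_ge0 expr_le1.
pose B (m N n : nat) := [set x | exists2 j, (j <= n)%N &
  m.+1%:R^-1 < `|M (j + N)%N x - M N x|].
have mB m N n : measurable (B m N n).
  rewrite (_ : B m N n = \bigcup_(j < n.+1)
      ~` [set x | `|M (j + N)%N x - M N x| <= m.+1%:R^-1]).
    apply: bigcup_measurable => j _; apply: measurableC.
    exact: measurable_osc.
  apply/seteqP; split=> x.
    by move=> [j jn ej]; exists j => //=; apply/negP; rewrite -ltNge.
  by move=> [j /= jn /negP]; rewrite -ltNge => ej; exists j.
have BU m N : (mu (\bigcup_n B m N n) <=
    (m.+1%:R ^+ 2 * (limn en - en N))%:E)%E.
  have mBU : measurable (\bigcup_n B m N n) by exact: bigcup_measurable.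
  have ndB : nondecreasing_seq (B m N).
    move=> n n' nn'; apply/subsetPset => x [j jn ej]; exists j => //.
    exact: leq_trans nn'.
  have cvB := nondecreasing_cvg_mu (mu := mu) (mB m N) mBU ndB.
  rewrite -(cvg_lim _ cvB)//; apply: lime_le; first exact: (cvgP _ cvB).
  apply: nearW => n /=.
  rewrite -[mu _]fineK ?fin_num_measure// lee_fin.
  have m0 : 0 < m.+1%:R^-1 :> R by rewrite invr_gt0.
  apply: (le_trans (maximal_inequality (is_martingale_shift N mart) m0 n)).
  rewrite exprVn invrK ler_wpM2l ?sqr_ge0// add0n lerB//.
  apply: nondecreasing_cvgn_le => //.
  apply/nondecreasing_seqP => s.
  have := martingale_increment (is_martingale_shift s mart) 1.
  rewrite add1n add0n -/(en s) -/(en s.+1) => E.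
  by rewrite -subr_ge0 -E; apply: Ex_ge0 => x; exact: sqr_ge0.
have mBI m : measurable (\bigcap_N \bigcup_n B m N n).
  apply: bigcap_measurable => [|N _]; first by exists 0%N.
  exact: bigcup_measurable.
have BI m : mu (\bigcap_N \bigcup_n B m N n) = 0%E.
  apply/eqP; rewrite eq_le measure_ge0 andbT; apply/lee_addgt0Pr => e e0.
  rewrite add0e.
  have e'0 : 0 < e / m.+1%:R ^+ 2 by rewrite divr_gt0// exprn_gt0.
  have /cvgrPdist_lt/(_ _ e'0)[N _ NE'] : en @ \oo --> limn en by [].
  have {NE'}NE := NE' N (leqnn N).
  have sub : \bigcap_N \bigcup_n B m N n `<=` \bigcup_n B m N n.
    by move=> x /(_ N); exact.
  have mBN : measurable (\bigcup_n B m N n) by exact: bigcup_measurable.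
  apply: (le_trans (le_measure mu (mem_set (mBI m)) (mem_set mBN) sub)).
  apply: (le_trans (BU m N)); rewrite lee_fin.
  rewrite mulrC -ler_pdivlMr ?exprn_gt0//.
  by apply: (le_trans (ler_norm _)); exact: ltW.
have mC : measurable (~` cauchy_set M).
  by apply: measurableC; exact: measurable_cauchy_set.
apply/eqP; rewrite eq_le measure_ge0 andbT.
have sub : ~` cauchy_set M `<=` \bigcup_m \bigcap_N \bigcup_n B m N n.
  rewrite /cauchy_set setC_bigcap => x [m _].
  rewrite setC_bigcup => xm; exists m => // N _.
  have := xm N I; rewrite setC_bigcap => -[j _ /= /negP]; rewrite -ltNge => ej.
  by exists j => //; exists j.
have mBB : measurable (\bigcup_m \bigcap_N \bigcup_n B m N n).
  exact: bigcup_measurable.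
apply: (le_trans (le_measure mu (mem_set mC) (mem_set mBB) sub)).
rewrite [leLHS](_ : _ = 0%E)//.
apply/negligibleP => //; apply: negligible_bigcup => m.
by apply/negligibleP; [exact: mBI|exact: BI].
Qed.

End martingale.

(** * Branching partitions as sequences of labels *)

Section labels.
Context (R : realType).

Lemma label_partition K (J : finType) (c : cube R (rset K) -> J) :
  finlab c -> symmetric_fun c ->
  symmetric_partition (fun j => c @^-1` [set j]).
Proof.
move=> mc sc; split=> //.
- by move=> j s x; rewrite /preimage/= sc.
- by apply/trivIsetP => i j _ _ ij; apply/seteqP; split=> // x [/= ci cj];
    move: ij; rewrite -ci -cj eqxx.
- by apply/seteqP; split=> // x _; exists (c x).
Qed.

Lemma partition_label K (J : finType) (Q : J -> set (cube R (rset K))) :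
  symmetric_partition Q -> exists c : cube R (rset K) -> J,
    [/\ finlab c, symmetric_fun c & forall j, Q j = c @^-1` [set j]].
Proof.
move=> [mQ sQ tQ cQ].
have /choice[c Qc] : forall x, exists j, Q j x.
  move=> x; have : (\bigcup_j Q j) x by rewrite cQ.
  by move=> [j _ Qx]; exists j.
have cP x j : Q j x -> c x = j.
  move=> Qx; apply/eqP/negPn/negP => cj.
  have : (Q (c x) `&` Q j) x by split => //; exact: Qc.
  by rewrite (trivIsetP.1 tQ _ _ I I cj).
have QE j : Q j = c @^-1` [set j].
  by apply/seteqP; split=> x /=; [exact: cP|move=> <-; exact: Qc].
exists c; split=> // [j|s x]; first by rewrite -QE.
by apply: cP; apply/sQ; exact: Qc.
Qed.

Lemma branching_label K p (P : branching_partition R K p) :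
  exists c : forall l, cube R (rset K) -> level_index p l,
    [/\ forall l, finlab (c l), forall l, symmetric_fun (c l),
        forall l i, P l i = c l @^-1` [set i] &
        forall l x, c l x = (c l.+1 x).1].
Proof.
have /= H l := partition_label (level_partition P l).
exists (fun l => projT1 (cid (H l))); split=> l.
- by case: cid => c [].
- by case: cid => c [].
- by case: cid => c [].
move=> x; case: cid => c [mc sc Pc]; case: cid => c' [mc' sc' Pc'] /=.
have : P l.+1 (c' x) x by rewrite Pc'.
case: (c' x) => i j /= Px; have : P l i x by rewrite -level_refine; exists j.
by rewrite Pc.
Qed.

Fixpoint iter_label T p (d : forall l, T -> 'I_(p l)) l :
    T -> level_index p l :=
  if l is l'.+1 then fun x => (iter_label d l' x, d l' x) else fun=> tt.

Lemma finlab_iter_label dd (T : measurableType dd) p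
    (d : forall l, T -> 'I_(p l)) l :
  (forall l, finlab (d l)) -> finlab (iter_label d l).
Proof.
move=> md; elim: l => [|l IHl] /=; last exact: finlab_pair.
move=> [] /=; rewrite (_ : _ @^-1` _ = setT)//.
by apply/seteqP; split.
Qed.

(** A branching partition of degree [p] amounts to one label with values in
    ['I_(p l)] for each level [l]. *)
Lemma branching_of_labels K p (d : forall l, cube R (rset K) -> 'I_(p l)) :
  (forall l, finlab (d l)) -> (forall l, symmetric_fun (d l)) ->
  exists P : branching_partition R K p,
    forall l i, P l i = iter_label d l @^-1` [set i].
Proof.
move=> md sd.
have sl l : symmetric_fun (iter_label d l).
  by elim: l => //= l IHl s x /=; rewrite IHl sd.
have part l := label_partition (finlab_iter_label (l := l) md) (sl l).
have e0 : iter_label d 0 @^-1` [set tt] = setT by apply/seteqP; split.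
have er l (i : level_index p l) :
    \bigcup_(j : 'I_(p l)) iter_label d l.+1 @^-1` [set (i, j)] =
    iter_label d l @^-1` [set i].
  apply/seteqP; split=> [x [j _ /= [->]]//|x /= <-].
  by exists (d l x).
by exists (Build_branching_partition part e0 er).
Qed.

Lemma perm_rset_lt_subproof K (s : 'S_K) (A : rset_lt K) :
  ((s @: val A)%SET != finset.set0) &&
  ((s @: val A)%SET \proper [set: 'I_K]%SET).
Proof.
have /andP[A0 AT] := valP A; rewrite imset_eq0 A0 finset.properT.
move: AT; rewrite finset.properT; apply: contra => /eqP AT.
apply/eqP/setP => x; rewrite finset.inE; have : s x \in (s @: val A)%SET.
  by rewrite AT finset.inE.
by move=> /imsetP[y yA /perm_inj ->].
Qed.

Definition perm_rset_lt K (s : 'S_K) (A : rset_lt K) : rset_lt K :=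
  Sub (s @: val A)%SET (perm_rset_lt_subproof s A).

Lemma perm_rset_of_lt K (s : 'S_K) (A : rset_lt K) :
  perm_rset s (rset_of_lt A) = rset_of_lt (perm_rset_lt s A).
Proof. exact: val_inj. Qed.

Lemma perm_rset_top K (s : 'S_K.+1) : perm_rset s (rset_top K) = rset_top K.
Proof.
apply: val_inj => /=; apply/setP => x; rewrite finset.inE.
by apply/imsetP; exists (s^-1 x)%g; rewrite ?finset.inE// permKV.
Qed.

Lemma perm_rset_lt_inj K (s : 'S_K) : injective (perm_rset_lt s).
Proof.
move=> A B /(congr1 val) /= /imset_inj AB; apply: val_inj; apply: AB.
exact: perm_inj.
Qed.

End labels.

(** * Realizing a consistent tree of hypergraphons *)

Section cumulative.
Context (R : realType).

(** The cell of [u] is the last one whose left end is at most [u]. *)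
Lemma cumulative_cell n (a : 'I_n -> R) u : 0 <= u -> u < \sum_j a j ->
  exists j : 'I_n, \sum_(j' < n | (j' < j)%N) a j' <= u /\
    u < \sum_(j' < n | (j' < j)%N) a j' + a j.
Proof.
move=> u0 ua.
have n0 : (0 < n)%N.
  by case: n a ua => // a; rewrite big_ord0 ltNge u0.
pose S (j : 'I_n) := \sum_(j' < n | (j' < j)%N) a j'.
have SS (j : 'I_n) : \sum_(j' < n | (j' <= j)%N) a j' = S j + a j.
  rewrite (bigD1 j)//= addrC; congr (_ + _); apply: eq_bigl => i.
  by rewrite ltn_neqAle andbC.
have S0 : S (Ordinal n0) <= u by rewrite /S big_pred0.
case: (arg_maxnP (P := fun j => S j <= u) (fun j => j : nat) S0) => j Sj jmax.
exists j; split => //; rewrite ltNge; apply/negP => Su.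
have [jn|jn] := ltnP j.+1 n.
  have /jmax /= : S (Ordinal jn) <= u.
    by apply: le_trans Su; rewrite -/(S j) -SS.
  by rewrite ltnn.
suff : \sum_j a j <= u by rewrite leNgt ua.
apply: le_trans Su; rewrite -/(S j) -SS le_eqVlt; apply/orP; left; apply/eqP.
by apply: eq_bigl => i; rewrite -ltnS (leq_trans (ltn_ord i) jn).
Qed.

(** The point 1 is left out of the hypothesis because half-open intervals do not
    cover it; it is negligible. *)
Lemma unitI_interval (a w : R) (A : set (unitI R)) : 0 <= a -> 0 <= w ->
  a + w <= 1 -> measurable A ->
  (forall t, sval t < 1 -> A t <-> a <= sval t < a + w) ->
  unitI_lebesgue A = w%:E.
Proof.
move=> a0 w0 aw1 mA AE.
pose sv := @sval R (fun x => 0 <= x <= 1).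
have sub1 : `[a, a + w[%classic `<=` sv @` A.
  move=> t /=; rewrite in_itv/= => /andP[at_ taw].
  have t1 : t < 1 by exact: lt_le_trans aw1.
  have t01 : 0 <= t <= 1 by rewrite (le_trans a0 at_) ltW.
  by exists (exist _ t t01) => //; apply/AE => //=; apply/andP.
have sub2 : sv @` A `<=` `[a, a + w[%classic `|` [set 1].
  move=> _ [t At <-]; have [t1|t1] := ltP (sval t) 1.
    by left; rewrite /= in_itv/=; apply/AE.
  by right; apply/eqP; rewrite eq_le t1 andbT; case/andP: (svalP t).
have mI : measurable (sv @` A).
  case: mA => B mB <-; rewrite setTI.
  have -> : sv @` (sv @^-1` B) = B `&` `[0, 1].
    apply/seteqP; split => [_ [[x x01] /= Bx <-]|x [Bx /=]].
      by split => //=; rewrite in_itv.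
    by rewrite in_itv /= => x01; exists (exist _ x x01).
  exact: measurableI.
have mw : lebesgue_measure (`[a, a + w[%classic : set R) = w%:E.
  rewrite lebesgue_measure_itv/= lte_fin.
  case: ltP => [_|]; first by rewrite -EFinD addrAC subrr add0r.
  by rewrite gerDl => w0'; congr EFin; apply/eqP; rewrite eq_le w0 w0'.
have msU : measurable (`[a, a + w[%classic `|` [set 1] : set R).
  by apply: measurableU.
have mI0 : measurable (`[a, a + w[%classic : set R) by [].
have le2 := le_measure lebesgue_measure (mem_set mI0) (mem_set mI) sub1.
have le1 := le_measure lebesgue_measure (mem_set mI) (mem_set msU) sub2.
apply/eqP; rewrite eq_le /unitI_lebesgue; apply/andP; split; last first.
  by rewrite -mw.
apply: (le_trans le1); rewrite -mw.
have := @measureU2 _ _ _ lebesgue_measure _ _ mI0 (measurable_set1 (1 : R)).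
move=> H; apply: (le_trans H).
by rewrite [X in (_ + X <= _)%E](lebesgue_measure_set1 (1 : R)) adde0.
Qed.

End cumulative.

Section interval_tree.
Context (R : realType) (X : Type) (p : nat -> nat).
Hypothesis hp : positive_degrees p.
Variable W : forall l, level_index p l -> X -> R.

Fixpoint left_end l : level_index p l -> X -> R :=
  match l with
  | 0 => fun _ _ => 0
  | l'.+1 => fun i x => left_end i.1 x +
      \sum_(j < p l' | (j < i.2)%N) W (l := l'.+1) (i.1, j) x
  end.

(** The children of an index fill its interval from left to right. *)
Definition in_interval l (i : level_index p l) (x : X) (t : R) : bool :=
  (left_end i x <= t) && (t < left_end i x + W i x).

(** For [t = 1] no interval contains [t] and the first child is taken. *)
Fixpoint tree_label l : X -> R -> level_index p l :=
  match l with
  | 0 => fun _ _ => tt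
  | l'.+1 => fun x t => (tree_label l' x t, odflt (Ordinal (hp l'))
     [pick j | in_interval (l := l'.+1) (tree_label l' x t, j) x t])
  end.

Hypothesis W_ge0 : forall l (i : level_index p l) x, 0 <= W i x.
Hypothesis W_root : forall x, W (l := 0) tt x = 1.
Hypothesis W_sum : forall l (i : level_index p l) x,
  \sum_j W (l := l.+1) (i, j) x = W i x.

Lemma left_end_bounds l (i : level_index p l) x :
  0 <= left_end i x /\ left_end i x + W i x <= 1.
Proof.
elim: l i => [[]|l IHl [i j]] /=; first by rewrite W_root add0r.
have [i0 i1] := IHl i; split.
  by rewrite addr_ge0// sumr_ge0.
apply: le_trans i1; rewrite -addrA lerD2l -(W_sum i).
rewrite [leRHS](bigID (fun j' : 'I__ => (j' < j)%N))/= lerD2l.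
by rewrite (bigD1 j) ?ltnn//= lerDl sumr_ge0.
Qed.

Lemma in_interval_child l (i : level_index p l) (j : 'I_(p l)) x t :
  in_interval (l := l.+1) (i, j) x t -> in_interval i x t.
Proof.
rewrite /in_interval /= => /andP[le lt]; apply/andP; split.
  by apply: le_trans le; rewrite lerDl sumr_ge0.
apply: (lt_le_trans lt); rewrite -addrA lerD2l -(W_sum i).
rewrite [leRHS](bigID (fun j' : 'I__ => (j' < j)%N))/= lerD2l.
by rewrite (bigD1 j) ?ltnn//= lerDl sumr_ge0.
Qed.

Lemma in_interval_uniq l (i : level_index p l) (j j' : 'I_(p l)) x t :
  in_interval (l := l.+1) (i, j) x t -> in_interval (l := l.+1) (i, j') x t ->
  j = j'.
Proof.
wlog jj' : j j' / (j <= j')%N.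
  move=> H Hj Hj'; have [/H->//|/ltnW/H->//] := leqP j j'.
rewrite /in_interval /= => /andP[_ lt] /andP[le _].
apply/val_inj/eqP; rewrite eqn_leq jj'/= leqNgt; apply/negP => jj'_lt.
suff /(lt_le_trans lt)/lt_le_trans/(_ le) :
    left_end i x + \sum_(j0 < p l | (j0 < j)%N) W (l := l.+1) (i, j0) x +
      W (l := l.+1) (i, j) x <=
    left_end i x + \sum_(j0 < p l | (j0 < j')%N) W (l := l.+1) (i, j0) x.
  by rewrite ltxx.
rewrite -addrA lerD2l [leRHS](bigD1 j)//= addrC lerD2l.
rewrite [leRHS](bigID (fun j' : 'I__ => (j' < j)%N))/=.
rewrite [X in _ <= X + _](eq_bigl (fun j0 : 'I_(p l) => (j0 < j)%N)).
  by rewrite lerDl sumr_ge0.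
move=> j0; have [j0j|] := ltnP j0 j; last by rewrite andbF.
by rewrite (ltn_trans j0j jj'_lt)/= -(inj_eq val_inj) /= ltn_eqF.
Qed.

Lemma tree_labelP l (i : level_index p l) x t : 0 <= t < 1 ->
  tree_label l x t = i <-> in_interval i x t.
Proof.
move=> t01; elim: l i => [[]|l IHl [i j]].
  by rewrite /in_interval /= W_root add0r.
split=> /= [[/[dup] /IHl it -> <-]|it].
  case: pickP => //= nopick; exfalso; move: it => /andP[le lt].
  have u0 : 0 <= t - left_end i x by rewrite subr_ge0.
  have := lt; rewrite -ltrBlDl -(W_sum i) => /(cumulative_cell u0)[j'[le' lt']].
  have := nopick j'; rewrite /in_interval /= -lerBrDl le' /=.
  by rewrite -addrA -ltrBlDl lt'.
have ii := in_interval_child it; have -> : tree_label l x t = i by apply/IHl.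
congr (_, _); case: pickP => [j' it'|/(_ j)]; last by rewrite it.
exact: in_interval_uniq it' it.
Qed.

End interval_tree.

Section realization.
Context (R : realType) (K : nat) (p : nat -> nat).
Hypothesis hp : positive_degrees p.
Variable W : forall l, level_index p l -> cube R (rset_lt K.+1) -> R.

(** Over [y], the part of index [i] is an interval of length [W i y] in the top
    coordinate.  Measurability in both variables is automatic because the label
    is computed from finitely many comparisons of measurable functions, and the
    parts are symmetric because a permutation fixes the top coordinate. *)
Lemma realize_tree :
  (forall l (i : level_index p l), bmf (W i)) ->
  (forall l (i : level_index p l) s y, W i (y \o perm_rset_lt s) = W i y) ->
  (forall l (i : level_index p l) x, 0 <= W i x) ->
  (forall x, W (l := 0) tt x = 1) ->
  (forall l (i : level_index p l) x,
    \sum_j W (l := l.+1) (i, j) x = W i x) ->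
  exists Pt : branching_partition R K.+1 p,
    forall l (i : level_index p l), set_graphon (Pt l i) = W i.
Proof.
move=> bW sW W_ge0 W_root W_sum.
pose base (z : cube R (rset K.+1)) : cube R (rset_lt K.+1) := z \o @rset_of_lt _.
pose top (z : cube R (rset K.+1)) : R := sval (z (rset_top K)).
pose lab l z := tree_label hp W l (base z) (top z).
have btop : bmf top.
  apply: bmf01 => [|z]; last exact: (svalP (z _)).
  apply: (measurableT_comp _ (@measurable_coord R _ (rset_top K))).
  by move=> _ B mB; exists B.
have mbase : measurable_fun setT base by exact: measurable_reindex.
have bleft l (i : level_index p l) : bmf (left_end W i).
  elim: l i => [i|l IHl [i j]] /=; first exact: bmf_cst.
  by apply: (bmfD (IHl i)); apply: bmf_sum => j' _; exact: bW.
have mlab l : finlab (lab l).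
  elim: l => [|l IHl].
    by move=> []; rewrite (_ : _ @^-1` _ = setT)//; apply/seteqP; split.
  pose b (i : level_index p l.+1) z := in_interval W i (base z) (top z).
  have mb i : finlab (b i).
    have bl := bmf_comp mbase (bleft _ i).
    have br := bmfD bl (bmf_comp mbase (bW _ i)).
    exact: (finlab_map (fun uv => uv.1 && uv.2)
      (finlab_pair (finlab_le bl.1 btop.1) (finlab_lt btop.1 br.1))).
  pose h (u : level_index p l * {ffun level_index p l.+1 -> bool})
      : level_index p l.+1 :=
    (u.1, odflt (Ordinal (hp l)) [pick j | u.2 (u.1, j)]).
  have := finlab_map h (finlab_pair IHl (finlab_ffun mb)).
  congr finlab; apply/funext => z; rewrite /h /lab /=; congr (_, odflt _ _).
  by apply: eq_pick => j; rewrite /= ffunE.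
have slab l : symmetric_fun (lab l).
  move=> s z.
  have ebase : base (z \o perm_rset s) = base z \o perm_rset_lt s.
    by apply/funext => A; rewrite /base /= perm_rset_of_lt.
  have etop : top (z \o perm_rset s) = top z.
    by rewrite /top /= perm_rset_top.
  have eleft l' (i : level_index p l') :
      left_end W i (base (z \o perm_rset s)) = left_end W i (base z).
    elim: l' i => [//|l' IHl [i j]] /=; rewrite IHl; congr (_ + _).
    by apply: eq_bigr => j' _; rewrite ebase sW.
  rewrite /lab; elim: l => //= l ->; congr (_, odflt _ _).
  by apply: eq_pick => j; rewrite /= /in_interval eleft etop ebase sW.
have [||Pt PtE] := @branching_of_labels R K.+1 p (fun l z => (lab l.+1 z).2).
- by move=> l; apply: finlab_map; exact: mlab.
- by move=> l s z; rewrite slab.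
have labE l : iter_label (fun l z => (lab l.+1 z).2) l =1 lab l.
  by move=> z; elim: l => [|l /= ->//]; rewrite /lab.
exists Pt => l i; apply/funext => y; rewrite /set_graphon.
pose A : set (unitI R) := add_top y @^-1` Pt l i.
have mA : measurable A.
  rewrite -[X in measurable X]setTI.
  apply: (@measurable_add_top2 R K.+1 y measurableT); rewrite PtE.
  exact: (finlab_iter_label (fun l => finlab_map snd (mlab l.+1))).
transitivity (\int[@unitI_lebesgue R]_t \1_A t).
  by apply: eq_Ex => t; rewrite !indicE.
have [left0 left1] := left_end_bounds W_ge0 W_root W_sum i y.
rewrite Ex_indic//.
suff AE : unitI_lebesgue A = (W i y)%:E by rewrite [X in fine X]AE.
apply: (unitI_interval left0 (W_ge0 l i y) left1 mA) => t t1.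
have t01 : 0 <= sval t < 1 by rewrite t1 andbT; case/andP: (svalP t).
have := tree_labelP hp W_ge0 W_root W_sum i y t01.
rewrite /A /preimage /= PtE /= labE /lab /base /top add_top_top.
by congr (tree_label _ _ _ _ _ = _ <-> _); apply/funext => B /=; rewrite add_top_lt.
Qed.

End realization.

(** * Rounding to a grid *)

Section grid.
Context (R : realType).

Definition grid (N : nat) (r : R) : 'I_N.+1 := inord (Num.truncn (r * N%:R)).

Lemma gridP N (r : R) (a : 'I_N.+1) : 0 <= r <= 1 ->
  (grid N r = a) <-> (a%:R <= r * N%:R < a.+1%:R).
Proof.
move=> /andP[r0 r1].
have rN0 : 0 <= r * N%:R by rewrite mulr_ge0.
have tN : (Num.truncn (r * N%:R) < N.+1)%N.
  rewrite truncn_lt_nat//; apply: (@le_lt_trans _ _ N%:R); last by rewrite ltr_nat.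
  by rewrite -[leRHS]mul1r ler_wpM2r.
have gE : grid N r = Num.truncn (r * N%:R) :> nat by rewrite /grid inordK.
split=> [<-|/(truncn_def)ta]; first by rewrite gE truncn_itv.
by apply: val_inj; rewrite /= gE ta.
Qed.

Lemma finlab_grid dd (T : measurableType dd) N (f : T -> R) :
  measurable_fun setT f -> (forall x, 0 <= f x <= 1) ->
  finlab (fun x => grid N (f x)).
Proof.
move=> mf f01 a; rewrite (_ : _ @^-1` _ =
    [set x | (a%:R <= f x * N%:R) && (f x * N%:R < a.+1%:R)]).
  have bf := bmfM (bmf01 mf f01) (bmf_cst _ (N%:R : R)).
  have b1 := bmf_cst T (a%:R : R); have b2 := bmf_cst T (a.+1%:R : R).
  have := finlab_map (fun uv => uv.1 && uv.2)
      (finlab_pair (finlab_le b1.1 bf.1) (finlab_lt bf.1 b2.1)).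
  by move=> /(_ true); congr measurable; apply/seteqP; split.
by apply/seteqP; split=> x /= /gridP; exact.
Qed.

Lemma grid_approx N (r : R) : (0 < N)%N -> 0 <= r <= 1 ->
  `|r - (grid N r)%:R / N%:R| <= N%:R^-1 /\
    0 <= ((grid N r)%:R / N%:R : R) <= 1.
Proof.
move=> N0 r01; have /andP[le lt] := (gridP (grid N r) r01).1 erefl.
have N0' : 0 < N%:R :> R by rewrite ltr0n.
have le1 : (grid N r)%:R / N%:R <= r by rewrite ler_pdivrMr.
split; last first.
  rewrite mulr_ge0 ?invr_ge0//= ler_pdivrMr// mul1r ler_nat -ltnS.
  exact: ltn_ord.
rewrite ger0_norm ?subr_ge0// lerBlDl -[X in _ + X]mul1r -mulrDl.
by rewrite ler_pdivlMr// ltW// (lt_le_trans lt)// -natr1.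
Qed.

End grid.

(** * From symmetric to arbitrary test functions *)

Section test_functions.
Context (R : realType) (K : nat).
Local Notation X := (cube R (rset_lt K)).
Local Notation Y := (cube R (rset K.-1)).
Local Notation mu := (cube_lebesgue R (rset_lt K)).

Definition face_prod (u : 'I_K -> Y -> R) (x : X) : R :=
  \prod_i u i (x \o face i).

Definition test01 (u : 'I_K -> Y -> R) : Prop :=
  (forall i, measurable_fun setT (u i)) /\ forall i y, 0 <= u i y <= 1.

Definition cut_bounded (D : X -> R) (c : R) : Prop :=
  forall u, test01 u -> `|\int[mu]_x (D x * face_prod u x)| <= c.

Lemma cut_normP (D : X -> R) (c : R) :
  (cut_norm D <= c%:E)%E <->
  (forall u, test01 u -> (forall i, symmetric_fun (u i)) ->
    `|\int[mu]_x (D x * face_prod u x)| <= c).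
Proof.
split=> [Dc u [mu_ u01] su|H].
  rewrite -lee_fin; apply: le_trans Dc; apply: ereal_sup_ubound.
  by exists u.
apply: ge_ereal_sup => _ [u u_ <-]; rewrite lee_fin; apply: H.
  by split=> [i|i y]; have [mu_ _ u01] := u_ i; [exact: mu_|exact: u01].
by move=> i; have [_ su _] := u_ i.
Qed.

Lemma bmf_face_prod u : (forall i, bmf (u i)) -> bmf (face_prod u).
Proof.
move=> bu; apply: bmf_prod => i _.
exact: (bmf_comp (@measurable_reindex R _ _ (face i)) (bu i)).
Qed.

Lemma prod01 (E : finType) (P : pred E) (a : E -> R) :
  (forall e, 0 <= a e <= 1) -> 0 <= \prod_(e | P e) a e <= 1.
Proof.
move=> a01; apply: (big_ind (fun z => 0 <= z <= 1)) => //.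
- by rewrite ler01 lexx.
- move=> a' b' /andP[? ?] /andP[? ?]; rewrite mulr_ge0//=.
  by rewrite mulr_ile1.
Qed.

Lemma face_prod01 u x : test01 u -> 0 <= face_prod u x <= 1.
Proof. by move=> [_ u01]; apply: prod01 => i; exact: u01. Qed.

Lemma test01_bmf u : test01 u -> forall i, bmf (u i).
Proof. by move=> [mu_ u01] i; apply: bmf01 => //; exact: u01. Qed.

End test_functions.

Section cut_norm.
Context (R : realType) (k : nat).
Local Notation K := k.+2.
Local Notation X := (cube R (rset_lt k.+2)).
Local Notation Y := (cube R (rset k.+1)).
Local Notation mu := (cube_lebesgue R (rset_lt k.+2)).

Lemma set1_neq0 n (j : 'I_n) : [set j]%SET != finset.set0.
Proof. by apply/set0Pn; exists j; rewrite finset.inE. Qed.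

(** A vertex is coloured through its singleton coordinate. *)
Definition vtx n (j : 'I_n) : rset n := Sub [set j]%SET (set1_neq0 j).

Lemma vtx_lt_subproof (j : 'I_K) :
  ([set j]%SET != finset.set0) && ([set j]%SET \proper [set: 'I_K]%SET).
Proof.
rewrite set1_neq0 finset.properT /=; apply/eqP => jT.
by have := cards1 j; rewrite jT cardsT card_ord.
Qed.

Definition vtx_lt (j : 'I_K) : rset_lt K :=
  Sub [set j]%SET (vtx_lt_subproof j).

Lemma vtx_lt_inj : injective vtx_lt.
Proof. by move=> i j /(congr1 val) /= /set1_inj. Qed.

Lemma face_vtx (i : 'I_K) (j : 'I_k.+1) : face i (vtx j) = vtx_lt (lift i j).
Proof. by apply: val_inj; rewrite /= imset_set1. Qed.

Lemma perm_vtx n (s : 'S_n) (j : 'I_n) : perm_rset s (vtx j) = vtx (s j).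
Proof. by apply: val_inj; rewrite /= imset_set1. Qed.

Section symmetrization.
Variables (C : finType) (col : unitI R -> C) (kap : 'I_K -> C).
Hypothesis mcol : finlab col.
Hypothesis kap_inj : injective kap.
Variable u : 'I_K -> Y -> R.
Hypothesis u01 : test01 u.

Let fits (i : 'I_K) (t : 'S_k.+1) (y : Y) : bool :=
  [forall j, col (y (vtx (t j))) == kap (lift i j)].

(** Restricting to a rainbow colouring of the vertices leaves at most one way of
    ordering a face, so a non-symmetric function becomes the restriction of a
    symmetric one. *)
Definition symmetrize (i : 'I_K) (y : Y) : R :=
  \sum_(t : 'S_k.+1) u i (y \o perm_rset t) * (fits i t y)%:R.

Let finlab_fits i t : finlab (fits i t).
Proof.
pose h (w : {ffun 'I_k.+1 -> C}) : bool := [forall j, w j == kap (lift i j)].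
have m1 j : finlab (fun y : Y => col (y (vtx (t j)))).
  exact: (finlab_comp (@measurable_coord R _ _) mcol).
have := finlab_map h (finlab_ffun m1); congr finlab; apply/funext => y.
by rewrite /h /fits; apply: eq_forallb => j; rewrite ffunE.
Qed.

Let fits_uniq i t t' y : fits i t y -> fits i t' y -> t = t'.
Proof.
move=> /forallP/= ft /forallP/= ft'; apply/permP => j.
have := ft' (t'^-1 (t j))%g; rewrite permKV => /eqP e1.
have /eqP e2 := ft j; move: e1; rewrite e2 => /kap_inj/lift_inj ej.
by rewrite {2}ej permKV.
Qed.

Lemma symmetrize_test01 : test01 symmetrize.
Proof.
split=> [i|i y].
  suff [] : bmf (symmetrize i) by [].
  apply: bmf_sum => t _; apply: bmfM.
    exact: (bmf_comp (@measurable_reindex R _ _ (perm_rset t))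
        (test01_bmf u01 i)).
  exact: (finlab_bmf (fun b : bool => b%:R) (finlab_fits i t)).
rewrite /symmetrize; have [/existsP[t ft]|/existsPn nf] :=
    boolP [exists t, fits i t y].
  rewrite (bigD1 t)//= ft mulr1 big1 ?addr0 => [|t' t't]; first exact: u01.2.
  case ft' : (fits i t' y); last by rewrite mulr0.
  by rewrite (fits_uniq ft ft') eqxx in t't.
rewrite big1 ?lexx ?ler01// => t _.
by rewrite (negbTE (nf t)) mulr0.
Qed.

Lemma symmetrize_sym i : symmetric_fun (symmetrize i).
Proof.
move=> s y; rewrite /symmetrize.
rewrite [RHS](reindex_inj (mulIg s)); apply: eq_bigr => t _ /=.
have -> : (y \o perm_rset s) \o perm_rset t = y \o perm_rset (t * s)%g.
  apply/funext => A /=; congr (y _); apply: val_inj => /=.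
  by rewrite -imset_comp; apply: eq_imset => j /=; rewrite permM.
congr (_ * (_ : bool)%:R); apply: eq_forallb => j.
by rewrite /= perm_vtx permM.
Qed.

(** If the colours seen on the face opposite to [i] are [kap] of the vertices other
    than [i], for every [i], then the vertex [j] cannot have colour [kap i] for
    [i] different from [j], so it has colour [kap j] and no face is reordered. *)
Lemma face_prod_symmetrize x :
  face_prod symmetrize x =
  face_prod u x * [forall j, col (x (vtx_lt j)) == kap j]%:R.
Proof.
have fitsE i t : fits i t (x \o face i) =
    [forall j, col (x (vtx_lt (lift i (t j)))) == kap (lift i j)].
  by apply: eq_forallb => j; congr (col (x _) == _); exact: face_vtx.
have [/forallP/= cx|] := boolP [forall j, col (x (vtx_lt j)) == kap j].
  rewrite mulr1; apply: eq_bigr => i _; rewrite /symmetrize.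
  have f1 : fits i 1%g (x \o face i).
    by rewrite fitsE; apply/forallP => j; rewrite perm1.
  rewrite (bigD1 (1%g : {perm 'I_k.+1}))//= f1 mulr1 big1 ?addr0 => [|t' t't].
    congr (u _ _); apply/funext => A /=; congr (x (face i _)); apply: val_inj => /=.
    by rewrite (eq_imset (g := id)) ?imset_id// => j; rewrite perm1.
  case ft' : (fits i t' (x \o face i)); last by rewrite mulr0.
  by rewrite (fits_uniq ft' f1) eqxx in t't.
move=> ncx; rewrite mulr0; apply/eqP; apply: contraNT ncx.
move=> /prodf_neq0 sn0; apply/forallP => j.
have other i : i != j -> exists2 a, a != i & col (x (vtx_lt j)) = kap a.
  move=> ij; have [t ft] : exists t, fits i t (x \o face i).
    apply/existsP; apply: contraNT (sn0 i isT) => /existsPn nf.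
    by rewrite /symmetrize big1// => t _; rewrite (negbTE (nf t)) mulr0.
  have [j' jE] := unlift_some ij.
  exists (lift i (t^-1 j')%g); first by rewrite eq_sym neq_lift.
  move: ft; rewrite fitsE => /forallP/(_ (t^-1 j')%g); rewrite permKV => /eqP <-.
  by rewrite -jE.
have [i0 i0j] : exists i0, i0 != j.
  by exists (lift j ord0); rewrite eq_sym neq_lift.
have [a _ ca] := other _ i0j.
have [aj|aj] := eqVneq a j; first by rewrite ca aj.
have [b ba cb] := other _ aj.
by move: cb; rewrite ca => /kap_inj ab; rewrite ab eqxx in ba.
Qed.

End symmetrization.

Section rainbow.
Variable N : nat.
Hypothesis N_gt0 : (0 < N)%N.

Let col (t : unitI R) : 'I_N.+1 := grid N (sval t).

Let mcol : finlab col.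
Proof.
apply: finlab_grid => [|t]; last exact: (svalP t).
by move=> _ B mB; exists B.
Qed.

Let cell_length a : 0 <= \int[@unitI_lebesgue R]_t (col t == a)%:R <= N%:R^-1.
Proof.
have N0 : 0 < N%:R :> R by rewrite ltr0n.
have colE (t : unitI R) : (col t == a) <-> a%:R <= sval t * N%:R < a.+1%:R.
  by rewrite -(gridP a (svalP t)); split=> /eqP.
rewrite Ex_ge0 /=; last by move=> t; rewrite ler0n.
rewrite (eq_Ex _ (g := \1_(col @^-1` [set a]))); last first.
  move=> t; rewrite indicE; congr (_ : bool)%:R; apply/idP/idP.
    by move=> /eqP ta; rewrite inE.
  by rewrite inE => /= ->.
rewrite Ex_indic//.
have [aN|] := ltnP a N; last first.
  rewrite leq_eqVlt ltnNge -ltnS ltn_ord orbF => /eqP aN.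
  suff a0 : unitI_lebesgue (col @^-1` [set a]) = 0%:E.
    by rewrite [X in fine X]a0 invr_ge0.
  apply: (unitI_interval (a := 0)); rewrite ?addr0// => t t1.
  split=> [/= /eqP/colE/andP[]|].
    rewrite -aN -[X in X <= _]mul1r ler_pM2r// => t1'.
    by rewrite ltNge t1' in t1.
  by move=> /andP[t0] /(le_lt_trans t0); rewrite ltxx.
suff aV : unitI_lebesgue (col @^-1` [set a]) = (N%:R^-1)%:E.
  by rewrite [X in fine X]aV.
apply: (unitI_interval (a := a%:R / N%:R)) => //.
  by rewrite -[X in _ + X]mul1r -mulrDl natr1 ler_pdivrMr// mul1r ler_nat.
move=> t _; rewrite -[X in _ + X]mul1r -mulrDl natr1 ler_pdivrMr// ltr_pdivlMr//.
by rewrite -colE; split=> /eqP.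
Qed.

Let sum_cell_length : \sum_a \int[@unitI_lebesgue R]_t (col t == a)%:R = 1.
Proof.
rewrite -Ex_sum => [|a _]; last exact: bmf_cell.
rewrite -[RHS](Ex_cst (@unitI_lebesgue R)); apply: eq_Ex => t.
by rewrite (bigD1 (col t))//= eqxx big1 ?addr0// => a /negbTE; rewrite eq_sym => ->.
Qed.

Let bcol (a : 'I_N.+1) (B : rset_lt K) :
  bmf (fun x : X => (col (x B) == a)%:R : R).
Proof.
exact: (bmf_comp (@measurable_coord R _ B) (bmf_cell R a mcol)).
Qed.

(* Given the colour of [i], the vertex [j] has the same colour with probability
   at most [1/N]. *)
Let collision (i j : 'I_K) : i != j ->
  \int[mu]_x (col (x (vtx_lt i)) == col (x (vtx_lt j)))%:R <= N%:R^-1 :> R.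
Proof.
move=> ij.
pose len a := \int[@unitI_lebesgue R]_t (col t == a)%:R : R.
have pair a : \int[mu]_x ((col (x (vtx_lt i)) == a)%:R *
    (col (x (vtx_lt j)) == a)%:R) = len a * len a :> R.
  rewrite (Ex_overwrite (phi := fun _ : unit => vtx_lt i) _ _).2; last 2 first.
  - by move=> [] [].
  - exact: (bmfM (bcol a _) (bcol a _)).
  transitivity (\int[mu]_x ((col (x (vtx_lt j)) == a)%:R * len a)); last first.
    transitivity (\int[mu]_x (len a * (col (x (vtx_lt j)) == a)%:R)).
      by apply: eq_Ex => x; rewrite mulrC.
    rewrite (ExZ mu _ (bcol a _)); congr (_ * _).
    exact: (Ex_coord _ (bmf_cell R a mcol)).
  apply: eq_Ex => z.
  transitivity (\int[cube_lebesgue R unit]_y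
      ((col (z (vtx_lt j)) == a)%:R * (col (y tt) == a)%:R)).
    apply: eq_Ex => y; rewrite (@overwrite_codom R unit _ _ y z tt) => [|[] []//].
    rewrite overwrite_notin 1?mulrC//; apply/codomP => -[_ /vtx_lt_inj ji].
    by rewrite ji eqxx in ij.
  have b1 : bmf (fun y : cube R unit => (col (y tt) == a)%:R : R).
    exact: (bmf_comp (@measurable_coord R _ tt) (bmf_cell R a mcol)).
  rewrite (ExZ _ _ b1); congr (_ * _).
  exact: (Ex_coord tt (bmf_cell R a mcol)).
rewrite (eq_Ex mu (g := fun x : X => \sum_a ((col (x (vtx_lt i)) == a)%:R *
    (col (x (vtx_lt j)) == a)%:R))); last first.
  move=> x; rewrite (bigD1 (col (x (vtx_lt i))))//= eqxx mul1r eq_sym.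
  by rewrite big1 ?addr0// => a /negbTE; rewrite eq_sym => ->; rewrite mul0r.
rewrite Ex_sum => [|a _]; last exact: (bmfM (bcol a _) (bcol a _)).
rewrite -[leRHS]mul1r -[X in _ <= X * _]sum_cell_length mulr_suml; apply: ler_sum => a _.
rewrite [leLHS](pair a); have /andP[l0 lN] := cell_length a.
exact: (ler_wpM2l l0 lN).
Qed.

(** The cut norm only tests symmetric functions, but it controls all of them:
    cut the cube according to the colours of its vertices for a fine colouring of
    the interval, and symmetrize separately for each rainbow colouring. *)
Lemma cut_norm_bounded (D : X -> R) (c : R) : bmf D -> (forall x, `|D x| <= 1) ->
  (cut_norm D <= c%:E)%E ->
  cut_bounded D ((N.+1 ^ K)%:R * c + (K ^ 2)%:R / N%:R).
Proof.
move=> bD D1 /cut_normP Dc u u01.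
have c0 : 0 <= c.
  have t0 : @test01 R K (fun _ _ => 0) by split=> [i|i y]; rewrite ?lexx ?ler01.
  by apply: le_trans (normr_ge0 _) (Dc _ t0 _).
have bu := bmf_face_prod (test01_bmf u01).
pose F x := D x * face_prod u x.
have bF : bmf F := bmfM bD bu.
pose C (x : X) : {ffun 'I_K -> 'I_N.+1} := [ffun j => col (x (vtx_lt j))].
have mC : finlab C.
  by apply: finlab_ffun => j; exact: (finlab_comp (@measurable_coord R _ _) mcol).
pose h1 (f : {ffun 'I_K -> 'I_N.+1}) : R := (injectiveb f)%:R.
pose h2 (f : {ffun 'I_K -> 'I_N.+1}) : R := (~~ injectiveb f)%:R.
have b1 : bmf (fun x => h1 (C x)) by exact: finlab_bmf.
have b2 : bmf (fun x => h2 (C x)) by exact: finlab_bmf.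
rewrite (eq_Ex mu (g := fun x : X => F x * h1 (C x) + F x * h2 (C x))); last first.
  move=> x; rewrite -mulrDr -/(F x) /h1 /h2.
  by case: injectiveb; rewrite ?addr0 ?add0r mulr1.
rewrite (ExD mu (bmfM bF b1) (bmfM bF b2)).
apply: (le_trans (ler_normD _ _)); apply: lerD.
  rewrite (Ex_lab mu h1 bF mC); apply: (le_trans (ler_norm_sum _ _ _)).
  apply: (@le_trans _ _ (\sum_(f : {ffun 'I_K -> 'I_N.+1}) c)); last first.
    by rewrite sumr_const card_ffun !card_ord mulr_natl.
  apply: ler_sum => f _; rewrite /h1.
  case: injectiveP => [f_inj|_]; last by rewrite mul0r normr0.
  rewrite mul1r (eq_Ex mu (g := fun x : X => D x * face_prod (symmetrize col f u) x)).
    apply: Dc; first exact: symmetrize_test01.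
    by move=> i; exact: symmetrize_sym.
  move=> x; rewrite (@face_prod_symmetrize _ col f f_inj) mulrA; congr (_ * (_ : bool)%:R).
  apply/eqP/forallP => [<- j|cx]; first by rewrite ffunE.
  by apply/ffunP => j; rewrite ffunE; exact/eqP.
apply: (le_trans (Ex_norm mu (bmfM bF b2))).
have bcc (ij : 'I_K * 'I_K) :
    bmf (fun x : X => (col (x (vtx_lt ij.1)) == col (x (vtx_lt ij.2)))%:R : R).
  have := finlab_bmf (fun f : {ffun 'I_K -> 'I_N.+1} =>
    (f ij.1 == f ij.2)%:R : R) mC.
  by apply: eq_bmf => x; rewrite !ffunE.
apply: (@le_trans _ _ (\int[mu]_x \sum_(ij : 'I_K * 'I_K | ij.1 != ij.2)
    (col (x (vtx_lt ij.1)) == col (x (vtx_lt ij.2)))%:R)).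
  apply: Ex_le; [exact: (bmf_norm (bmfM bF b2))|exact: bmf_sum|move=> x].
  rewrite /h2; case: injectiveP => [_|ninj]; first by rewrite mulr0 normr0 sumr_ge0.
  rewrite mulr1 (@le_trans _ _ 1)//.
    rewrite /F normrM -[leRHS]mulr1 ler_pM//.
    by have /andP[? ?] := face_prod01 x u01; rewrite ger0_norm.
  have [i [j [ij cij]]] : exists i j, i != j /\ C x i = C x j.
    apply: contra_notP ninj => no i j cij; apply/eqP/negPn/negP => ij.
    by apply: no; exists i, j.
  rewrite (bigD1 (i, j))//=; move: cij; rewrite !ffunE => ->.
  by rewrite eqxx lerDl sumr_ge0.
rewrite Ex_sum => [|ij _]; last exact: bcc.
apply: (@le_trans _ _ (\sum_(ij : 'I_K * 'I_K) N%:R^-1)).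
  rewrite [leRHS](bigID (fun ij : 'I_K * 'I_K => ij.1 != ij.2))/=.
  rewrite -[leLHS]addr0; apply: lerD.
    by apply: ler_sum => ij; exact: collision.
  by apply: sumr_ge0 => ij _; rewrite invr_ge0.
by rewrite sumr_const card_prod !card_ord mulnn -[leLHS]mulr_natl.
Qed.

End rainbow.
End cut_norm.

(** * Faces of a larger vertex set *)

Section increasing.
Variables (K m : nat).

Definition inc : finType :=
  {f : {ffun 'I_K -> 'I_m} | [forall i : 'I_K, forall j : 'I_K,
    (i < j)%N ==> (f i < f j)%N]}.

Lemma increasing_lt (e : inc) (i j : 'I_K) : (i < j)%N -> (val e i < val e j)%N.
Proof. by have /forallP/(_ i)/forallP/(_ j)/implyP := valP e. Qed.

Lemma increasing_inj (e : inc) : injective (fun i => val e i).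
Proof.
move=> i j eij; apply/val_inj/eqP; rewrite eqn_leq.
by apply/andP; split; rewrite leqNgt; apply/negP => /(increasing_lt e);
  rewrite eij ltnn.
Qed.

(** Both maps list the same set in increasing order. *)
Lemma inc_codom_inj (e e' : inc) :
  (forall i, val e i \in codom (val e')) -> e = e'.
Proof.
move=> sub.
have sorted_inc (f : inc) : sorted ltn [seq val (val f i) | i <- enum 'I_K].
  rewrite sorted_map; have : sorted ltn [seq val i | i <- enum 'I_K].
    by rewrite val_enum_ord iota_ltn_sorted.
  by rewrite sorted_map; apply: sub_sorted => i j /=; exact: increasing_lt.
have mem_eq : codom (val e) =i codom (val e').
  have card_eq : #|codom (val e)| = #|codom (val e')|.
    by rewrite !card_codom//; exact: increasing_inj.
  by apply/(subset_cardP card_eq)/fintype.subsetP => _ /codomP[i ->]; exact: sub.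
have seq_eq : [seq val (val e i) | i <- enum 'I_K] =
    [seq val (val e' i) | i <- enum 'I_K].
  apply: (irr_sorted_eq ltn_trans ltnn) => // x.
  apply/mapP/mapP => -[i _ ->].
    have := mem_eq (val e i); rewrite codom_f => /esym/codomP[j ->].
    by exists j; rewrite ?mem_enum.
  have := mem_eq (val e' i); rewrite codom_f => /codomP[j ->].
  by exists j; rewrite ?mem_enum.
apply/val_inj/ffunP => i; apply: val_inj.
have /eq_in_map/(_ i) := seq_eq; rewrite mem_enum; exact.
Qed.

Lemma inc_avoid (e e' : inc) : e != e' ->
  exists i, val e i \notin codom (val e').
Proof.
move=> ee'; apply/existsP; apply: contraNT ee' => /existsPn all_in.
by apply/eqP/inc_codom_inj => i; rewrite -[_ \in _]negbK; exact: all_in.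
Qed.

End increasing.

Lemma face_inc_subproof K m (e : inc K.+1 m) (i : 'I_K.+1) :
  [forall a : 'I_K, forall b : 'I_K, (a < b)%N ==>
    ([ffun j : 'I_K => val e (lift i j)] a < [ffun j => val e (lift i j)] b)%N].
Proof.
apply/forallP => a; apply/forallP => b; apply/implyP => ab; rewrite !ffunE.
apply: increasing_lt; rewrite /= /bump.
have [ia|ai] := leqP i a; have [ib|bi] := leqP i b; rewrite ?add0n ?add1n ?ltnS //.
- by move: bi; rewrite ltnNge (leq_trans ia (ltnW ab)).
- exact: ltnW.
Qed.

Definition face_inc K m (e : inc K.+1 m) (i : 'I_K.+1) : inc K m :=
  Sub [ffun j => val e (lift i j)] (face_inc_subproof e i).

Lemma lift_inc_subproof K (i : 'I_K.+1) :
  [forall a : 'I_K, forall b : 'I_K, (a < b)%N ==>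
    ([ffun j : 'I_K => lift i j] a < [ffun j => lift i j] b)%N].
Proof.
apply/forallP => a; apply/forallP => b; apply/implyP => ab; rewrite !ffunE.
rewrite /= /bump.
have [ia|ai] := leqP i a; have [ib|bi] := leqP i b; rewrite ?add0n ?add1n ?ltnS //.
- by move: bi; rewrite ltnNge (leq_trans ia (ltnW ab)).
- exact: ltnW.
Qed.

Definition lift_inc K (i : 'I_K.+1) : inc K K.+1 :=
  Sub [ffun j => lift i j] (lift_inc_subproof i).

(** A set of [K] vertices out of [K.+1] misses exactly one. *)
Lemma lift_inc_bij K : bijective (@lift_inc K).
Proof.
have surj (d : inc K K.+1) : {i | lift_inc i = d}.
  have [i iP] : {i | i \notin codom (val d)}.
    apply/sigW; apply/existsP; rewrite -[[exists _, _]]negbK; apply/negP.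
    move=> /existsPn all_in.
    have : (#|'I_K.+1| <= #|codom (val d)|)%N.
      by apply/subset_leq_card/fintype.subsetP => i _; rewrite -[_ \in _]negbK all_in.
    by rewrite card_codom ?card_ord ?ltnn//; exact: increasing_inj.
  exists i; symmetry; apply: inc_codom_inj => j.
  have [|a -> _] := @unlift_some _ i (val d j).
    by apply: contraNneq iP => ->; exact: codom_f.
  by apply/codomP; exists a; rewrite ffunE.
exists (fun d => sval (surj d)) => [i|d]; last exact: (svalP (surj d)).
case: surj => j /= jE.
apply/eqP/negPn/negP => ji.
have [a aE _] := unlift_some ji.
have := congr1 (fun f : inc _ _ => i \in codom (val f)) jE => /=.
have -> : i \in codom [ffun j0 => lift j j0].
  by apply/codomP; exists a; rewrite ffunE.
move/esym/codomP => [b]; rewrite ffunE => /eqP.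
by rewrite (negbTE (neq_lift _ _)).
Qed.

Section image_index.
Variables (a b : nat).

Lemma imr_subproof (phi : 'I_a -> 'I_b) (A : rset a) :
  (phi @: val A)%SET != finset.set0.
Proof. by rewrite imset_eq0 (valP A). Qed.

Definition imr (phi : 'I_a -> 'I_b) (A : rset a) : rset b :=
  Sub (phi @: val A)%SET (imr_subproof phi A).

Lemma imr_inj phi : injective phi -> injective (imr phi).
Proof.
move=> phi_inj A B /(congr1 val) /= /imset_inj AB.
by apply: val_inj; apply: AB.
Qed.

End image_index.

Lemma imr_face K m (e : inc K.+1 m) (i : 'I_K.+1) (A : rset K) :
  imr (val e) (rset_of_lt (face i A)) = imr (val (face_inc e i)) A.
Proof.
apply: val_inj => /=; rewrite -imset_comp; apply: eq_imset => j /=.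
by rewrite ffunE.
Qed.

Lemma imr_lift_inc K (i : 'I_K.+1) (A : rset K) :
  imr (val (lift_inc i)) A = rset_of_lt (face i A).
Proof. by apply: val_inj => /=; apply: eq_imset => j /=; rewrite ffunE. Qed.

Lemma face_inj K (i : 'I_K.+1) : injective (@face K.+1 i).
Proof.
move=> A B /(congr1 val) /= /imset_inj AB; apply: val_inj; apply: AB.
exact: lift_inj.
Qed.

Lemma faceP K (i : 'I_K.+1) (B : rset K.+1) : i \notin val B ->
  exists A : rset K, rset_of_lt (face i A) = B.
Proof.
move=> iB; pose A0 : {set 'I_K} := [set j | lift i j \in val B]%SET.
have liftA : (lift i @: A0)%SET = val B.
  apply/setP => j; apply/imsetP/idP => [[j' + ->]|jB]; first by rewrite finset.inE.
  have [|j' jE _] := @unlift_some _ i j; first by apply: contraNneq iB => ->.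
  by exists j'; rewrite // finset.inE -jE.
have A00 : A0 != finset.set0.
  by apply: contraTneq (valP B) => A00 /=; rewrite -liftA A00 imset0 eqxx.
by exists (Sub A0 A00); apply: val_inj.
Qed.

(** * Replacing one factor at a time *)

Section telescoping.
Context (R : realType) (k m : nat).
Local Notation K := k.+1.
Local Notation mu := (cube_lebesgue R (rset m)).

Definition integrate_top (D : cube R (rset K) -> R) (y : cube R (rset_lt K)) : R :=
  \int[@unitI_lebesgue R]_t D (add_top y t).

(** Once the coordinates that do not lie on the face [phi] are frozen, the
    factors [u i] become test functions for the cut norm. *)
Lemma freeze_outside (phi : 'I_K -> 'I_m) (D : cube R (rset K) -> R)
    (u : 'I_K -> cube R (rset m) -> R) (c : R) :
  injective phi -> bmf D ->
  (forall i, measurable_fun setT (u i)) -> (forall i x, 0 <= u i x <= 1) ->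
  (forall i (x x' : cube R (rset m)),
    (forall A : rset m, phi i \notin val A -> x A = x' A) ->
    u i x = u i x') ->
  cut_bounded (integrate_top D) c ->
  `|\int[mu]_x (D (x \o imr phi) * \prod_i u i x)| <= c.
Proof.
move=> phi_inj bD mu_ u01 uloc Dc.
have bu i : bmf (u i) by apply: bmf01.
have bU : bmf (fun x => \prod_i u i x) by apply: bmf_prod => i _.
have bF := bmfM (bmf_comp (@measurable_reindex R _ _ (imr phi)) bD) bU.
have gl_inj := imr_inj phi_inj.
have [bG ->] := Ex_overwrite gl_inj bF.
apply: Ex_norm_le => // z.
have bI : bmf (fun y => D y * \prod_i u i (overwrite (imr phi) y z)).
  by apply: (bmfM bD); exact: (bmf_comp (measurable_overwrite_l (imr phi) z) bU).
rewrite (eq_Ex _ (g := fun y => D y * \prod_i u i (overwrite (imr phi) y z))); last first.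
  move=> y; congr (D _ * _); apply/funext => A /=.
  by rewrite overwrite_codom.
rewrite (Ex_top bI).2.
pose rf (i : 'I_K) (A : rset k) : rset K := rset_of_lt (face i A).
have rf_inj i : injective (rf i).
  by move=> A B /rset_of_lt_inj/face_inj.
pose y0 : cube R (rset K) := point.
pose v (i : 'I_K) (w : cube R (rset k)) : R :=
  u i (overwrite (imr phi) (overwrite (rf i) w y0) z).
have v01 : test01 v.
  split=> [i|i w]; last exact: u01.
  exact: (measurableT_comp (mu_ i)
    (measurableT_comp (measurable_overwrite_l (imr phi) z)
      (measurable_overwrite_l (rf i) y0))).
rewrite (eq_Ex _ (g := fun y => integrate_top D y * face_prod v y)); first exact: Dc.
move=> y; rewrite mulrC /integrate_top.
have bDt : bmf (fun t => D (add_top y t)).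
  exact: (bmf_comp (measurable_add_top2 y) bD).
rewrite -(ExZ _ _ bDt); apply: eq_Ex => t; rewrite mulrC; congr (_ * _).
apply: eq_bigr => i _; apply: uloc => A iA.
have [/codomP[B AB]|nA] := boolP (A \in codom (imr phi)); last first.
  by rewrite !overwrite_notin.
rewrite AB !overwrite_codom//.
have iB : i \notin val B.
  by apply: contra iA => iB; rewrite AB /=; apply/imsetP; exists i.
have [B' B'E] := faceP iB.
by rewrite -B'E -/(rf i B') overwrite_codom// /rf add_top_lt.
Qed.

Variables (E : finType) (phi : E -> 'I_K -> 'I_m).
Hypothesis phi_inj : forall e, injective (phi e).
Hypothesis phi_avoid : forall e e', e != e' ->
  exists i, phi e i \notin codom (phi e').

(** Another face misses some vertex of [e]; grouping the other factors by such a
    vertex puts them in the form required by [freeze_outside]. *)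
Lemma replace_one (e : E) (D : cube R (rset K) -> R)
    (h : E -> cube R (rset K) -> R) (c : R) :
  bmf D -> (forall e, measurable_fun setT (h e)) ->
  (forall e y, 0 <= h e y <= 1) -> cut_bounded (integrate_top D) c ->
  `|\int[mu]_x (D (x \o imr (phi e)) *
     \prod_(e' | e' != e) h e' (x \o imr (phi e')))| <= c.
Proof.
move=> bD mh h01 Dc.
have /choice[io ioP] : forall e', exists i, e' != e -> phi e i \notin codom (phi e').
  move=> e'; have [->|e'e] := eqVneq e' e; first by exists ord0.
  have ee' : e != e' by rewrite eq_sym.
  by have [i ip] := phi_avoid ee'; exists i.
pose u (i : 'I_K) (x : cube R (rset m)) :=
  \prod_(e' | (e' != e) && (io e' == i)) h e' (x \o imr (phi e')).
rewrite (eq_Ex mu (g := fun x : cube R (rset m) =>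
  D (x \o imr (phi e)) * \prod_i u i x)); last first.
  by move=> x; rewrite (partition_big io predT).
have u01 i x : 0 <= u i x <= 1 by apply: prod01 => e'; exact: h01.
apply: freeze_outside => // [i|i x x' xx'].
  have [] // : bmf (u i).
  apply: bmf_prod => e' _; apply: (bmf_comp (@measurable_reindex R _ _ _)).
  by apply: bmf01 => //; exact: h01.
apply: eq_bigr => e' /andP[e'e /eqP ioe']; congr (h _ _).
apply/funext => A; apply: xx' => /=; rewrite -ioe'.
apply: contra (ioP _ e'e) => /imsetP[j _ ->]; exact: codom_f.
Qed.

(** Hybrid argument: pass from [a] to [b] through the products in which the faces
    already visited carry [b] and the others carry [a]. *)
Lemma replace_all (a b : E -> cube R (rset K) -> R) (c : E -> R) :
  (forall e, measurable_fun setT (a e)) -> (forall e y, 0 <= a e y <= 1) ->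
  (forall e, measurable_fun setT (b e)) -> (forall e y, 0 <= b e y <= 1) ->
  (forall e, cut_bounded (integrate_top (fun y => a e y - b e y)) (c e)) ->
  `|\int[mu]_x \prod_e a e (x \o imr (phi e)) -
    \int[mu]_x \prod_e b e (x \o imr (phi e))| <= \sum_e c e.
Proof.
move=> ma a01 mb b01 abc.
pose h (s : seq E) e := if e \in s then b e else a e.
have mh s e : measurable_fun setT (h s e) by rewrite /h; case: ifP.
have h01 s e y : 0 <= h s e y <= 1 by rewrite /h; case: ifP.
have bh s e : bmf (fun x : cube R (rset m) => h s e (x \o imr (phi e))).
  apply: (bmf_comp (@measurable_reindex R _ _ _)).
  by apply: bmf01 => //; exact: h01.
have bhp s (P : pred E) : bmf (fun x : cube R (rset m) =>
    \prod_(e | P e) h s e (x \o imr (phi e))) by apply: bmf_prod.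
have main s : uniq s -> `|\int[mu]_x \prod_e a e (x \o imr (phi e)) -
    \int[mu]_x \prod_e h s e (x \o imr (phi e))| <= \sum_(e <- s) c e.
  elim: s => [_|e s IHs /= /andP[es us]].
    rewrite big_nil (eq_Ex mu (g := fun x : cube R (rset m) =>
      \prod_e a e (x \o imr (phi e)))); first by rewrite subrr normr0.
    by move=> x; apply: eq_bigr => e _.
  rewrite big_cons [leRHS]addrC; set I1 := Rintegral _ _ _; set I2 := Rintegral _ _ _.
  set I3 := \int[mu]_x \prod_e h s e (x \o imr (phi e)).
  rewrite (_ : I1 - I2 = (I1 - I3) + (I3 - I2)); last by rewrite addrA subrK.
  apply: (le_trans (ler_normD _ _)); apply: lerD; first exact: IHs.
  rewrite /I3 /I2 -(ExB _ (bhp _ _) (bhp _ _)).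
  pose D y := a e y - b e y.
  have bD : bmf D by apply: bmfB; apply: bmf01.
  rewrite (eq_Ex mu (g := fun x : cube R (rset m) => D (x \o imr (phi e)) *
      \prod_(e' | e' != e) h s e' (x \o imr (phi e')))).
    by apply: replace_one => //; exact: abc.
  move=> x; rewrite (bigD1 e)//= [X in _ - X](bigD1 e)//= /D mulrBl.
  congr (_ * _ - _ * _).
  - by rewrite /h (negbTE es).
  - by rewrite /h mem_head.
  apply: eq_bigr => e' e'e; by rewrite /h inE (negbTE e'e).
have := main (enum E) (enum_uniq E).
rewrite big_enum/= (eq_Ex mu (f := fun x : cube R (rset m) =>
  \prod_e h (enum E) e (x \o imr (phi e)))
  (g := fun x : cube R (rset m) => \prod_e b e (x \o imr (phi e))))//.
by move=> x; apply: eq_bigr => e _; rewrite /h mem_enum.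
Qed.

End telescoping.

(** * Cells of a labelled partition *)

Section profile.
Context (R : realType) (K : nat) (J : finType).
Local Notation mu := (cube_lebesgue R (rset_lt K)).
Variable c : cube R (rset K.-1) -> J.
Variable Q : J -> set (cube R (rset K.-1)).
Hypothesis Qc : forall j, Q j = c @^-1` [set j].

(** Its value at [x] names the only cell that contains [x]. *)
Definition profile (x : cube R (rset_lt K)) : {ffun 'I_K -> J} :=
  [ffun i => c (x \o face i)].

Lemma label_indic j y : \1_(Q j) y = (c y == j)%:R :> R.
Proof.
rewrite Qc indicE; congr (_ : bool)%:R.
by apply/idP/eqP => [|cj]; rewrite inE.
Qed.

Lemma cell_indicE f x : cell_indic Q f x = (profile x == f)%:R :> R.
Proof.
rewrite /cell_indic; have [/eqP pf|] := boolP (profile x == f).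
  by apply: big1 => i _; rewrite label_indic -pf ffunE eqxx.
move=> pf; have [i fi] : exists i, profile x i != f i.
  by apply/existsP; apply: contraNT pf => /existsPn pf; apply/eqP/ffunP => i;
    apply/eqP; rewrite -[_ == _]negbK; exact: pf.
by rewrite (bigD1 i)//= label_indic; move: fi; rewrite ffunE => /negbTE ->;
  rewrite mul0r.
Qed.

Lemma cell_volE f : cell_vol Q f = lab_vol mu profile f.
Proof. by apply: eq_Ex => x; rewrite cell_indicE. Qed.

Lemma cell_weightE W f : cell_weight W Q f = lab_weight mu W profile f.
Proof.
rewrite /cell_weight /lab_weight cell_volE; case: ifP => // _; congr (_ * _).
by apply: eq_Ex => x; rewrite cell_indicE.
Qed.

Lemma steppingE W x : stepping W Q x = cond_exp mu W profile x.
Proof.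
rewrite /stepping (bigD1 (profile x))//= cell_indicE eqxx mulr1 big1.
  by rewrite addr0 cell_weightE.
by move=> f /negbTE fp; rewrite cell_indicE eq_sym fp mulr0.
Qed.

Lemma finlab_profile : finlab c -> finlab profile.
Proof.
by move=> mc; apply: finlab_ffun => i; exact: (finlab_comp (measurable_reindex _)).
Qed.

End profile.

(** * Densities of configurations *)

Section density.
Context (R : realType).

Definition density K m (S : inc K m -> set (cube R (rset K))) : R :=
  \int[cube_lebesgue R (rset m)]_x \prod_e \1_(S e) (x \o imr (val e)).

(** The cells of a partition of the facets of a simplex are the configurations on
    that simplex, so the counting lemma also governs their volumes. *)
Lemma cell_vol_density k : exists miss : inc k.+1 k.+2 -> 'I_k.+2,
  forall (J : finType) (Q : J -> set (cube R (rset k.+1)))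
    (f : {ffun 'I_k.+2 -> J}), (forall j, measurable (Q j)) ->
  cell_vol (k := k.+2) Q f = density (fun d => Q (f (miss d))).
Proof.
have [miss missK lift_missK] := lift_inc_bij k.+1.
exists miss => J Q f mQ; rewrite /density.
have bQ j : bmf (\1_(Q j) : _ -> R) by exact: bmf_indic.
have bc : bmf (cell_indic (k := k.+2) Q f).
  by apply: bmf_prod => i _; exact: (bmf_comp (measurable_reindex _)).
rewrite /cell_vol -(Ex_reindex (@rset_of_lt_inj k.+2) bc).
apply: eq_Ex => x; rewrite /cell_indic.
rewrite (reindex (@lift_inc k.+1)); last by apply: onW_bij; exists miss.
apply: eq_bigr => i _; rewrite missK; congr (\1_ _ _); apply/funext => A /=.
by rewrite imr_lift_inc.
Qed.

Lemma density01 K m (S : inc K m -> set (cube R (rset K))) :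
  (forall e, measurable (S e)) -> 0 <= density S <= 1.
Proof.
move=> mS; apply: Ex_01 => [|x]; last first.
  by apply: prod01 => e; exact: indic01.
apply: bmf_prod => e _; apply: (bmf_comp (measurable_reindex _)).
exact: bmf_indic.
Qed.

Lemma prod_bool (E : finType) (b : E -> bool) :
  \prod_e (b e)%:R = [forall e, b e]%:R :> R.
Proof.
have [/forallP ball|/forallPn[e nbe]] := boolP [forall e, b e].
  by apply: big1 => e _; rewrite ball.
by rewrite (bigD1 e)//= (negbTE nbe) mul0r.
Qed.

Definition restrict_face K m (e : inc K m) (x : cube R (rset m)) :
  cube R (rset_lt K) := fun A => x (imr (val e) (rset_of_lt A)).

Section expansion.
Variables (k m : nat) (J : finType).
Variables (c : cube R (rset k.+1) -> J) (Q : J -> set (cube R (rset k.+1))).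
Hypothesis mc : finlab c.
Hypothesis Qc : forall j, Q j = c @^-1` [set j].
Local Notation mu := (cube_lebesgue R (rset m)).

Definition face_labels (gam : {ffun inc k.+1 m -> J}) (e : inc k.+2 m) :
  {ffun 'I_k.+2 -> J} := [ffun i => gam (face_inc e i)].

Let labels (x : cube R (rset m)) : {ffun inc k.+1 m -> J} :=
  [ffun d : inc k.+1 m => c (x \o imr (val d))].

Let finlab_labels : finlab labels.
Proof.
by apply: finlab_ffun => d; exact: (finlab_comp (measurable_reindex _)).
Qed.

Let profile_labels e x : profile (K := k.+2) c (restrict_face e x) = face_labels (labels x) e.
Proof.
apply/ffunP => i; rewrite !ffunE; congr c; apply/funext => A /=.
by rewrite /restrict_face /= imr_face.
Qed.

Lemma density_labels (gam : {ffun inc k.+1 m -> J}) :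
  density (fun d => Q (gam d)) = \int[mu]_x (labels x == gam)%:R.
Proof.
apply: eq_Ex => x; rewrite (eq_bigr (fun d => (labels x d == gam d)%:R)).
  rewrite prod_bool; congr (_ : bool)%:R.
  by apply/forallP/eqP => [H|->//]; apply/ffunP => d; apply/eqP.
by move=> d _; rewrite (label_indic (K := k.+2) Qc) ffunE.
Qed.

(** A product of step functions is constant on each configuration of the lower
    faces. *)
Lemma stepping_expansion (W : inc k.+2 m -> cube R (rset_lt k.+2) -> R) :
  \int[mu]_x \prod_e stepping (k := k.+2) (W e) Q (restrict_face e x) =
  \sum_(gam : {ffun inc k.+1 m -> J})
    (\prod_e cell_weight (k := k.+2) (W e) Q (face_labels gam e)) *
    density (fun d => Q (gam d)).
Proof.
pose H (gam : {ffun inc k.+1 m -> J}) :=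
  \prod_e cell_weight (k := k.+2) (W e) Q (face_labels gam e).
transitivity (\int[mu]_x (1 * H (labels x))).
  apply: eq_Ex => x; rewrite mul1r; apply: eq_bigr => e _.
  by rewrite (steppingE (K := k.+2) Qc) /cond_exp profile_labels (cell_weightE (K := k.+2) Qc).
rewrite (Ex_lab mu H (bmf_cst _ 1) finlab_labels); apply: eq_bigr => gam _.
by congr (_ * _); rewrite density_labels; apply: eq_Ex => x; rewrite mul1r.
Qed.

(** The configuration restricted to the vertices of [e] lies in the cell that [gam]
    induces there. *)
Lemma density_le_cell_vol (gam : {ffun inc k.+1 m -> J}) (e : inc k.+2 m) :
  density (fun d => Q (gam d)) <= cell_vol (k := k.+2) Q (face_labels gam e).
Proof.
have rinj : injective (fun A : rset_lt k.+2 => imr (val e) (rset_of_lt A)).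
  by move=> A B /(imr_inj (@increasing_inj _ _ e))/rset_of_lt_inj.
have mp := finlab_profile (K := k.+2) mc.
have bp := bmf_cell R (face_labels gam e) mp.
rewrite density_labels (cell_volE (K := k.+2) Qc) /lab_vol -(Ex_reindex rinj bp).
have bl := bmf_cell R gam finlab_labels.
have bl' := bmf_comp (@measurable_reindex R _ _
  (fun A : rset_lt k.+2 => imr (val e) (rset_of_lt A))) bp.
apply: (Ex_le mu bl bl') => x /=.
case: eqP => [lx|]; last by rewrite ler0n.
suff -> : profile (K := k.+2) c
    (x \o (fun A : rset_lt k.+2 => imr (val e) (rset_of_lt A))) =
    face_labels gam e by rewrite eqxx.
by rewrite -lx -(profile_labels e x).
Qed.

End expansion.

Lemma cvg_prod_fin (E : finType) (u : E -> nat -> R) (l : E -> R) :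
  (forall e, u e n @[n --> \oo] --> l e) ->
  \prod_e u e n @[n --> \oo] --> \prod_e l e.
Proof. by move=> ul; apply: (cvg_big mul_continuous) => e _; exact: ul. Qed.

Lemma cvg_sum_fin (E : finType) (u : E -> nat -> R) (l : E -> R) :
  (forall e, u e n @[n --> \oo] --> l e) ->
  \sum_e u e n @[n --> \oo] --> \sum_e l e.
Proof. by move=> ul; apply: (cvg_big add_continuous) => e _; exact: ul. Qed.

Lemma cvg_up_to (d : nat -> R) (dl : R) :
  (forall eps, 0 < eps -> exists a : nat -> R, exists al : R,
    [/\ forall n, `|d n - a n| <= eps, `|dl - al| <= eps &
        a n @[n --> \oo] --> al]) ->
  d n @[n --> \oo] --> dl.
Proof.
move=> H; apply/cvgrPdist_le => eps eps0.
have e3 : 0 < eps / 3 by rewrite divr_gt0.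
have [a [al [da dla /cvgrPdist_le/(_ _ e3) aal]]] := H _ e3.
near=> n.
have an : `|al - a n| <= eps / 3 by near: n.
rewrite (_ : dl - d n = (dl - al) + (al - a n) + (a n - d n)); last by ring.
rewrite (le_trans (ler_normD _ _))//.
rewrite (_ : eps = eps / 3 + eps / 3 + eps / 3); last by field.
rewrite lerD// ?[`|a n - d n|]distrC//.
by rewrite (le_trans (ler_normD _ _))// lerD.
Unshelve. all: by end_near. Qed.

(** A weight is only determined in the limit on cells of positive limit volume.
    A null cell does no harm, since it forces the density [d] to tend to zero
    while the weights stay bounded. *)
Lemma cvg_weighted_density (E : finType) (v w : E -> nat -> R) (vl wl : E -> R)
    (d : nat -> R) (dl : R) :
  (forall e n, 0 <= w e n <= 1) ->
  (forall e, v e n @[n --> \oo] --> vl e) ->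
  (forall e, v e n * w e n @[n --> \oo] --> vl e * wl e) ->
  (forall e, vl e = 0 -> dl = 0) ->
  (forall n, 0 <= d n) ->
  d n @[n --> \oo] --> dl ->
  (\prod_e w e n) * d n @[n --> \oo] --> (\prod_e wl e) * dl.
Proof.
move=> w01 vvl vwvl v0 d0 ddl.
have [/forallP vne0|/forallPn[e]] := boolP [forall e, vl e != 0]; last first.
  rewrite negbK => /eqP /v0 dl0; rewrite dl0 mulr0; rewrite dl0 in ddl.
  apply: (@squeeze_cvgr _ _ _ _ (fun=> 0) d) => //; last exact: cvg_cst.
  apply: nearW => n; have /andP[p0 p1] := prod01 predT (fun e => w01 e n).
  by rewrite mulr_ge0//= ler_piMl.
apply: cvgM => //; apply: cvg_prod_fin => e.
have lim : v e n * w e n * (v e n)^-1 @[n --> \oo] --> vl e * wl e * (vl e)^-1.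
  by apply: cvgM => //; exact: cvgV.
rewrite mulrAC divff// mul1r in lim.
apply: cvg_trans lim; apply: near_eq_cvg.
have : \forall n \near \oo, v e n != 0.
  exact: (cvgr_neq0 _ (vvl e)).
by apply: filterS => n vn0; rewrite mulrAC divff// mul1r.
Qed.

End density.

(** * The counting lemma *)

Section counting.
Context (R : realType).

Lemma measurable_level K p (P : branching_partition R K p) l i :
  measurable (P l i).
Proof. by have [mP _ _ _] := level_partition P l; exact: mP. Qed.

Lemma cut_bounded_L1 K (D : cube R (rset_lt K) -> R) : bmf D ->
  cut_bounded D (\int[cube_lebesgue R (rset_lt K)]_x `|D x|).
Proof.
move=> bD u u01.
have bu := bmf_face_prod (test01_bmf u01).
apply: (le_trans (Ex_norm _ (bmfM bD bu))).
apply: (Ex_le _ (bmf_norm (bmfM bD bu)) (bmf_norm bD)) => x.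
rewrite normrM ler_piMr//; have /andP[? ?] := face_prod01 x u01.
by rewrite ger0_norm.
Qed.

(** The top coordinate of each face occurs in a single factor, so integrating it
    out turns indicators into hypergraphons. *)
Lemma density_replace k m (S : inc k.+1 m -> set (cube R (rset k.+1)))
    (B : inc k.+1 m -> cube R (rset_lt k.+1) -> R) (c : inc k.+1 m -> R) :
  (forall e, measurable (S e)) ->
  (forall e, measurable_fun setT (B e)) -> (forall e y, 0 <= B e y <= 1) ->
  (forall e, cut_bounded (fun y => set_graphon (S e) y - B e y) (c e)) ->
  `|density S - \int[cube_lebesgue R (rset m)]_x \prod_e B e (restrict_face e x)|
    <= \sum_e c e.
Proof.
move=> mS mB B01 Sc.
have bS e : bmf (\1_(S e) : _ -> R) by exact: bmf_indic.
pose b e (y : cube R (rset k.+1)) := B e (y \o @rset_of_lt _).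
have mr : measurable_fun setT (fun y : cube R (rset k.+1) =>
    (y \o @rset_of_lt _ : cube R (rset_lt k.+1))) by exact: measurable_reindex.
have mb e : measurable_fun setT (b e) by exact: (measurableT_comp (mB e) mr).
apply: (@replace_all R k m _ (fun e : inc k.+1 m => val e) _ _
  (fun e => \1_(S e)) b) => //.
- by move=> e; exact: increasing_inj.
- by move=> e e'; exact: inc_avoid.
- by move=> e y; exact: indic01.
- by move=> e y; exact: B01.
move=> e; have := Sc e; congr (cut_bounded _ _); apply/funext => y.
have bSt := bmf_comp (measurable_add_top2 y) (bS e).
have addK t : add_top y t \o @rset_of_lt _ = y.
  by apply/funext => A /=; rewrite add_top_lt.
rewrite /integrate_top (eq_Ex _ (g := fun t => \1_(S e) (add_top y t) - B e y)).
  by rewrite (ExB _ bSt (bmf_cst _ _)) Ex_cst.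
by move=> t; rewrite /b addK.
Qed.

Lemma rset_lt1_void (A : rset_lt 1) : False.
Proof.
have /andP[A0 /proper_card] := valP A; rewrite cardsT card_ord ltnS leqn0.
by rewrite cards_eq0 (negbTE A0).
Qed.

(** Distinct vertices have independent coordinates.  With no lower faces, the error
    of replacing an indicator by its mean is zero. *)
Lemma density_base m (S : inc 1 m -> set (cube R (rset 1))) :
  (forall e, measurable (S e)) ->
  density S = \prod_e fine (cube_lebesgue R (rset 1) (S e)).
Proof.
move=> mS; pose v e := fine (cube_lebesgue R (rset 1) (S e)).
have v01 e : 0 <= v e <= 1.
  rewrite /v -Ex_indic//; apply: Ex_01; first exact: bmf_indic.
  by move=> y; exact: indic01.
have vE e y : set_graphon (S e) y = v e.
  rewrite /v Ex_set_graphon// -[LHS](Ex_cst (cube_lebesgue R (rset_lt 1))).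
  apply: eq_Ex => y'; congr (set_graphon _ _).
  by apply/funext => A; have := rset_lt1_void A.
have H0 e : cut_bounded (fun y => set_graphon (S e) y - v e) 0.
  move=> u _; rewrite (eq_Ex _ (g := fun=> 0)) ?Ex_cst ?normr0// => y.
  by rewrite vE subrr mul0r.
have := @density_replace 0 m S (fun e _ => v e) (fun=> 0) mS
  (fun e => @measurable_cst _ _ _ _ _ _) (fun e _ => v01 e) H0.
by rewrite [leRHS]big1// Ex_cst normr_le0 subr_eq0 => /eqP.
Qed.

Lemma stepping_bounds k (J : finType) (Q : J -> set (cube R (rset k.+1)))
    (S : set (cube R (rset k.+2))) :
  symmetric_partition Q -> measurable S ->
  measurable_fun setT (stepping (k := k.+2) (set_graphon S) Q) /\
  forall y, 0 <= stepping (k := k.+2) (set_graphon S) Q y <= 1.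
Proof.
move=> /partition_label[c [mc _ Qc]] mS.
have mp := finlab_profile (K := k.+2) mc.
have [mW W01] := set_graphon01 mS.
have bW : bmf (set_graphon S) by exact: bmf_set_graphon.
have E : stepping (k := k.+2) (set_graphon S) Q =
    cond_exp (cube_lebesgue R (rset_lt k.+2)) (set_graphon S)
      (profile (K := k.+2) c).
  by apply/funext => y; exact: (steppingE (K := k.+2) Qc).
rewrite E; split; first by case: (bmf_cond_exp (cube_lebesgue R (rset_lt k.+2))
  (set_graphon S) mp).
by move=> y; exact: cond_exp01.
Qed.

Lemma cell_weight_bounds k (J : finType) (Q : J -> set (cube R (rset k.+1)))
    (S : set (cube R (rset k.+2))) f :
  symmetric_partition Q -> measurable S ->
  0 <= cell_weight (k := k.+2) (set_graphon S) Q f <= 1.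
Proof.
move=> /partition_label[c [mc _ Qc]] mS.
have mp := finlab_profile (K := k.+2) mc.
have [mW W01] := set_graphon01 mS.
have bW : bmf (set_graphon S) by exact: bmf_set_graphon.
rewrite (cell_weightE (K := k.+2) Qc); exact: lab_weight01.
Qed.

Lemma small_ratio (a eps : R) : 0 < eps ->
  \forall n \near \oo, a / n.+1%:R <= eps.
Proof.
move=> eps0.
have : a / n.+1%:R @[n --> \oo] --> (0 : R).
  rewrite -(mulr0 a); apply: cvgM; first exact: cvg_cst.
  exact: cvg_harmonic.
move=> /cvgrPdist_le/(_ _ eps0); apply: filterS => n; rewrite sub0r normrN.
exact: le_trans (ler_norm _).
Qed.

Lemma quotient_d1_cvg (k : nat) (J : finType)
    (V : nat -> {ffun 'I_k -> J} -> R * R) (Vl : {ffun 'I_k -> J} -> R * R) :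
  quotient_d1 (V n) Vl @[n --> \oo] --> (0 : R) <->
  forall f, (V n f).1 @[n --> \oo] --> (Vl f).1 /\
    (V n f).1 * (V n f).2 @[n --> \oo] --> (Vl f).1 * (Vl f).2.
Proof.
split=> [d0 f|H].
  have bound (u : nat -> R) (l : R) : (forall n, `|u n - l| <= quotient_d1 (V n) Vl) ->
      u n @[n --> \oo] --> l.
    move=> ul; apply/cvgrPdist_le => eps eps0.
    move/cvgrPdist_le : d0 => /(_ _ eps0); apply: filterS => n.
    rewrite sub0r normrN => le; rewrite distrC.
    exact: (le_trans (ul n) (le_trans (ler_norm _) le)).
  split; apply: bound => n; rewrite /quotient_d1 (bigD1 f)//=.
    by rewrite -addrA lerDl addr_ge0// sumr_ge0// => g _; rewrite addr_ge0.
  by rewrite addrAC lerDr addr_ge0// sumr_ge0// => g _; rewrite addr_ge0.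
rewrite /quotient_d1.
rewrite [X in _ --> X](_ : (0 : R) = \sum_(f : {ffun 'I_k -> J})
    (`|(Vl f).1 - (Vl f).1| +
     `|(Vl f).1 * (Vl f).2 - (Vl f).1 * (Vl f).2|)); last first.
  by rewrite big1// => f _; rewrite !subrr normr0 addr0.
apply: (cvg_sum_fin (u := fun f n => `|(V n f).1 - (Vl f).1| +
    `|(V n f).1 * (V n f).2 - (Vl f).1 * (Vl f).2|)) => f; have [H1 H2] := H f.
apply: cvgD; apply: cvg_norm; apply: cvgB => //; exact: cvg_cst.
Qed.

Section step.
Variables (k : nat) (p q : nat -> nat).
Variables (P : nat -> branching_partition R k.+2 p)
  (Pt : branching_partition R k.+2 p).
Variables (Q : nat -> branching_partition R k.+1 q)
  (Qt : branching_partition R k.+1 q).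
Hypothesis reg : forall n, weakly_regular_pair (P n) (Q n) (fun s => s%:R^-1).
Hypothesis count : forall m s (g : inc k.+1 m -> level_index q s),
  density (fun e => Q n s (g e)) @[n --> \oo] --> density (fun e => Qt s (g e)).
Hypothesis quot : forall s l (i : level_index p l), (0 < s)%N -> (0 < l)%N ->
  quotient_d1 (quotient (k := k.+2) (set_graphon (P n l i)) (Q n s))
              (quotient (k := k.+2) (set_graphon (Pt l i)) (Qt s))
    @[n --> \oo] --> (0 : R).
Hypothesis ae_step : forall l (i : level_index p l),
  {ae cube_lebesgue R (rset_lt k.+2), forall x,
    stepping (k := k.+2) (set_graphon (Pt l i)) (Qt s) x @[s --> \oo]
      --> set_graphon (Pt l i) x}.

(** Both densities are close to those of the steppings at a fine level [t.+1]: for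
    [P n] by regularity, uniformly in [n], and for [Pt] because its steppings
    converge in mean.  At a fixed level the steppings only involve densities for
    [Q n], which converge. *)
Lemma counting_step m s (g : inc k.+2 m -> level_index p s) :
  density (fun e => P n s (g e)) @[n --> \oo] --> density (fun e => Pt s (g e)).
Proof.
(* The only part of level 0 is the whole cube. *)
case: s g => [|s] g.
  have setTE (B : branching_partition R k.+2 p) :
      (fun e => B 0%N (g e)) = fun=> setT.
    by apply/funext => e; case: (g e); rewrite level0.
  by rewrite setTE; under eq_cvg do rewrite setTE; exact: cvg_cst.
set mu := cube_lebesgue R (rset m).
apply: (cvg_up_to (d := fun n => density (fun e => P n s.+1 (g e)))) => eps eps0.
set E := inc k.+2 m; pose cE : R := #|E|%:R.
have eps2 : 0 < eps / 2 by rewrite divr_gt0.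
(* First the number of colours, then the precision [1 / t.+1] of the regularity,
   since the former multiplies the latter. *)
have [N NP] : exists N, (cE * (k.+2 ^ 2)%:R) / N.+1%:R <= eps / 2.
  exact: (@filter_ex _ _ eventually_filter _ (small_ratio _ eps2)).
pose Wt e := set_graphon (Pt s.+1 (g e)).
pose Bt t e := stepping (k := k.+2) (Wt e) (Qt t).
have mPt e : measurable (Pt s.+1 (g e)) by exact: measurable_level.
have bWt e : bmf (Wt e) by exact: bmf_set_graphon.
have [mBt Bt01] : (forall t e, measurable_fun setT (Bt t e)) /\
    (forall t e y, 0 <= Bt t e y <= 1).
  by split=> t e; have [] := stepping_bounds (level_partition Qt t) (mPt e).
have bBt t e : bmf (Bt t e) by apply: bmf01; [exact: mBt|exact: Bt01].
pose del t e := \int[cube_lebesgue R (rset_lt k.+2)]_x `|Wt e x - Bt t e x|.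
have del0 : \forall t \near \oo, \sum_e del t e <= eps.
  have : \sum_e del t e @[t --> \oo] --> \sum_(e : E) (0 : R).
    apply: (cvg_sum_fin (u := fun e t => del t e)) => e.
    rewrite [X in _ --> X](_ : 0 = \int[cube_lebesgue R (rset_lt k.+2)]_x 0);
      last by rewrite Ex_cst.
    apply: (@Ex_cvg _ _ _ _ (fun t x => `|Wt e x - Bt t e x|) _ 1).
    - by move=> t; case: (bmf_norm (bmfB (bWt e) (bBt t e))).
    - exact: measurable_cst.
    - move=> t x; rewrite normr_id ler_norml.
      have [_ W01] := set_graphon01 (mPt e).
      have /andP[w0 w1] := W01 x; have /andP[b0 b1] := Bt01 t e x.
      by apply/andP; split; rewrite /Wt; lra.
    apply: filterS (ae_step (g e)) => x cx.
    rewrite [X in _ --> X](_ : 0 = `|Wt e x - Wt e x|); last by rewrite subrr normr0.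
    by apply: cvg_norm; apply: cvgB => //; exact: cvg_cst.
  rewrite big1// => /cvgrPdist_le/(_ _ eps0); apply: filterS => t.
  by rewrite sub0r normrN; exact: le_trans (ler_norm _).
have [t [st Nt dt]] : exists t, [/\ (s <= t)%N,
    (cE * (N.+2 ^ k.+2)%:R) / t.+1%:R <= eps / 2 &
    \sum_e del t.+1 e <= eps].
  have d1 : \forall t \near \oo, \sum_e del t.+1 e <= eps.
    by case: del0 => N0 _ HN; exists N0 => // t /= tN; apply: HN; exact: leqW.
  have d2 := small_ratio (cE * (N.+2 ^ k.+2)%:R) eps2.
  have d3 : \forall t \near \oo, (s <= t)%N by exact: nbhs_infty_ge.
  have : \forall t \near \oo, [/\ (s <= t)%N,
    (cE * (N.+2 ^ k.+2)%:R) / t.+1%:R <= eps / 2 & \sum_e del t.+1 e <= eps].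
    by near=> t; split; near: t.
  by move=> /filter_ex.
pose W n e := set_graphon (P n s.+1 (g e)).
pose B n e := stepping (k := k.+2) (W n e) (Q n t.+1).
have mP n e : measurable (P n s.+1 (g e)) by exact: measurable_level.
have bW n e : bmf (W n e) by exact: bmf_set_graphon.
have [mB B01] : (forall n e, measurable_fun setT (B n e)) /\
    (forall n e y, 0 <= B n e y <= 1).
  by split=> n e; have [] := stepping_bounds (level_partition (Q n) t.+1) (mP n e).
have bB n e : bmf (B n e) by apply: bmf01; [exact: mB|exact: B01].
exists (fun n => \int[mu]_x \prod_e B n e (restrict_face e x)).
exists (\int[mu]_x \prod_e Bt t.+1 e (restrict_face e x)); split.
- move=> n.
  pose c : R := (N.+2 ^ k.+2)%:R * t.+1%:R^-1 + (k.+2 ^ 2)%:R / N.+1%:R.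
  apply: (@le_trans _ _ (\sum_(e : E) c)).
    apply: density_replace => // e; apply: cut_norm_bounded => //.
    + exact: (bmfB (bW n e) (bB n e)).
    + move=> x; rewrite ler_norml.
      have [_ W01] := set_graphon01 (mP n e).
      have /andP[w0 w1] := W01 x; have /andP[b0 b1] := B01 n e x.
      by apply/andP; split; lra.
    + exact: reg.
  rewrite sumr_const -[leLHS]mulr_natl -/cE /c mulrDr !mulrA.
  by rewrite (splitr eps) lerD.
- apply: le_trans dt; apply: density_replace => // e.
  exact: (cut_bounded_L1 (bmfB (bWt e) (bBt t.+1 e))).
have [cn cnP] := choice (fun n => partition_label (level_partition (Q n) t.+1)).
have [ct [mct _ Qct]] := partition_label (level_partition Qt t.+1).
rewrite /Bt (stepping_expansion mct Qct).
have En n : \int[mu]_x \prod_e B n e (restrict_face e x) =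
    \sum_(gam : {ffun inc k.+1 m -> level_index q t.+1})
      (\prod_e cell_weight (k := k.+2) (W n e) (Q n t.+1) (face_labels gam e)) *
      density (fun d => Q n t.+1 (gam d)).
  have [mcn _ Qcn] := cnP n; exact: stepping_expansion mcn Qcn _.
under eq_cvg do rewrite En.
apply: (cvg_sum_fin (u := fun (gam : {ffun inc k.+1 m -> level_index q t.+1}) n =>
  (\prod_e cell_weight (k := k.+2) (W n e) (Q n t.+1) (face_labels gam e)) *
      density (fun d => Q n t.+1 (gam d)))) => gam.
have quot' e := (quotient_d1_cvg _ _).1 (quot (g e) (ltn0Sn t) (ltn0Sn s)).
apply: (cvg_weighted_density
  (v := fun e n => cell_vol (k := k.+2) (Q n t.+1) (face_labels gam e))
  (vl := fun e => cell_vol (k := k.+2) (Qt t.+1) (face_labels gam e))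
  (w := fun e n => cell_weight (k := k.+2) (W n e) (Q n t.+1) (face_labels gam e))).
- move=> e n; apply: cell_weight_bounds => //; exact: level_partition.
- by move=> e; have [] := quot' e (face_labels gam e).
- by move=> e; have [] := quot' e (face_labels gam e).
- move=> e v0; apply/eqP; rewrite eq_le; apply/andP; split.
    by rewrite -[leRHS]v0; exact: density_le_cell_vol mct Qct _ _.
  by have /andP[] := @density01 R _ _ (fun d => Qt t.+1 (gam d))
    (fun d => measurable_level Qt _).
- by move=> n; have /andP[] := @density01 R _ _ (fun d => Q n t.+1 (gam d))
    (fun d => measurable_level (Q n) _).
exact: (@count m t.+1 (fun d => gam d)).
Unshelve. all: by end_near. Qed.

End step.

Theorem counting_lemma k p (P : nat -> branching_partition R k.+1 p)
    (Pt : branching_partition R k.+1 p) :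
  partitionably_converges P Pt ->
  forall m s (g : inc k.+1 m -> level_index p s),
  density (fun e => P n s (g e)) @[n --> \oo] --> density (fun e => Pt s (g e)).
Proof.
elim: k p P Pt => [|k IHk] p P Pt /=.
  move=> PPt m s g.
  rewrite (density_base (fun e => measurable_level Pt (g e))).
  under eq_cvg do rewrite (density_base (fun e => measurable_level (P _) (g e))).
  apply: (cvg_prod_fin (u := fun e n =>
    fine (cube_lebesgue R (rset 1) (P n s (g e))))) => e.
  apply: fine_cvg; rewrite fineK ?fin_num_measure//; first exact: PPt.
  exact: measurable_level.
move=> [q [Q [Qt [hq reg QQt quot ae_step]]]] m s g.
exact: (counting_step reg (IHk _ _ _ QQt) quot ae_step).
Qed.

End counting.

(** * Weak regularity *)

Section relabel.
Context d (T : measurableType d) (R : realType) (mu : probability T R).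

(** Only the partition matters, not the names of its parts. *)
Lemma cond_exp_relabel (F F' : finType) (W : T -> R) (c : T -> F) (h : F -> F') :
  injective h -> cond_exp mu W (fun x => h (c x)) =1 cond_exp mu W c.
Proof.
move=> h_inj x; rewrite /cond_exp /lab_weight /lab_vol.
have cellE y : ((h (c y) == h (c x))%:R : R) = (c y == c x)%:R.
  by rewrite (inj_eq h_inj).
have -> : \int[mu]_y ((h (c y) == h (c x))%:R : R) = \int[mu]_y (c y == c x)%:R.
  by apply: eq_Ex.
case: ifP => // _; congr (_ * _); apply: eq_Ex => y; by rewrite cellE.
Qed.

End relabel.

Lemma prod_perturb (R : realType) (E : finType) (a b : E -> R) (c : R) :
  (forall e, 0 <= a e <= 1) -> (forall e, 0 <= b e <= 1) ->
  (forall e, `|a e - b e| <= c) ->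
  `|\prod_e a e - \prod_e b e| <= #|E|%:R * c.
Proof.
move=> a01 b01 abc.
have -> : #|E|%:R * c = \sum_(e : E) c by rewrite sumr_const mulr_natl.
suff [] : [/\ 0 <= \prod_e a e <= 1, 0 <= \prod_e b e <= 1 &
    `|\prod_e a e - \prod_e b e| <= \sum_(e : E) c] by [].
apply: (big_ind3 (fun x y z => [/\ 0 <= x <= 1, 0 <= y <= 1 & `|x - y| <= z])).
- by rewrite lexx ler01 subrr normr0.
- move=> x1 x2 x3 y1 y2 y3 [/andP[? ?] /andP[? ?] le2] [/andP[? ?] /andP[? ?] le3].
  split; try by rewrite mulr_ge0//= mulr_ile1.
  rewrite (_ : _ - _ = (x1 - x2) * y1 + x2 * (y1 - y2)); last by ring.
  apply: (le_trans (ler_normD _ _)); rewrite !normrM.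
  by apply: lerD; [apply: le_trans le2|apply: le_trans le3];
    [rewrite ler_piMr// ger0_norm|rewrite ler_piMl// ger0_norm].
- by move=> e _.
Qed.

Lemma budget_step (R : realType) (x a b r : R) (t : nat) :
  x < a + t.+1%:R * r -> a + r <= b -> x < b + t%:R * r.
Proof. by rewrite -natr1; lra. Qed.

Section weak_regularity.
Context (R : realType) (k : nat).
Local Notation K := k.+2.
Local Notation X := (cube R (rset_lt k.+2)).
Local Notation Y := (cube R (rset k.+1)).
Local Notation mu := (cube_lebesgue R (rset_lt k.+2)).
Local Notation prof := (profile (K := k.+2)).

Variable I : finType.

Section fixed_precision.
Variables (eps : R) (N : nat).
Hypothesis eps_gt0 : 0 < eps.
Hypothesis N_gt0 : (0 < N)%N.
Hypothesis N_eps : K%:R / N%:R <= eps / 2.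
Variable W : I -> X -> R.
Hypothesis mW : forall i, measurable_fun setT (W i).
Hypothesis W01 : forall i x, 0 <= W i x <= 1.

Let bW i : bmf (W i). Proof. exact: bmf01. Qed.

Definition regular_label (J : finType) (c : Y -> J) : Prop :=
  forall i, (cut_norm (fun x => (W i x - cond_exp mu (W i) (prof c) x)%R)
    <= eps%:E)%E.

Definition energy (J : finType) (c : Y -> J) : R :=
  \sum_i \int[mu]_x (cond_exp mu (W i) (prof c) x) ^+ 2.

Lemma energy_le (J : finType) (c : Y -> J) : finlab c -> energy c <= #|I|%:R.
Proof.
move=> mc; rewrite /energy -sum1_card natr_sum; apply: ler_sum => i _.
have mp := finlab_profile (K := K) mc.
have bc := bmf_cond_exp mu (W i) mp.
have bc2 := bmf_sqr bc.
suff /andP[] : 0 <= \int[mu]_x (cond_exp mu (W i) (prof c) x) ^+ 2 <= 1 by [].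
apply: (Ex_01 mu bc2) => x.
have /andP[? ?] := cond_exp01 mu x (bW i) mp (W01 i).
by rewrite sqr_ge0 expr_le1.
Qed.

Definition pair_label (J J' : finType) (c : Y -> J) (c' : Y -> J') (y : Y) :
  (J * J')%type := (c y, c' y).

Let fst_profile (J J' : finType) (f : {ffun 'I_K -> (J * J')%type}) :
  {ffun 'I_K -> J} := [ffun i => (f i).1].

Let profile_pair (J J' : finType) (c : Y -> J) (c' : Y -> J') x :
  prof c x = fst_profile (prof (pair_label c c') x).
Proof. by apply/ffunP => i; rewrite !ffunE. Qed.

(** A symmetric witness of irregularity correlates with [W - E[W|c]]; rounding it
    to a grid keeps half of the correlation and makes it a function of a finer
    symmetric label. *)
Lemma energy_increment (J : finType) (c : Y -> J) :
  finlab c -> symmetric_fun c -> ~ regular_label c ->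
  exists d : Y -> {ffun 'I_K -> 'I_N.+1},
    [/\ finlab d, symmetric_fun d &
        energy c + (eps / 2) ^+ 2 <= energy (pair_label c d)].
Proof.
move=> mc sc /existsNP[i0 irr].
have mp := finlab_profile (K := K) mc.
pose D x := W i0 x - cond_exp mu (W i0) (prof c) x.
have bD : bmf D by apply: bmfB => //; exact: bmf_cond_exp.
have D1 x : `|D x| <= 1.
  have /andP[w0 w1] := W01 i0 x.
  have /andP[e0 e1] := cond_exp01 mu x (bW i0) mp (W01 i0).
  by rewrite ler_norml /D; apply/andP; split; lra.
have [u [u01 su uD]] : exists u, [/\ test01 u, forall i, symmetric_fun (u i) &
    eps < `|\int[mu]_x (D x * face_prod u x)|].
  apply: contra_notP irr => no; apply/cut_normP => u u01 su.
  by rewrite leNgt; apply/negP => lt; apply: no; exists u.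
pose d (y : Y) : {ffun 'I_K -> 'I_N.+1} := [ffun i => grid N (u i y)].
have md : finlab d.
  by apply: finlab_ffun => i; apply: finlab_grid; case: u01.
have sd : symmetric_fun d by move=> s y; apply/ffunP => i; rewrite !ffunE su.
exists d; split => //.
have mcd : finlab (pair_label c d) by exact: finlab_pair.
have mpcd := finlab_profile (K := K) mcd.
have gain i := cond_exp_pythagoras mu (bW i) mpcd (@profile_pair _ _ c d).
have energyD (J' : finType) (c' : Y -> J') : energy c' =
    \int[mu]_x (cond_exp mu (W i0) (prof c') x) ^+ 2 +
    \sum_(i | i != i0) \int[mu]_x (cond_exp mu (W i) (prof c') x) ^+ 2.
  by rewrite /energy (bigD1 i0 isT).
have aux (a b a' b' r : R) : r <= a' - a -> b <= b' -> a + b + r <= a' + b'.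
  by lra.
rewrite !energyD; apply: aux; last first.
  by apply: ler_sum => i _; rewrite -subr_ge0 -gain; apply: Ex_ge0 => x;
    exact: sqr_ge0.
pose h (f : {ffun 'I_K -> (J * {ffun 'I_K -> 'I_N.+1})%type}) : R :=
  \prod_i (((f i).2 i)%:R / N%:R).
have val01 (a : 'I_N.+1) : 0 <= (a%:R / N%:R : R) <= 1.
  rewrite divr_ge0//= ler_pdivrMr ?ltr0n// mul1r ler_nat -ltnS.
  exact: ltn_ord.
have h1 f : `|h f| <= 1.
  have /andP[h0 h1] : 0 <= h f <= 1 by apply: prod01 => i; exact: val01.
  by rewrite ger0_norm.
apply: le_trans (cond_exp_correlation mu (bW i0) mpcd (@profile_pair _ _ c d) h1).
have e2 : 0 <= eps / 2 by rewrite divr_ge0// ltW.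
rewrite -[leRHS]real_normK ?num_real// lerXn2r ?nnegrE//.
have bu := bmf_face_prod (test01_bmf u01).
have bh : bmf (fun x => h (prof (pair_label c d) x)) by exact: finlab_bmf.
have close x : `|face_prod u x - h (prof (pair_label c d) x)| <= eps / 2.
  apply: le_trans N_eps.
  rewrite -[X in X%:R / _](card_ord K); apply: prod_perturb => i; first exact: u01.2.
    exact: val01.
  rewrite ffunE /pair_label /= ffunE.
  exact: (grid_approx N_gt0 (u01.2 i _)).1.
have bdiff := bmfB bu bh.
have err : `|\int[mu]_x (D x * (face_prod u x - h (prof (pair_label c d) x)))|
    <= eps / 2.
  apply: (Ex_norm_le mu (bmfM bD bdiff)) => x; rewrite normrM.
  by rewrite -[leRHS]mul1r ler_pM.
have split_int : \int[mu]_x (D x * face_prod u x) =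
    \int[mu]_x (D x * (face_prod u x - h (prof (pair_label c d) x))) +
    \int[mu]_x (D x * h (prof (pair_label c d) x)).
  rewrite -(ExD mu (bmfM bD bdiff) (bmfM bD bh)); apply: eq_Ex => x.
  by rewrite -mulrDr subrK.
suff : eps / 2 <= `|\int[mu]_x (D x * h (prof (pair_label c d) x))| by [].
rewrite split_int in uD; have := lt_le_trans uD (ler_normD _ _).
by move: err; rewrite {2}(splitr eps); lra.
Qed.

Lemma regular_pair_relabel (J J' : finType) (c : Y -> J) (h : J -> J') :
  injective h -> regular_label c -> regular_label (fun y => h (c y)).
Proof.
move=> h_inj reg i; have := reg i.
rewrite (_ : (fun x => W i x - cond_exp mu (W i) (prof c) x) =
  (fun x => W i x - cond_exp mu (W i) (prof (fun y => h (c y))) x))//.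
apply/funext => x; congr (_ - _).
pose hf (f : {ffun 'I_K -> J}) : {ffun 'I_K -> J'} := [ffun j => h (f j)].
have hf_inj : injective hf.
  by move=> f g /ffunP fg; apply/ffunP => j; apply: h_inj; have := fg j; rewrite !ffunE.
rewrite -(cond_exp_relabel mu (W i) (prof c) hf_inj).
apply: (congr1 (fun p => cond_exp mu (W i) p x)); apply/funext => x'.
by apply/ffunP => j; rewrite !ffunE.
Qed.

(** The label accumulated in [t] steps; its type depends neither on the partition
    nor on the hypergraphons, which is what makes the degree uniform. *)
Fixpoint refinement_type (t : nat) : finType :=
  if t is t'.+1 then ({ffun 'I_K -> 'I_N.+1} * refinement_type t')%type
  else unit.

Fixpoint refinement_default t : refinement_type t :=
  if t is t'.+1 then ([ffun=> ord0], refinement_default t') else tt.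

(** At most [t] increments fit below the total energy [#|I|]; when the partition is
    already regular the remaining parts are left empty. *)
Lemma energy_iteration t (J : finType) (c : Y -> J) :
  finlab c -> symmetric_fun c ->
  #|I|%:R < energy c + t%:R * (eps / 2) ^+ 2 ->
  exists d : Y -> refinement_type t,
    [/\ finlab d, symmetric_fun d & regular_label (pair_label c d)].
Proof.
elim: t J c => [|t IHt] J c mc sc en.
  by move: en; rewrite mul0r addr0 ltNge energy_le.
have [reg|irr] := pselect (regular_label c).
  exists (fun=> refinement_default t.+1); split.
  - exact: (finlab_map (fun=> refinement_default t.+1) mc).
  - by move=> s y.
  apply: (regular_pair_relabel (h := fun j => (j, refinement_default t.+1)) _ reg).
  by move=> j j' [].
have [d1 [md1 sd1 en1]] := energy_increment mc sc irr.
have mcd : finlab (pair_label c d1) by exact: finlab_pair.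
have scd : symmetric_fun (pair_label c d1).
  by move=> s y; rewrite /pair_label sc sd1.
have [|d2 [md2 sd2 reg2]] := IHt _ (pair_label c d1) mcd scd.
  exact: (budget_step en en1).
exists (fun y => (d1 y, d2 y)); split.
- exact: finlab_pair.
- by move=> s y; rewrite sd1 sd2.
apply: (regular_pair_relabel (h := fun j => (j.1.1, (j.1.2, j.2))) _ reg2).
by move=> [[a b] e] [[a' b'] e'] [-> -> ->].
Qed.

End fixed_precision.

(** The energy starts at 0 or above, so the number of steps, and with it the number
    of parts, can be fixed before the hypergraphons and the partition are known. *)
Lemma weak_regularity (eps : R) : 0 < eps -> exists2 n : nat, (0 < n)%N &
  forall W : I -> X -> R, (forall i, measurable_fun setT (W i)) ->
    (forall i x, 0 <= W i x <= 1) ->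
  forall (J : finType) (c : Y -> J), finlab c -> symmetric_fun c ->
  exists d : Y -> 'I_n,
    [/\ finlab d, symmetric_fun d & regular_label eps W (fun y => (c y, d y))].
Proof.
move=> eps0; have e2 : 0 < eps / 2 by rewrite divr_gt0.
have [N NP] : exists N, K%:R / N.+1%:R <= eps / 2.
  exact: (@filter_ex _ _ eventually_filter _ (small_ratio _ e2)).
have e4 : 0 < (eps / 2) ^+ 2 by rewrite exprn_gt0.
have [t tP] : exists t : nat, #|I|%:R < t%:R * (eps / 2) ^+ 2.
  exists (Num.truncn (#|I|%:R / (eps / 2) ^+ 2)).+1.
  by rewrite -ltr_pdivrMr// truncnS_gt.
exists #|refinement_type N.+1 t|.
  by apply/card_gt0P; exists (refinement_default N.+1 t).
move=> W mW W01 J c mc sc.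
have [|d [md sd reg]] := energy_iteration (t := t) eps0 (ltn0Sn N) NP mW W01 mc sc.
  rewrite (lt_le_trans tP)// lerDr; apply: sumr_ge0 => i _.
  by apply: Ex_ge0 => x; exact: sqr_ge0.
exists (fun y => enum_rank (d y)); split.
- exact: finlab_map.
- by move=> s y; rewrite sd.
apply: (regular_pair_relabel (h := fun j => (j.1, enum_rank j.2)) _ reg).
by move=> [a b] [a' b'] /= [-> /enum_rank_inj ->].
Qed.

End weak_regularity.

(** At level [s.+1] the members of [P] of level at most [s.+1] are finitely many,
    so one refinement of the level [s] regularizes them all. *)
Lemma regular_branching (R : realType) k p : exists2 q : nat -> nat,
  positive_degrees q &
  forall P : branching_partition R k.+2 p,
  exists Q : branching_partition R k.+1 q,
    weakly_regular_pair P Q (fun s => s%:R^-1).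
Proof.
pose I s : finType := {l : 'I_s.+2 & level_index p l}.
have inv_gt0 s : 0 < s.+1%:R^-1 :> R by rewrite invr_gt0.
pose wr s := cid2 (weak_regularity k (I s) (inv_gt0 s)).
pose q s := s2val (wr s).
exists q => [s|P]; first by exact: (s2valP (wr s)).
pose W s (i : I s) := set_graphon (P _ (tagged i)).
have W01 s i : measurable_fun setT (W s i) /\ forall x, 0 <= W s i x <= 1.
  by apply: set_graphon01; exact: measurable_level.
pose good s := {c : cube R (rset k.+1) -> level_index q s |
  finlab c /\ symmetric_fun c}.
have step s (c : good s) : {d : cube R (rset k.+1) -> 'I_(q s) |
    [/\ finlab d, symmetric_fun d &
        regular_label s.+1%:R^-1 (W s) (fun y => (sval c y, d y))]}.
  have [mc sc] := svalP c.
  apply: cid; apply: (s2valP' (wr s)) => //.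
  - by move=> i; case: (W01 s i).
  - by move=> i; case: (W01 s i).
have good0 : finlab (fun _ : cube R (rset k.+1) => tt) /\
    symmetric_fun (fun _ : cube R (rset k.+1) => tt).
  split=> //; move=> [] /=; rewrite (_ : _ @^-1` _ = setT)//.
  by apply/seteqP; split.
have goodS s (c : good s) : finlab (fun y => (sval c y, sval (step s c) y)) /\
    symmetric_fun (fun y => (sval c y, sval (step s c) y)).
  have [mc sc] := svalP c; have [md sd _] := svalP (step s c).
  by split; [exact: finlab_pair|move=> t y; rewrite sc sd].
pose build := fix build s : good s :=
  if s is s'.+1 return good s then exist _ _ (goodS s' (build s'))
  else exist _ _ good0.
pose d s := sval (step s (build s)).
have labE s : iter_label d s = sval (build s).
  elim: s => [//|s IHs]; rewrite [LHS]/= IHs; by [].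
have [||Q QE] := @branching_of_labels R k.+1 q d.
- by move=> s; have [] := svalP (step s (build s)).
- by move=> s; have [] := svalP (step s (build s)).
exists Q => -[//|s] _ l i ls.
have [_ _ reg] := svalP (step s (build s)).
have ls' : (l < s.+2)%N by rewrite ltnS.
have := reg (existT (fun l : 'I_s.+2 => level_index p l : Type) (Ordinal ls') i).
rewrite /weakly_regular /W /=; congr (cut_norm _ <= _)%E; apply/funext => x.
congr (_ - _); rewrite (steppingE (K := k.+2) (c := iter_label d s.+1)).
  by rewrite /= labE.
by move=> j; rewrite QE.
Qed.

(** * Symmetry of the cells *)

Section symmetry.
Context (R : realType).

Definition permute_cell K (J : finType) (s : 'S_K) (f : {ffun 'I_K -> J}) :
  {ffun 'I_K -> J} := [ffun a => f (s a)].

Lemma permute_cell_inj K (J : finType) (s : 'S_K) :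
  injective (@permute_cell K J s).
Proof.
move=> f g /ffunP fg; apply/ffunP => a.
by have := fg (s^-1 a)%g; rewrite !ffunE permKV.
Qed.

(** A permutation carries the facet opposite to [a] to the facet opposite to [s a],
    up to reordering its vertices. *)
Lemma face_perm k (s : 'S_k.+1) (a : 'I_k.+1) :
  exists t : 'S_k, forall j, s (lift a j) = lift (s a) (t j).
Proof.
have ne j : s a != s (lift a j) by rewrite (inj_eq perm_inj) neq_lift.
pose t j := odflt j (unlift (s a) (s (lift a j))).
have tE j : s (lift a j) = lift (s a) (t j).
  by rewrite /t; have [j' -> ->] := unlift_some (ne j).
have t_inj : injective t.
  by move=> i j ij; apply: (@lift_inj _ a); apply: (@perm_inj _ s);
    rewrite !tE ij.
by exists (perm t_inj) => j; rewrite permE.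
Qed.

Lemma profile_perm k (J : finType) (c : cube R (rset k.+1) -> J) (s : 'S_k.+2)
    (x : cube R (rset_lt k.+2)) : symmetric_fun c ->
  profile (K := k.+2) c (x \o perm_rset_lt s) =
  permute_cell s (profile (K := k.+2) c x).
Proof.
move=> sc; apply/ffunP => a; rewrite !ffunE.
have [t tE] := face_perm s a.
rewrite -(sc t (x \o face (s a))); congr c; apply/funext => A /=.
congr (x _); apply: val_inj => /=; rewrite -!imset_comp.
by apply: eq_imset => j /=; rewrite tE.
Qed.

Lemma set_graphon_perm K (S : set (cube R (rset K.+1))) (s : 'S_K.+1) y :
  symmetric_set S -> set_graphon S (y \o perm_rset_lt s) = set_graphon S y.
Proof.
move=> sS; apply: eq_Ex => t.
have -> : add_top (y \o perm_rset_lt s) t = add_top y t \o perm_rset s.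
  apply/funext => A /=; have [->|/rset_ltP[B <-]] := eqVneq A (rset_top K).
    by rewrite add_top_top perm_rset_top add_top_top.
  by rewrite add_top_lt perm_rset_of_lt add_top_lt.
by rewrite !indicE; congr (_ : bool)%:R; apply/idP/idP; rewrite !inE => Sy; exact/(sS s).
Qed.

Lemma cell_integral_perm k (J : finType) (c : cube R (rset k.+1) -> J)
    (W : cube R (rset_lt k.+2) -> R) (s : 'S_k.+2) f :
  finlab c -> symmetric_fun c -> bmf W ->
  (forall x, W (x \o perm_rset_lt s) = W x) ->
  \int[cube_lebesgue R (rset_lt k.+2)]_x
    (W x * (profile (K := k.+2) c x == permute_cell s f)%:R) =
  \int[cube_lebesgue R (rset_lt k.+2)]_x
    (W x * (profile (K := k.+2) c x == f)%:R).
Proof.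
move=> mc sc bW sW.
have bc := bmf_cell R (permute_cell s f) (finlab_profile (K := k.+2) mc).
rewrite -(Ex_reindex (@perm_rset_lt_inj _ s) (bmfM bW bc)).
apply: eq_Ex => x; rewrite sW (profile_perm s x sc); congr (_ * (_ : bool)%:R).
by rewrite (inj_eq (@permute_cell_inj _ _ s)).
Qed.

End symmetry.

(** * The limit object *)

Section finite_sums.
Context d (T : measurableType d) (R : realType) (mu : probability T R).

Lemma Ex_label (F : finType) (c : T -> F) (h : F -> R) : finlab c ->
  \int[mu]_x h (c x) = \sum_f h f * lab_vol mu c f.
Proof.
move=> mc; have := Ex_lab mu h (bmf_cst T (1 : R)) mc.
have -> : \int[mu]_x (1 * h (c x)) = \int[mu]_x h (c x).
  by apply: eq_Ex => x; rewrite mul1r.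
move=> ->; apply: eq_bigr => f _; congr (_ * _).
by apply: eq_Ex => x; rewrite mul1r.
Qed.

End finite_sums.

Definition parent_cell q s K (g : {ffun 'I_K -> level_index q s.+1}) :
  {ffun 'I_K -> level_index q s} := [ffun a => (g a).1].

Lemma profile_parent (R : realType) K (q : nat -> nat)
    (c : forall s, cube R (rset K.-1) -> level_index q s) s x :
  (forall s x, c s x = (c s.+1 x).1) ->
  profile (c s) x = parent_cell (profile (c s.+1) x).
Proof. by move=> cS; apply/ffunP => a; rewrite !ffunE. Qed.

Section limit.
Context (R : realType) (k : nat) (p q : nat -> nat).
Local Notation K := k.+2.
Local Notation X := (cube R (rset_lt k.+2)).
Local Notation mu := (cube_lebesgue R (rset_lt k.+2)).
Local Notation cellt s := ({ffun 'I_k.+2 -> level_index q s}).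

Hypothesis hp : positive_degrees p.
Variable Qt : branching_partition R k.+1 q.
Let v s (f : cellt s) : R := cell_vol (k := K) (Qt s) f.
Variable z : forall l (i : level_index p l) s, cellt s -> R.
Hypothesis z_bounds : forall l (i : level_index p l) s (f : cellt s),
  0 <= z i f <= v f.
Hypothesis z_root : forall s (f : cellt s), z (l := 0) tt f = v f.
Hypothesis z_sum : forall l (i : level_index p l) s (f : cellt s),
  \sum_j z (l := l.+1) (i, j) f = z i f.
Hypothesis z_refine : forall l (i : level_index p l) s (f : cellt s),
  \sum_(g : cellt s.+1 | parent_cell g == f) z i g = z i f.
Hypothesis z_perm : forall l (i : level_index p l) s (f : cellt s) (t : 'S_K),
  z i (permute_cell t f) = z i f.

Let w l (i : level_index p l) s (f : cellt s) : R :=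
  if v f == 0 then 0 else (v f)^-1 * z i f.

Variable c : forall s, cube R (rset k.+1) -> level_index q s.
Hypothesis mc : forall s, finlab (c s).
Hypothesis sc : forall s, symmetric_fun (c s).
Hypothesis Qc : forall s j, Qt s j = c s @^-1` [set j].
Hypothesis cS : forall s x, c s x = (c s.+1 x).1.

Let prof s (x : X) : cellt s := profile (K := K) (c s) x.

Let mprof s : finlab (@prof s).
Proof. exact: finlab_profile. Qed.

Let vE s (f : cellt s) : v f = lab_vol mu (@prof s) f.
Proof. exact: (cell_volE (K := K) (@Qc s)). Qed.

Let v_ge0 s (f : cellt s) : 0 <= v f.
Proof. by rewrite vE lab_vol_ge0. Qed.

Let w01 l (i : level_index p l) s (f : cellt s) : 0 <= w i f <= 1.
Proof.
rewrite /w; case: ifPn => [_|v0]; first by rewrite lexx ler01.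
have v_gt0 : 0 < v f by rewrite lt_neqAle eq_sym v0 v_ge0.
have /andP[z0 zv] := z_bounds i f.
by rewrite mulr_ge0 ?invr_ge0//= ler_pdivrMl// mulr1.
Qed.

Let vw l (i : level_index p l) s (f : cellt s) : v f * w i f = z i f.
Proof.
rewrite /w; case: eqP => [v0|/eqP v0]; last by rewrite mulVKf.
have /andP[z0 zv] := z_bounds i f.
by rewrite mulr0; apply/eqP; rewrite eq_le z0 -[X in _ <= X]v0 zv.
Qed.

Let M l (i : level_index p l) s (x : X) : R := w i (prof s x).

Let M01 l (i : level_index p l) s x : 0 <= M i s x <= 1.
Proof. exact: w01. Qed.

Let bM l (i : level_index p l) s : bmf (M i s).
Proof. exact: (finlab_bmf (fun f => w i f) (@mprof s)). Qed.

Let integral_M l (i : level_index p l) s (h : cellt s -> R) :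
  \int[mu]_x (M i s x * h (prof s x)) = \sum_f h f * z i f.
Proof.
rewrite (Ex_label mu (fun f => w i f * h f) (@mprof s)).
by apply: eq_bigr => f _; rewrite -vw -vE; ring.
Qed.

Let mart l (i : level_index p l) : is_martingale mu prof (M i).
Proof.
split.
- exact: mprof.
- move=> s; exists (@parent_cell q s K) => x.
  exact: (profile_parent s x cS).
- by move=> s; exists (fun f => w i f).
- by move=> s x; exact: M01.
move=> s h; rewrite integral_M.
transitivity (\int[mu]_x (M i s.+1 x * h (parent_cell (prof s.+1 x)))).
  apply: eq_Ex => x; congr (_ * h _).
  exact: (profile_parent s x cS).
rewrite (integral_M i (fun g => h (parent_cell g))).
rewrite (partition_big (@parent_cell q s K) predT)//=.
apply: eq_bigr => f _; rewrite -z_refine mulr_sumr.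
by apply: eq_bigr => g /eqP ->.
Qed.

Let mart_later l (i : level_index p l) s (f : cellt s) t :
  \int[mu]_x (M i (t + s)%N x * (prof s x == f)%:R) = z i f.
Proof.
suff H t' : exists2 h : cellt (t' + s)%N -> R,
    forall x, (prof s x == f)%:R = h (prof (t' + s)%N x) &
    \int[mu]_x (M i (t' + s)%N x * h (prof (t' + s)%N x)) = z i f.
  have [h hE <-] := H t; by apply: eq_Ex => x; rewrite hE.
elim: t' => [|t' [h hE hz]].
  exists (fun g => (g == f)%:R) => //.
  rewrite (integral_M i (fun g => (g == f)%:R)) (bigD1 f)//= eqxx mul1r.
  by rewrite big1 ?addr0// => g /negbTE ->; rewrite mul0r.
exists (fun g => h (parent_cell g)) => [x|].
  by rewrite hE; congr h; exact: (profile_parent (t' + s)%N x cS).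
have [_ _ _ _ /(_ (t' + s)%N h) E] := mart i.
rewrite -hz -E; apply: eq_Ex => x; congr (_ * h _); symmetry.
exact: (profile_parent (t' + s)%N x cS).
Qed.

(* On null cells the weights do not add up along the tree. *)
Let good : set X := [set x |
  (forall l (i : level_index p l), cauchy_set (M i) x) /\
  (forall s, v (prof s x) != 0)].

Let goodE : good =
  (\bigcap_l \bigcap_(i in [set: level_index p l]) cauchy_set (M i)) `&`
  \bigcap_s ((@prof s) @^-1` [set f | v f != 0]).
Proof.
apply/seteqP; split=> x [Cx vx]; split.
- by move=> l _ i _; exact: Cx.
- by move=> s _; exact: vx.
- by move=> l i; exact: (Cx l I i I).
- by move=> s; exact: (vx s I).
Qed.

Let mcauchy l (i : level_index p l) : measurable (cauchy_set (M i)).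
Proof. by apply: measurable_cauchy_set => s; exact: bM. Qed.

Let mgood : measurable good.
Proof.
rewrite goodE; apply: measurableI.
  apply: bigcap_measurable => [|l _]; first by exists 0%N.
  by apply: fin_bigcap_measurable => // i _; exact: mcauchy.
apply: bigcap_measurable => [|s _]; first by exists 0%N.
exact: finlab_preimage.
Qed.

Let null_cells s : mu ((@prof s) @^-1` [set f | v f = 0]) = 0%E.
Proof.
set A := _ @^-1` _; have mA : measurable A by exact: finlab_preimage.
have : \int[mu]_x \1_A x = 0.
  transitivity (\int[mu]_x ((v (prof s x) == 0)%:R : R)).
    apply: eq_Ex => x; rewrite indicE; congr (_ : bool)%:R.
    by apply/idP/eqP; rewrite inE.
  rewrite (Ex_label mu (fun f => (v f == 0)%:R) (@mprof s)); apply: big1 => f _.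
  by rewrite -vE; case: eqP => [->|]; rewrite ?mulr0 ?mul0r.
rewrite Ex_indic// => A0.
rewrite -(@fineK _ (mu A)) ?fin_num_measure//; by rewrite [X in X%:E]A0.
Qed.

Let null_bad : mu.-negligible (~` good).
Proof.
rewrite goodE setCI; apply: negligibleU.
  rewrite setC_bigcap; apply: negligible_bigcup => l.
  have -> : ~` (\bigcap_(i in [set: level_index p l]) cauchy_set (M i)) =
      \bigcup_n (if unpickle n is Some i then ~` cauchy_set (M (i : level_index p l))
                 else set0).
    rewrite setC_bigcap; apply/seteqP; split=> x.
      by move=> [i _ ix]; exists (pickle i) => //; rewrite pickleK.
    by move=> [n _]; case: unpickle => // i ix; exists i.
  apply: negligible_bigcup => n; case: unpickle => [i|]; last exact: negligible_set0.
  apply/negligibleP; first by apply: measurableC; exact: mcauchy.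
  exact: (martingale_cauchy (mart i)).
rewrite setC_bigcap; apply: negligible_bigcup => s.
rewrite (_ : ~` _ = (@prof s) @^-1` [set f | v f = 0]).
  by apply/negligibleP; [exact: finlab_preimage|exact: null_cells].
by apply/seteqP; split=> x /=; [move/negP; rewrite negbK => /eqP|move=> ->;
  rewrite eqxx].
Qed.

Let root_cell : cellt 0 := [ffun=> tt].

(** On the exceptional set the limits are replaced by the masses of the trivial
    partition, because these are constants, hence measurable and symmetric, and
    satisfy exactly the linear relations that the limits satisfy elsewhere. *)
Definition limit_graphon l (i : level_index p l) (x : X) : R :=
  if x \in good then limn (fun s => M i s x) else z i root_cell.

Let good_cvg l (i : level_index p l) x : good x ->
  M i s x @[s --> \oo] --> limit_graphon i x.
Proof.
move=> gx; rewrite /limit_graphon mem_set//.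
by have [/(_ l i)/cauchy_set_cvg] := gx.
Qed.

Let v_root : v root_cell = 1.
Proof.
rewrite vE -[RHS](Ex_cst mu); apply: eq_Ex => x.
rewrite (_ : prof 0 x = root_cell) ?eqxx//.
by apply/ffunP => a; rewrite !ffunE; case: (c _ _).
Qed.

Let limit_graphon01 l (i : level_index p l) x : 0 <= limit_graphon i x <= 1.
Proof.
have [gx|/negbTE gx] := boolP (x \in good); last first.
  by rewrite /limit_graphon gx -v_root z_bounds.
have cv := @good_cvg _ i _ (set_mem gx).
have cvgM : cvgn (fun s => M i s x) by apply/cvg_ex; eexists; exact: cv.
rewrite -(cvg_lim _ cv)//; apply/andP; split.
  by apply: limr_ge => //; apply: nearW => s; have /andP[] := M01 i s x.
by apply: limr_le => //; apply: nearW => s; have /andP[] := M01 i s x.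
Qed.

Let limit_graphon_bmf l (i : level_index p l) : bmf (limit_graphon i).
Proof.
apply: bmf01; last exact: limit_graphon01.
have bg : bmf (\1_good : X -> R) by exact: bmf_indic.
have bng := bmfB (bmf_cst X (1 : R)) bg.
apply: (measurable_fun_cvg
  (h := fun s x => M i s x * \1_good x + z i root_cell * (1 - \1_good x))).
  by move=> s; case: (bmfD (bmfM (bM i s) bg) (bmfM (bmf_cst _ (z i root_cell)) bng)).
move=> x _; rewrite indicE; have [gx|/negbTE gx] := boolP (x \in good).
  under eq_cvg do rewrite mulr1 subrr mulr0 addr0.
  exact: good_cvg (set_mem gx).
under eq_cvg do rewrite mulr0 subr0 mulr1 add0r.
rewrite /limit_graphon gx; exact: cvg_cst.
Qed.

Let M_perm l (i : level_index p l) s (t : 'S_K) x :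
  M i s (x \o perm_rset_lt t) = M i s x.
Proof.
have vp (f : cellt s) : v (permute_cell t f) = v f by rewrite -!z_root z_perm.
by rewrite /M /prof (profile_perm t x (sc s)) /w vp z_perm.
Qed.

Let good_perm (t : 'S_K) x : good (x \o perm_rset_lt t) <-> good x.
Proof.
have vp s (f : cellt s) : v (permute_cell t f) = v f by rewrite -!z_root z_perm.
have profp s : prof s (x \o perm_rset_lt t) = permute_cell t (prof s x).
  exact: profile_perm.
have cp l (i : level_index p l) :
    cauchy_set (M i) (x \o perm_rset_lt t) = cauchy_set (M i) x.
  apply/propext; split=> H m _; have [N _ HN] := H m I; exists N => // j _ /=;
    by have := HN j I; rewrite /= !M_perm.
split=> -[Cx vx]; split.
- by move=> l i; rewrite -cp.
- by move=> s; have := vx s; rewrite profp vp.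
- by move=> l i; rewrite cp.
- by move=> s; rewrite profp vp.
Qed.

Let limit_graphon_perm l (i : level_index p l) (t : 'S_K) x :
  limit_graphon i (x \o perm_rset_lt t) = limit_graphon i x.
Proof.
rewrite /limit_graphon.
have -> : (x \o perm_rset_lt t \in good) = (x \in good).
  by apply/idP/idP; rewrite !inE => gx; exact/(good_perm t).
case: ifP => // _; congr (limn _); apply/funext => s; exact: M_perm.
Qed.

Let limit_graphon_root x : limit_graphon (l := 0) tt x = 1.
Proof.
have [gx|/negbTE gx] := boolP (x \in good); last first.
  by rewrite /limit_graphon gx z_root v_root.
have cv := @good_cvg 0 tt _ (set_mem gx).
rewrite -(cvg_lim _ cv)//.
have [_ vx] := set_mem gx.
rewrite (_ : (fun s => M (l := 0) tt s x) = fun=> 1) ?lim_cst//.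
apply/funext => s; rewrite /M /w z_root; have := vx s.
by case: ifPn => // v0 _; rewrite mulVf.
Qed.

Let limit_graphon_sum l (i : level_index p l) x :
  \sum_j limit_graphon (l := l.+1) (i, j) x = limit_graphon i x.
Proof.
have [gx|/negbTE gx] := boolP (x \in good); last first.
  by rewrite /limit_graphon gx z_sum.
have cv := @good_cvg _ i _ (set_mem gx).
have cvs : \sum_j M (l := l.+1) (i, j) s x @[s --> \oo] -->
    \sum_j limit_graphon (l := l.+1) (i, j) x.
  apply: (cvg_sum_fin (u := fun j s => M (l := l.+1) (i, j) s x)) => j.
  exact: (@good_cvg l.+1 (i, j) _ (set_mem gx)).
have [_ vx] := set_mem gx.
have E : (fun s => \sum_j M (l := l.+1) (i, j) s x) = (fun s => M i s x).
  apply/funext => s; rewrite /M /w (negbTE (vx s)) -mulr_sumr.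
  by rewrite z_sum.
rewrite E in cvs.
exact: (cvg_unique _ cvs cv).
Qed.

(* The integral of the martingale over a cell of level [s] is constant from
   time [s] on. *)
Let limit_mass l (i : level_index p l) s (f : cellt s) :
  \int[mu]_x (limit_graphon i x * (prof s x == f)%:R) = z i f.
Proof.
have bc := bmf_cell R f (@mprof s).
have bl := bmfM (limit_graphon_bmf i) bc.
have cv : \int[mu]_x (M i (t + s)%N x * (prof s x == f)%:R) @[t --> \oo] -->
    \int[mu]_x (limit_graphon i x * (prof s x == f)%:R).
  apply: (@Ex_cvg _ _ _ mu _ _ 1).
  - by move=> t; case: (bmfM (bM i (t + s)%N) bc).
  - by case: bl.
  - move=> t x; rewrite normrM -[leRHS]mulr1 ler_pM//.
      by have /andP[? ?] := M01 i (t + s)%N x; rewrite ger0_norm.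
    by case: (_ == f); rewrite /= ?normr1 ?normr0 ?ler01.
  apply: (negligibleS _ null_bad) => x /= nc gx; apply: nc.
  apply: cvgM; last exact: cvg_cst.
  by rewrite (cvg_shiftn s (fun t => M i t x)); exact: good_cvg.
rewrite (_ : (fun t => \int[mu]_x _) = fun=> z i f) in cv; last first.
  by apply/funext => t; exact: mart_later.
by rewrite -(cvg_lim (@Rhausdorff R) cv) lim_cst//; exact: Rhausdorff.
Qed.

(** The hypotheses on [z] are the relations satisfied by the integrals of the
    hypergraphons of a branching partition over the cells of [Qt]. *)
Lemma realize_limit : exists Pt : branching_partition R K p,
  (forall l (i : level_index p l) s (f : cellt s),
    cell_vol (k := K) (Qt s) f *
      cell_weight (k := K) (set_graphon (Pt l i)) (Qt s) f = z i f) /\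
  (forall l (i : level_index p l), {ae mu, forall x,
    stepping (k := K) (set_graphon (Pt l i)) (Qt s) x @[s --> \oo] -->
      set_graphon (Pt l i) x}).
Proof.
have [|||||Pt PtE] := @realize_tree R k.+1 p hp limit_graphon.
- by move=> l i; exact: limit_graphon_bmf.
- by move=> l i t y; exact: limit_graphon_perm.
- by move=> l i x; have /andP[] := limit_graphon01 i x.
- exact: limit_graphon_root.
- exact: limit_graphon_sum.
have mass l (i : level_index p l) s (f : cellt s) :
    cell_vol (k := K) (Qt s) f *
      cell_weight (k := K) (set_graphon (Pt l i)) (Qt s) f = z i f.
  rewrite PtE (cell_weightE (K := K) (@Qc s)) (cell_volE (K := K) (@Qc s)).
  rewrite (lab_vol_weight mu f (limit_graphon_bmf i) (@mprof s)).
  exact: limit_mass.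
exists Pt; split => // l i.
apply: (negligibleS _ null_bad) => x /= nc gx; apply: nc.
rewrite [X in _ --> X](_ : _ = limit_graphon i x); last by rewrite PtE.
have -> : (fun s => stepping (k := K) (set_graphon (Pt l i)) (Qt s) x) =
    (fun s => M i s x); last exact: good_cvg.
apply/funext => s; rewrite (steppingE (K := K) (@Qc s)) /cond_exp.
have [_ /(_ s) vx] := gx.
rewrite -(cell_weightE (K := K) (@Qc s)).
apply: (mulfI vx); rewrite vw; exact: mass.
Qed.

End limit.

(** * Extracting subsequences *)

Section subsequences.
Context (R : realType).

Definition extraction (phi : nat -> nat) : Prop :=
  forall m n, (m < n)%N -> (phi m < phi n)%N.

Lemma extraction_comp phi psi : extraction phi -> extraction psi ->
  extraction (phi \o psi).
Proof. by move=> ephi epsi m n mn; apply: ephi; exact: epsi. Qed.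

Lemma extraction_cvg phi : extraction phi -> phi @ \oo --> \oo.
Proof.
move=> ephi A [N _ NA]; exists N => // n /= Nn; apply: NA => /=.
apply: (leq_trans Nn); elim: n {Nn} => // n IHn.
by apply: (leq_ltn_trans IHn); exact: ephi.
Qed.

Lemma cvg_extraction (T : topologicalType) (u : nat -> T) (F : set_system T) phi :
  extraction phi -> u n @[n --> \oo] --> F -> u (phi n) @[n --> \oo] --> F.
Proof. by move=> /extraction_cvg ephi; exact: cvg_comp. Qed.

(** Limits along one ultrafilter serve all the sequences at once; the [n]-th term
    of the subsequence is then chosen where the first [n] sequences are within
    [1/n] of their limits. *)
Lemma common_subsequence (J : countType) (a : J -> nat -> R) :
  (forall j n, 0 <= a j n <= 1) ->
  exists2 phi, extraction phi &
    exists z : J -> R, forall j, a j (phi n) @[n --> \oo] --> z j.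
Proof.
move=> a01.
have [G [GU sG]] := @ultraFilterLemma nat \oo _.
have /choice[z zP] : forall j, exists z : R, a j @ G --> z.
  move=> j; have Ga : (a j @ G) `[0, 1]%classic.
    by apply: sG; exists 0%N => // n _ /=; rewrite in_itv /=; exact: a01.
  have [z [_ clz]] := @segment_compact R 0 1 (a j @ G) _ Ga.
  exists z => V nV; have [//|GC] := in_ultra_setVsetC (a j @^-1` V) GU.
  by have [y []] := clz (~` V) V GC nV.
pose close n m := forall j : J, (pickle j <= n)%N -> `|a j m - z j| <= n.+1%:R^-1.
have closeG n : G (close n).
  have H i : G [set m | forall j : J, pickle j = i -> `|a j m - z j| <= n.+1%:R^-1].
    case: (pselect (exists j : J, pickle j = i)) => [[j ji]|no]; last first.
      by apply: filterS filterT => m _ j ji; exfalso; apply: no; exists j.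
    have n0 : 0 < n.+1%:R^-1 :> R by rewrite invr_gt0.
    have /cvgrPdist_le/(_ _ n0) := zP j; apply: filterS => m /= d j' j'i.
    have -> : j' = j by apply: (pcan_inj pickleK); rewrite ji j'i.
    by rewrite distrC.
  suff : forall b, G [set m | forall j : J, (pickle j < b)%N ->
      `|a j m - z j| <= n.+1%:R^-1] by move=> /(_ n.+1).
  elim=> [|b IHb]; first by apply: filterS filterT.
  apply: filterS (filterI IHb (H b)) => m [mb mH] j.
  by rewrite ltnS leq_eqVlt => /predU1P[|]; [exact: mH|exact: mb].
have pick n N : exists m, (N < m)%N /\ close n m.
  apply: (@filter_ex _ G); apply: filterI; last exact: closeG.
  by apply: sG; exists N.+1.
have /choice[f fP] : forall nN : nat * nat, exists m, (nN.2 < m)%N /\ close nN.1 m.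
  by move=> [n N]; exact: pick.
pose phi := fix phi n := if n is n'.+1 then f (n'.+1, phi n') else f (0, 0)%N.
have phiS n : (phi n < phi n.+1)%N by have [] := fP (n.+1, phi n).
have phi_close n : close n (phi n).
  by case: n => [|n] /=; [have [] := fP (0, 0)%N|have [] := fP (n.+1, phi n)].
exists phi.
  move=> m n; elim: n => // n IHn; rewrite ltnS leq_eqVlt => /predU1P[-> //|mn].
  exact: (ltn_trans (IHn mn) (phiS n)).
exists z => j; apply/cvgrPdist_le => e e0.
have [N _ HN] := near_infty_natSinv_lt (PosNum e0).
exists (maxn N (pickle j)) => // n /=; rewrite geq_max => /andP[Nn jn].
rewrite distrC; apply: (le_trans (phi_close n j jn)).
by apply: ltW; exact: HN.
Qed.

End subsequences.

Lemma partitionably_converges_extraction (R : realType) k p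
    (P : nat -> branching_partition R k.+1 p) Pt phi : extraction phi ->
  partitionably_converges P Pt -> partitionably_converges (P \o phi) Pt.
Proof.
move=> ephi; elim: k p P Pt => [|k IHk] p P Pt /=.
  by move=> H l i; exact: cvg_extraction ephi (H l i).
move=> [q [Q [Qt [hq reg QQt quot ae_step]]]].
exists q, (Q \o phi), Qt; split.
- exact: hq.
- by move=> n; exact: reg.
- exact: (IHk _ _ _ QQt).
- by move=> s l i s0 l0; exact: cvg_extraction ephi (quot s l i s0 l0).
- exact: ae_step.
Qed.

(** * Compactness *)

Section compactness.
Context (R : realType).

Lemma seq_limit_unique (u : nat -> R) (a b : R) :
  u n @[n --> \oo] --> a -> u n @[n --> \oo] --> b -> a = b.
Proof. by move=> ua ub; rewrite -(cvg_lim _ ua)// (cvg_lim _ ub). Qed.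

Lemma graphon_children K p (P : branching_partition R K.+1 p) l
    (i : level_index p l) y :
  \sum_j set_graphon (P l.+1 (i, j)) y = set_graphon (P l i) y.
Proof.
have [c [mc _ Pc cS]] := branching_label P.
have mP l' i' : measurable (P l' i') by exact: measurable_level.
have mt := @measurable_add_top2 R K.+1 y.
rewrite /set_graphon -Ex_sum => [|j _]; last first.
  exact: (bmf_comp mt (bmf_indic R (mP l.+1 (i, j)))).
apply: eq_Ex => t; have indE l' i' x : \1_(P l' i') x = (c l' x == i')%:R :> R.
  rewrite Pc indicE; congr (_ : bool)%:R.
  by apply/idP/eqP => [|ci]; rewrite inE.
rewrite (eq_bigr (fun j => (c l.+1 (add_top y t) == (i, j))%:R)) => [|j _];
  last exact: indE.
rewrite indE (cS l).
case: (c l.+1 (add_top y t)) => i' j' /=.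
have [i'i|i'i] := eqVneq i' i; last first.
  by apply: big1 => j _; case: eqP => // -[ij _]; rewrite ij eqxx in i'i.
subst i'; rewrite (bigD1 j')//= eqxx big1 ?addr0// => j jj'.
by case: eqP => // -[ij]; rewrite ij eqxx in jj'.
Qed.

Lemma graphon_root K p (P : branching_partition R K.+1 p) y :
  set_graphon (P 0%N tt) y = 1.
Proof.
rewrite level0 /set_graphon -[RHS](Ex_cst (@unitI_lebesgue R)).
by apply: eq_Ex => t; rewrite indicE in_setT.
Qed.

(** Here a hypergraphon is a number, the measure of the part. *)
Lemma compactness_base p (hp : positive_degrees p)
    (P : nat -> branching_partition R 1 p) :
  exists Pt : branching_partition R 1 p,
    exists2 phi, extraction phi & partitionably_converges (P \o phi) Pt.
Proof.
pose J : countType := {l : nat & level_index p l}.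
pose a (j : J) n := fine (cube_lebesgue R (rset 1) (P n _ (tagged j))).
have aE j n : a j n =
    \int[cube_lebesgue R (rset_lt 1)]_y set_graphon (P n _ (tagged j)) y.
  by rewrite -Ex_set_graphon//; exact: measurable_level.
have bW n l i : bmf (set_graphon (P n l i)).
  by apply: bmf_set_graphon; exact: measurable_level.
have W01 n l i y : 0 <= set_graphon (P n l i) y <= 1.
  by have [_ /(_ y)] := set_graphon01 (measurable_level (P n) i).
have [|phi ephi [z za]] := common_subsequence (a := a).
  by move=> j n; rewrite aE; apply: Ex_01.
pose zz l (i : level_index p l) : R := z (existT _ l i).
have zz_lim l (i : level_index p l) :
    \int[cube_lebesgue R (rset_lt 1)]_y set_graphon (P (phi n) l i) y
      @[n --> \oo] --> zz l i.
  by have := za (existT _ l i); under eq_cvg do rewrite aE.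
have [|||||Pt PtE] := @realize_tree R 0 p hp (fun l i _ => zz l i).
- by move=> l i; exact: bmf_cst.
- by [].
- move=> l i _; apply: (cvgr_to_ge (zz_lim l i)).
  by apply: nearW => n; apply: Ex_ge0 => y; case/andP: (W01 (phi n) l i y).
- move=> _; apply: (seq_limit_unique (zz_lim 0%N tt)).
  under eq_cvg => n.
    rewrite (eq_Ex _ (g := fun=> 1)) ?Ex_cst; last exact: graphon_root.
    over.
  exact: cvg_cst.
- move=> l i _.
  have cvs : \sum_j \int[cube_lebesgue R (rset_lt 1)]_y
      set_graphon (P (phi n) l.+1 (i, j)) y @[n --> \oo] -->
      \sum_j zz l.+1 (i, j).
    apply: (cvg_sum_fin (u := fun j n => \int[cube_lebesgue R (rset_lt 1)]_y
      set_graphon (P (phi n) l.+1 (i, j)) y)) => j.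
    exact: zz_lim.
  apply: (seq_limit_unique cvs).
  have E n : \sum_j \int[cube_lebesgue R (rset_lt 1)]_y
      set_graphon (P (phi n) l.+1 (i, j)) y =
      \int[cube_lebesgue R (rset_lt 1)]_y set_graphon (P (phi n) l i) y.
    rewrite -Ex_sum => [|j _]; last exact: bW.
    by apply: eq_Ex => y; exact: graphon_children.
  by under eq_cvg do rewrite E; exact: zz_lim.
exists Pt, phi => // l i /=.
have finE (S : set (cube R (rset 1))) : measurable S ->
    cube_lebesgue R (rset 1) S =
    (\int[cube_lebesgue R (rset_lt 1)]_y set_graphon S y)%:E.
  by move=> mS; rewrite -Ex_set_graphon// fineK// fin_num_measure.
rewrite finE; last exact: measurable_level.
under eq_cvg do rewrite (finE _ (measurable_level _ _)).
apply: cvg_EFin; first exact: nearW.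
rewrite PtE Ex_cst; exact: zz_lim.
Qed.

(** The integrals [mass] of the hypergraphons over the cells of the regularizing
    partitions are what has to converge besides those partitions themselves. *)
Lemma compactness_step k
  (IHk : forall p (hp : positive_degrees p)
    (P : nat -> branching_partition R k.+1 p),
    exists Pt : branching_partition R k.+1 p,
      exists2 phi, extraction phi & partitionably_converges (P \o phi) Pt)
  p (hp : positive_degrees p) (P : nat -> branching_partition R k.+2 p) :
  exists Pt : branching_partition R k.+2 p,
    exists2 phi, extraction phi & partitionably_converges (P \o phi) Pt.
Proof.
set mu := cube_lebesgue R (rset_lt k.+2).
have [q hq regq] := regular_branching R k p.
have /choice[Q reg] := fun n => regq (P n).
have [Qt [phi1 ephi1 QQt]] := IHk q hq Q.
pose J : countType := ({l : nat & level_index p l} *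
  {s : nat & {ffun 'I_k.+2 -> level_index q s}})%type.
pose mass n l (i : level_index p l) s (f : {ffun 'I_k.+2 -> level_index q s}) : R :=
  \int[mu]_x (set_graphon (P n l i) x * cell_indic (k := k.+2) (Q n s) f x).
have mQ n s j : measurable (Q n s j) by exact: measurable_level.
have bcell n s f : bmf (cell_indic (k := k.+2) (Q n s) f).
  by apply: bmf_prod => a _; apply: (bmf_comp (measurable_reindex _));
    exact: bmf_indic.
have cell01 n s f x : 0 <= cell_indic (k := k.+2) (Q n s) f x <= 1.
  by apply: prod01 => a; exact: indic01.
have bW n l i : bmf (set_graphon (P n l i)).
  by apply: bmf_set_graphon; exact: measurable_level.
have W01 n l i y : 0 <= set_graphon (P n l i) y <= 1.
  by have [_ /(_ y)] := set_graphon01 (measurable_level (P n) i).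
have mass_bounds n l i s f : 0 <= mass n l i s f <= cell_vol (k := k.+2) (Q n s) f.
  apply/andP; split.
    apply: Ex_ge0 => x; have /andP[? _] := W01 n l i x.
    by have /andP[? _] := cell01 n s f x; rewrite mulr_ge0.
  apply: (Ex_le mu (bmfM (bW n l i) (bcell n s f)) (bcell n s f)) => x.
  have /andP[w0 w1] := W01 n l i x; have /andP[? _] := cell01 n s f x.
  by rewrite ler_piMl.
have vol_le1 n s f : cell_vol (k := k.+2) (Q n s) f <= 1.
  by have /andP[] := Ex_01 mu (bcell n s f) (cell01 n s f).
pose a (j : J) n := mass (phi1 n) _ (tagged j.1) _ (tagged j.2).
have [|phi2 ephi2 [z za]] := common_subsequence (a := a).
  move=> j n; have /andP[m0 m1] := mass_bounds (phi1 n) _ (tagged j.1) _ (tagged j.2).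
  by rewrite /a m0 (le_trans m1).
pose phi := phi1 \o phi2.
have ephi : extraction phi by exact: extraction_comp.
have QQt' : partitionably_converges (fun n => Q (phi n)) Qt.
  exact: partitionably_converges_extraction ephi2 QQt.
pose zz l (i : level_index p l) s (f : {ffun 'I_k.+2 -> level_index q s}) : R :=
  z (existT _ l i, existT _ s f).
have zz_lim l (i : level_index p l) s f :
    mass (phi n) l i s f @[n --> \oo] --> zz l i s f.
  exact: (za (existT _ l i, existT _ s f)).
have vol_lim s (f : {ffun 'I_k.+2 -> level_index q s}) :
    cell_vol (k := k.+2) (Q (phi n) s) f @[n --> \oo] -->
    cell_vol (k := k.+2) (Qt s) f.
  have [miss volE] := cell_vol_density R k.
  have mQt j : measurable (Qt s j) by exact: measurable_level.
  rewrite (volE _ (Qt s) f mQt).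
  under eq_cvg do rewrite (volE _ _ f (mQ _ s)).
  exact: (@counting_lemma _ _ _ _ _ QQt' k.+2 s (fun d => f (miss d))).
have /choice[cl clP] := fun n => branching_label (Q n).
have [ct [mct sct Qct ctS]] := branching_label Qt.
have mp n s : finlab (profile (K := k.+2) (cl n s)).
  by have [mcl _ _ _] := clP n; exact: finlab_profile.
have massE n l i s f : mass n l i s f =
    \int[mu]_x (set_graphon (P n l i) x * (profile (K := k.+2) (cl n s) x == f)%:R).
  have [_ _ Qcl _] := clP n.
  by apply: eq_Ex => x; rewrite (cell_indicE (K := k.+2) (@Qcl s)).
have mass_weight n l i s f :
    cell_vol (k := k.+2) (Q n s) f *
    cell_weight (k := k.+2) (set_graphon (P n l i)) (Q n s) f = mass n l i s f.
  have [_ _ Qcl _] := clP n.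
  rewrite massE (cell_weightE (K := k.+2) (@Qcl s)) (cell_volE (K := k.+2) (@Qcl s)).
  exact: (lab_vol_weight mu f (bW n l i) (mp n s)).
have bc n s f := bmf_cell R f (mp n s).
have zz_bounds l (i : level_index p l) s f :
    0 <= zz l i s f <= cell_vol (k := k.+2) (Qt s) f.
  apply/andP; split.
    apply: (cvgr_to_ge (zz_lim l i s f)); apply: nearW => n.
    by have /andP[] := mass_bounds (phi n) l i s f.
  apply: (ler_cvg_to (zz_lim l i s f) (vol_lim s f)); apply: nearW => n.
  by have /andP[] := mass_bounds (phi n) l i s f.
have zz_root s f : zz 0%N tt s f = cell_vol (k := k.+2) (Qt s) f.
  apply: (seq_limit_unique (zz_lim 0%N tt s f)).
  have E n : mass n 0%N tt s f = cell_vol (k := k.+2) (Q n s) f.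
    by apply: eq_Ex => x; rewrite graphon_root mul1r.
  by under eq_cvg do rewrite E; exact: vol_lim.
have zz_sum l (i : level_index p l) s f :
    \sum_j zz l.+1 (i, j) s f = zz l i s f.
  have cvs : \sum_j mass (phi n) l.+1 (i, j) s f @[n --> \oo] -->
      \sum_j zz l.+1 (i, j) s f.
    apply: (cvg_sum_fin (u := fun j n => mass (phi n) l.+1 (i, j) s f)) => j.
    exact: zz_lim.
  apply: (seq_limit_unique cvs).
  have E n : \sum_j mass n l.+1 (i, j) s f = mass n l i s f.
    rewrite /mass -Ex_sum => [|j _]; last exact: (bmfM (bW n l.+1 (i, j)) (bcell n s f)).
    by apply: eq_Ex => x; rewrite -mulr_suml graphon_children.
  by under eq_cvg do rewrite E; exact: zz_lim.
have zz_refine l (i : level_index p l) s f :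
    \sum_(g : {ffun 'I_k.+2 -> level_index q s.+1} | parent_cell g == f)
      zz l i s.+1 g = zz l i s f.
  have cvs : \sum_(g : {ffun 'I_k.+2 -> level_index q s.+1} | parent_cell g == f)
      mass (phi n) l i s.+1 g @[n --> \oo] -->
      \sum_(g : {ffun 'I_k.+2 -> level_index q s.+1} | parent_cell g == f)
      zz l i s.+1 g.
    by apply: (cvg_big add_continuous) => g _; exact: zz_lim.
  apply: (seq_limit_unique cvs).
  have E n : \sum_(g : {ffun 'I_k.+2 -> level_index q s.+1} | parent_cell g == f)
      mass n l i s.+1 g = mass n l i s f.
    under eq_bigr do rewrite massE.
    rewrite massE -Ex_sum => [|g _]; last exact: (bmfM (bW n l i) (bc n s.+1 g)).
    apply: eq_Ex => x; rewrite -mulr_sumr; congr (_ * _).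
    have [_ _ _ clS] := clP n.
    rewrite (profile_parent (K := k.+2) s x clS).
    set g0 := profile _ x; have [g0f|g0f] := eqVneq (parent_cell g0) f.
      rewrite (bigD1 g0) ?g0f//= eqxx big1 ?addr0// => g /andP[_ gg0].
      by rewrite eq_sym (negbTE gg0).
    by rewrite big1// => g /eqP gf; case: eqP => // g0g; rewrite g0g gf eqxx in g0f.
  by under eq_cvg do rewrite E; exact: zz_lim.
have zz_perm l (i : level_index p l) s f (t : 'S_k.+2) :
    zz l i s (permute_cell t f) = zz l i s f.
  apply: (seq_limit_unique (zz_lim l i s (permute_cell t f))).
  have E n : mass n l i s (permute_cell t f) = mass n l i s f.
    have [mcl scl _ _] := clP n; rewrite !massE.
    apply: cell_integral_perm => // x; apply: set_graphon_perm.
    by have [_ sP _ _] := level_partition (P n) l; exact: sP.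
  by under eq_cvg do rewrite E; exact: zz_lim.
have [Pt [PtE Pt_ae]] := realize_limit hp zz_bounds zz_root zz_sum zz_refine
  zz_perm mct sct Qct ctS.
exists Pt, phi; first exact: ephi.
exists q, (fun n => Q (phi n)), Qt; split.
- exact: hq.
- by move=> n; exact: reg.
- exact: QQt'.
- move=> s l i _ _; apply/quotient_d1_cvg => f; split; first exact: vol_lim.
  rewrite [X in _ --> X]PtE (_ : (fun n => _) = fun n => mass (phi n) l i s f).
    exact: zz_lim.
  by apply/funext => n; exact: mass_weight.
- exact: Pt_ae.
Qed.

End compactness.

Theorem proposition6p8 (R : realType) (k : nat) (p : nat -> nat)
    (hp : positive_degrees p)
    (P : nat -> branching_partition R k.+1 p) :
  exists Pt : branching_partition R k.+1 p,
    exists2 phi : nat -> nat,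
      (forall m n, (m < n)%N -> (phi m < phi n)%N) &
      partitionably_converges (fun n => P (phi n)) Pt.
Proof.
elim: k p hp P => [|k IHk] p hp P; first exact: compactness_base.
exact: compactness_step.
Qed.
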